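(* Let $n,k,h$ be integers with $0<k<n$ and $h\geq 2$. If $n\neq 2$, then the dual ordered configuration space $\mathcal{F}_h^{\max(0,n-hk)}(n-k,n)^*$ is a simply connected manifold. If $n=2$, then the fundamental group of $\mathcal{F}_h^{\max(0,n-hk)}(n-k,n)^*$ is isomorphic to the pure braid group on $h$ strings of the sphere, $\pi_1(\mathcal{F}_h(\mathbb{C}\mathbb{P}^1))$.
   Context: For $0<m<n$, $Gr(m,n)^*$ is the Grassmannian manifold parametrizing the $m$-dimensional linear subspaces of the dual space $(\mathbb{C}^n)^*$. For a manifold $M$, $\mathcal{F}_h(M)=\{(x_1,\ldots,x_h)\in M^h\mid x_a\neq x_b \text{ for } a\neq b\}$ is the ordered configuration space of $h$ distinct points in $M$, and the pure braid group on $h$ strings of $M$ is $\pi_1(\mathcal{F}_h(M))$. The $i$th dual ordered configuration space is $$\mathcal{F}_h^i(m,n)^*=\{(H_1,\ldots,H_h)\in\mathcal{F}_h(Gr(m,n)^* )\mid \dim(H_1\cap\cdots\cap H_h)=i\},$$ topologized as a subspace of $(Gr(m,n)^* )^h$. *)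

(* Defs.v *)
(* The complex numbers are [R[i]] for an arbitrary [R : realType]. *)
From HB Require Import structures.
From mathcomp Require Import all_boot all_order all_algebra generic_quotient.
From mathcomp Require Import complex.
From mathcomp Require Import all_classical all_reals all_analysis homotopy.
From mathcomp Require Import ring lra.

Set Implicit Arguments.
Unset Strict Implicit.
Unset Printing Implicit Defensive.

Import Order.TTheory GRing.Theory Num.Theory numFieldNormedType.Exports.
Local Open Scope classical_set_scope.
Local Open Scope ring_scope.

(* The usual topology of the complex plane, given by the modulus. *)
HB.instance Definition _ (R : realType) :=
  PseudoPointedMetric.copy R[i] (R[i])^o.

Section UnitInterval.
Variable R : realType.

Definition unit_interval : Type := set_type (`[(0 : R), 1]%classic).

HB.instance Definition _ := Topological.on unit_interval.

Local Notation I := unit_interval.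

Definition clampR (u : R) : R := Num.max 0 (Num.min 1 u).

Lemma clampR_itv u : clampR u \in `[(0 : R), 1]%classic.
Proof.
by rewrite inE /= in_itv /= /clampR le_max lexx/= ge_max ler01 ge_min lexx.
Qed.

(* The retraction of the real line onto the unit interval. Concatenation and
   reversal of paths only apply it to points of the interval. *)
Definition clamp (u : R) : I := exist _ (clampR u) (clampR_itv u).

Lemma unit_interval_ge0 (t : I) : 0 <= val t.
Proof. by case: t => u /= /[!inE] /=; rewrite in_itv /= => /andP[]. Qed.

Lemma unit_interval_le1 (t : I) : val t <= 1.
Proof. by case: t => u /= /[!inE] /=; rewrite in_itv /= => /andP[]. Qed.

Lemma clamp_val (t : I) : clamp (val t) = t.
Proof.
apply: val_inj; rewrite /= /clampR.
by rewrite min_r ?unit_interval_le1// max_r ?unit_interval_ge0.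
Qed.

Lemma val_clamp u : 0 <= u <= 1 -> val (clamp u) = u.
Proof. by case/andP => u0 u1; rewrite /= /clampR min_r// max_r. Qed.

Lemma val_clamp0 : val (clamp 0) = 0 :> R.
Proof. by rewrite val_clamp// lexx ler01. Qed.

Lemma val_clamp1 : val (clamp 1) = 1 :> R.
Proof. by rewrite val_clamp// lexx ler01. Qed.

Fact unit_interval_01_neq : clamp 0 != clamp 1.
Proof.
by apply/eqP => /(congr1 val); rewrite val_clamp0 val_clamp1 => /eqP;
  rewrite eq_sym oner_eq0.
Qed.

HB.instance Definition _ := isBiPointed.Build unit_interval unit_interval_01_neq.

Lemma val_zero : val (zero : I) = 0. Proof. exact: val_clamp0. Qed.

Lemma val_one : val (one : I) = 1. Proof. exact: val_clamp1. Qed.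

Lemma val_continuous : continuous (val : I -> R).
Proof. exact: initial_continuous. Qed.

Lemma clampR_continuous : continuous clampR.
Proof.
move=> u; apply: (@continuous_max R R (cst 0) (cst 1 \min id) u).
  exact: cst_continuous.
by apply: continuous_min; [exact: cst_continuous|move=> ?; exact: cvg_id].
Qed.

Lemma clamp_continuous : continuous clamp.
Proof.
apply: (@continuous_comp_initial _ _ _ (set_val : I -> R)).
exact: clampR_continuous.
Qed.

End UnitInterval.

Lemma comp_continuous {X Y Z : topologicalType} (f : X -> Y) (g : Y -> Z) :
  continuous f -> continuous g -> continuous (fun x => g (f x)).
Proof. by move=> cf cg x; apply: continuous_comp; [exact: cf|exact: cg]. Qed.

Lemma pair_continuous {X Y Z : topologicalType} (f : X -> Y) (g : X -> Z) :
  continuous f -> continuous g -> continuous (fun x => (f x, g x)).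
Proof. by move=> cf cg x; apply: cvg_pair; [exact: cf|exact: cg]. Qed.

Lemma fst_cont {X Y : topologicalType} : continuous (fst : X * Y -> X).
Proof. by move=> x; exact: cvg_fst. Qed.

Lemma snd_cont {X Y : topologicalType} : continuous (snd : X * Y -> Y).
Proof. by move=> x; exact: cvg_snd. Qed.

Lemma paste_continuous {R : realType} {X T : topologicalType} (u : X -> R)
    (c : R) (f g : X -> T) :
  continuous u -> continuous f -> continuous g ->
  (forall x, u x = c -> f x = g x) ->
  continuous (fun x => if u x <= c then f x else g x).
Proof.
move=> cu cf cg fg; set h := fun x => _.
apply/continuous_subspace_setT.
have -> : [set: X] = (u @^-1` [set y | y <= c]) `|` (u @^-1` [set y | c <= y]).
  by apply/seteqP; split => // x _ /=; case: (lerP (u x) c) => ?;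
    [left|right; exact: ltW].
apply: withinU_continuous.
- by apply: closed_comp => [x _|]; [exact: cu|exact: closed_le].
- by apply: closed_comp => [x _|]; [exact: cu|exact: closed_ge].
- apply: (@subspace_eq_continuous _ _ _ f); last exact: continuous_subspaceT.
  by move=> x /[!inE] /= xc; rewrite /h /from_subspace/= xc.
- apply: (@subspace_eq_continuous _ _ _ g); last exact: continuous_subspaceT.
  move=> x /[!inE] /= xc; rewrite /h /from_subspace/=; case: ifP => // xc'.
  by rewrite fg//; apply/eqP; rewrite eq_le xc xc'.
Qed.

Section RealContinuity.
Context {R : realType} {X : topologicalType}.
Implicit Types f g : X -> R.

Lemma const_cont (c : R) : continuous (fun _ : X => c).
Proof. exact: cst_continuous. Qed.

Lemma add_cont f g :
  continuous f -> continuous g -> continuous (fun x => f x + g x).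
Proof. by move=> cf cg x; apply: cvgD; [exact: cf|exact: cg]. Qed.

Lemma sub_cont f g :
  continuous f -> continuous g -> continuous (fun x => f x - g x).
Proof. by move=> cf cg x; apply: cvgB; [exact: cf|exact: cg]. Qed.

Lemma mul_cont f g :
  continuous f -> continuous g -> continuous (fun x => f x * g x).
Proof. by move=> cf cg x; apply: cvgM; [exact: cf|exact: cg]. Qed.

Lemma min_cont f g :
  continuous f -> continuous g -> continuous (fun x => Num.min (f x) (g x)).
Proof. by move=> cf cg x; apply: continuous_min; [exact: cf|exact: cg]. Qed.

Lemma max_cont f g :
  continuous f -> continuous g -> continuous (fun x => Num.max (f x) (g x)).
Proof. by move=> cf cg x; apply: continuous_max; [exact: cf|exact: cg]. Qed.

End RealContinuity.

Section Homotopy.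
Variable R : realType.
Local Notation I := (unit_interval R).

Section Concatenation.
Variable T : topologicalType.

(* A path, extended to the line by its end values. *)
Definition extend (p : I -> T) (u : R) : T := p (clamp u).

Lemma extend_continuous (p : I -> T) : continuous p -> continuous (extend p).
Proof. by move=> cp; exact: comp_continuous (@clamp_continuous R) cp. Qed.

Definition cat_fun (p q : I -> T) (t : I) : T :=
  if val t <= 2^-1 then extend p (2 * val t) else extend q (2 * val t - 1).

Lemma affine_continuous (a b : R) : continuous (fun t : I => a * val t + b).
Proof.
apply: add_cont; last exact: const_cont.
by apply: mul_cont; [exact: const_cont|exact: val_continuous].
Qed.

Lemma extend_le0 (p : I -> T) u : u <= 0 -> extend p u = p zero.
Proof.
move=> u0; congr p; apply: val_inj; rewrite val_zero /= /clampR max_l//.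
by rewrite ge_min u0 orbT.
Qed.

Lemma extend_ge1 (p : I -> T) u : 1 <= u -> extend p u = p one.
Proof.
move=> u1; congr p; apply: val_inj; rewrite val_one /= /clampR min_l//.
by rewrite max_r.
Qed.

Lemma extend_val (p : I -> T) t : extend p (val t) = p t.
Proof. by rewrite /extend clamp_val. Qed.

Variables (x y z : T).

Section Cat.
Variables (p : {path I from x to y in T}) (q : {path I from y to z in T}).

Fact cat_continuous : continuous (cat_fun p q).
Proof.
apply: paste_continuous; first exact: val_continuous.
- apply: (@comp_continuous I R T (fun t => 2 * val t)).
    by apply: mul_cont; [exact: const_cont|exact: val_continuous].
  by apply: extend_continuous; exact: cts_fun.
- apply: (@comp_continuous I R T (fun t => 2 * val t - 1)).
    exact: affine_continuous.
  by apply: extend_continuous; exact: cts_fun.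
- move=> t ->; rewrite mulfV ?pnatr_eq0// subrr extend_ge1// extend_le0//.
  by rewrite path_one path_zero.
Qed.

Fact cat_zero : cat_fun p q zero = x.
Proof.
by rewrite /cat_fun val_zero invr_ge0 ler0n mulr0 extend_le0// path_zero.
Qed.

Fact cat_one : cat_fun p q one = z.
Proof.
rewrite /cat_fun val_one ifF; last by apply/negbTE; rewrite -ltNge; lra.
by rewrite extend_ge1 ?path_one//; lra.
Qed.

Definition path_cat : {path I from x to z in T} :=
  mk_path cat_continuous cat_zero cat_one.

End Cat.

Section Rev.
Variable p : {path I from x to y in T}.

Definition rev_fun (t : I) : T := extend p (1 - val t).

Fact rev_continuous : continuous rev_fun.
Proof.
apply: (@comp_continuous I R T (fun t => 1 - val t)).
  by apply: sub_cont; [exact: const_cont|exact: val_continuous].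
by apply: extend_continuous; exact: cts_fun.
Qed.

Fact rev_zero : rev_fun zero = y.
Proof. by rewrite /rev_fun val_zero subr0 extend_ge1// path_one. Qed.

Fact rev_one : rev_fun one = x.
Proof. by rewrite /rev_fun val_one subrr extend_le0// path_zero. Qed.

Definition path_rev : {path I from y to x in T} :=
  mk_path rev_continuous rev_zero rev_one.

End Rev.

Definition path_cst : {path I from x to x in T} := cst x.

(* Homotopy relative to the end points. *)
Definition homotopic (p q : {path I from x to y in T}) : Prop :=
  exists H : I * I -> T,
    [/\ continuous H,
        forall t, H (t, zero) = p t /\ H (t, one) = q t &
        forall s, H (zero, s) = x /\ H (one, s) = y].

Lemma homotopic_refl p : homotopic p p.
Proof.
exists (fun w => p w.1); split => [||s]; last by rewrite path_zero path_one.
- exact: comp_continuous (@fst_cont _ _) (@cts_fun _ _ p).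
- by [].
Qed.

Lemma homotopic_sym p q : homotopic p q -> homotopic q p.
Proof.
case=> H [cH Hpq Hxy]; exists (fun w => H (w.1, clamp (1 - val w.2))); split.
- apply: (@comp_continuous (I * I)%type (I * I)%type T
    (fun w => (w.1, clamp (1 - val w.2)))) cH.
  apply: pair_continuous; first exact: fst_cont.
  apply: (@comp_continuous (I * I)%type R I (fun w => 1 - val w.2));
    last exact: clamp_continuous.
  apply: sub_cont; first exact: const_cont.
  exact: comp_continuous (@snd_cont _ _) (@val_continuous R).
- move=> t; cbn [fst snd]; rewrite val_zero val_one subr0 subrr.
  by have [] := Hpq t.
- by move=> s /=; exact: Hxy.
Qed.

Lemma homotopic_trans q p r :
  homotopic p q -> homotopic q r -> homotopic p r.
Proof.
case=> H [cH Hpq Hxy] [K [cK Kqr Kxy]].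
exists (fun w => if val w.2 <= 2^-1 then H (w.1, clamp (2 * val w.2))
                 else K (w.1, clamp (2 * val w.2 - 1))); split.
- have cv : continuous (fun w : I * I => val w.2).
    exact: comp_continuous (@snd_cont _ _) (@val_continuous R).
  have c2 : continuous (fun w : I * I => 2 * val w.2).
    by apply: mul_cont => //; exact: const_cont.
  apply: paste_continuous => //.
  + apply: (@comp_continuous (I * I)%type (I * I)%type T
      (fun w => (w.1, clamp (2 * val w.2)))) cH.
    apply: pair_continuous; first exact: fst_cont.
    exact: comp_continuous c2 (@clamp_continuous R).
  + apply: (@comp_continuous (I * I)%type (I * I)%type T
      (fun w => (w.1, clamp (2 * val w.2 - 1)))) cK.
    apply: pair_continuous; first exact: fst_cont.
    apply: (@comp_continuous (I * I)%type R I (fun w => 2 * val w.2 - 1));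
      last exact: clamp_continuous.
    by apply: sub_cont => //; exact: const_cont.
  + move=> [t s] /= ->; rewrite mulfV ?pnatr_eq0// subrr.
    by have [_ ->] := Hpq t; have [-> _] := Kqr t.
- move=> t; cbn [fst snd]; rewrite val_zero val_one invr_ge0 ler0n mulr0.
  have [-> _] := Hpq t; split => //.
  rewrite ifF; last by apply/negbTE; rewrite -ltNge; lra.
  rewrite mulr1 (_ : 2 - 1 = 1); last by lra.
  by have [_] := Kqr t.
- move=> s; cbn [fst snd]; have [H0 H1] := Hxy (clamp (2 * val s)).
  have [K0 K1] := Kxy (clamp (2 * val s - 1)).
  by rewrite H0 H1 K0 K1; split; case: ifP.
Qed.

(* Two reparametrizations of the same curve are homotopic. *)
Lemma reparam_homotopic (f : R -> T) (u v : I -> R)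
    (p q : {path I from x to y in T}) :
  continuous f -> continuous u -> continuous v ->
  u zero = v zero -> u one = v one ->
  p =1 f \o u -> q =1 f \o v -> homotopic p q.
Proof.
move=> cf cu cv uv0 uv1 pE qE.
exists (fun w => f (u w.1 + val w.2 * (v w.1 - u w.1))); split.
- apply: (@comp_continuous (I * I)%type R T
    (fun w => u w.1 + val w.2 * (v w.1 - u w.1))) cf.
  have cu1 : continuous (fun w : I * I => u w.1).
    exact: comp_continuous (@fst_cont _ _) cu.
  apply: add_cont => //; apply: mul_cont; last first.
    by apply: sub_cont => //; exact: comp_continuous (@fst_cont _ _) cv.
  exact: comp_continuous (@snd_cont _ _) (@val_continuous R).
- move=> t; cbn [fst snd]; rewrite val_zero val_one mul0r mul1r addr0 pE qE.
  by rewrite addrC subrK.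
- move=> s; cbn [fst snd]; rewrite -uv0 -uv1 !subrr !mulr0 !addr0; split.
    by rewrite -[LHS]/((f \o u) zero) -pE path_zero.
  by rewrite -[LHS]/((f \o u) one) -pE path_one.
Qed.

End Concatenation.

Lemma homotopic_cat (T : topologicalType) (x y z : T)
    (p p' : {path I from x to y in T}) (q q' : {path I from y to z in T}) :
  homotopic p p' -> homotopic q q' -> homotopic (path_cat p q) (path_cat p' q').
Proof.
case=> H [cH Hp Hxy] [K [cK Kq Kyz]].
exists (fun w => if val w.1 <= 2^-1 then H (clamp (2 * val w.1), w.2)
                 else K (clamp (2 * val w.1 - 1), w.2)); split.
- have cv : continuous (fun w : I * I => val w.1).
    exact: comp_continuous (@fst_cont _ _) (@val_continuous R).
  have c2 : continuous (fun w : I * I => 2 * val w.1).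
    by apply: mul_cont => //; exact: const_cont.
  apply: paste_continuous => //.
  + apply: (@comp_continuous (I * I)%type (I * I)%type T
      (fun w => (clamp (2 * val w.1), w.2))) cH.
    apply: pair_continuous; last exact: snd_cont.
    exact: comp_continuous c2 (@clamp_continuous R).
  + apply: (@comp_continuous (I * I)%type (I * I)%type T
      (fun w => (clamp (2 * val w.1 - 1), w.2))) cK.
    apply: pair_continuous; last exact: snd_cont.
    apply: (@comp_continuous (I * I)%type R I (fun w => 2 * val w.1 - 1));
      last exact: clamp_continuous.
    by apply: sub_cont => //; exact: const_cont.
  + move=> [t s] /= ->; rewrite mulfV ?pnatr_eq0// subrr.
    by have [_ ->] := Hxy s; have [-> _] := Kyz s.
- move=> t; have [Hp0 Hp1] := Hp (clamp (2 * val t)).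
  have [Kq0 Kq1] := Kq (clamp (2 * val t - 1)).
  by cbn [fst snd]; rewrite Hp0 Hp1 Kq0 Kq1.
- move=> s; cbn [fst snd]; rewrite val_zero val_one invr_ge0 ler0n mulr0.
  split; first by have [] := Hxy s.
  rewrite ifF; last by apply/negbTE; rewrite -ltNge; lra.
  rewrite mulr1 (_ : 2 - 1 = 1); last by lra.
  by have [] := Kyz s.
Qed.

Lemma homotopic_rev (T : topologicalType) (x y : T)
    (p q : {path I from x to y in T}) :
  homotopic p q -> homotopic (path_rev p) (path_rev q).
Proof.
case=> H [cH Hpq Hxy]; exists (fun w => H (clamp (1 - val w.1), w.2)); split.
- apply: (@comp_continuous (I * I)%type (I * I)%type T
    (fun w => (clamp (1 - val w.1), w.2))) cH.
  apply: pair_continuous; last exact: snd_cont.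
  apply: (@comp_continuous (I * I)%type R I (fun w => 1 - val w.1));
    last exact: clamp_continuous.
  apply: sub_cont; first exact: const_cont.
  exact: comp_continuous (@fst_cont _ _) (@val_continuous R).
- by move=> t /=; exact: Hpq.
- move=> s; cbn [fst snd]; rewrite val_zero val_one subr0 subrr.
  by have [] := Hxy s.
Qed.

Section Laws.
Variable T : topologicalType.

Lemma extend_cat (x y z : T) (p : {path I from x to y in T})
    (q : {path I from y to z in T}) (u : R) : 0 <= u <= 1 ->
  extend (path_cat p q) u =
  if u <= 2^-1 then extend p (2 * u) else extend q (2 * u - 1).
Proof.
by move=> u01; rewrite -[LHS]/(cat_fun p q (clamp u)) /cat_fun val_clamp.
Qed.

Lemma path_catA (x y z w : T) (p : {path I from x to y in T})
    (q : {path I from y to z in T}) (r : {path I from z to w in T}) :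
  homotopic (path_cat p (path_cat q r)) (path_cat (path_cat p q) r).
Proof.
pose v (t : I) :=
  Num.min (2 * val t) (Num.min (val t + 4^-1) (2^-1 * val t + 2^-1)).
have cval := @val_continuous R.
apply: (@reparam_homotopic _ _ _ (extend (path_cat p (path_cat q r))) val v).
- by apply: extend_continuous; exact: cts_fun.
- by [].
- apply: min_cont; first by apply: mul_cont => //; exact: const_cont.
  apply: min_cont; first by apply: add_cont => //; exact: const_cont.
  exact: affine_continuous.
- rewrite /v val_zero !min_l; lra.
- rewrite /v val_one [Num.min (1 + _) _]min_r ?min_r; lra.
- by move=> t; rewrite /= extend_val.
- move=> t.
  have t0 := unit_interval_ge0 t; have t1 := unit_interval_le1 t.
  have v01 : 0 <= v t <= 1.
    apply/andP; rewrite /v.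
    by case: (lerP (val t + _)) => ?; case: (lerP (2 * _)) => ?; split; lra.
  rewrite -[LHS]/(cat_fun (path_cat p q) r t).
  rewrite -[RHS]/(extend (path_cat p (path_cat q r)) (v t)).
  rewrite [RHS]extend_cat// /cat_fun.
  have [th|th] := lerP (val t) 2^-1.
    rewrite extend_cat; last by apply/andP; split; lra.
    have [tq|tq] := lerP (2 * val t) 2^-1.
      have -> : v t = 2 * val t.
        by rewrite /v; case: (lerP (val t + _)) => ?;
  case: (lerP (2 * _)) => ?; lra.
      by rewrite tq.
    have -> : v t = val t + 4^-1.
      by rewrite /v; case: (lerP (val t + _)) => ?;
  case: (lerP (2 * _)) => ?; lra.
    rewrite ifF; last by apply/negbTE; rewrite -ltNge; lra.
    rewrite extend_cat; last by apply/andP; split; lra.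
    rewrite ifT; last by lra.
    by congr extend; lra.
  have -> : v t = 2^-1 * val t + 2^-1.
    by rewrite /v; case: (lerP (val t + _)) => ?;
  case: (lerP (2 * _)) => ?; lra.
  rewrite ifF; last by apply/negbTE; rewrite -ltNge; lra.
  rewrite extend_cat; last by apply/andP; split; lra.
  rewrite ifF; last by apply/negbTE; rewrite -ltNge; lra.
  by congr extend; lra.
Qed.

Lemma path_cat1p (x y : T) (p : {path I from x to y in T}) :
  homotopic (path_cat (path_cst x) p) p.
Proof.
have cval := @val_continuous R.
apply: (@reparam_homotopic _ _ _ (extend p)
  (fun t => Num.max 0 (2 * val t - 1)) val).
- by apply: extend_continuous; exact: cts_fun.
- apply: max_cont; first exact: const_cont.
  exact: affine_continuous.
- by [].
- rewrite val_zero; case: lerP => ?; lra.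
- rewrite val_one; case: lerP => ?; lra.
- move=> t; rewrite -[LHS]/(cat_fun (path_cst x) p t) /cat_fun.
  rewrite -[RHS]/(extend p (Num.max 0 (2 * val t - 1))).
  have [th|th] := lerP (val t) 2^-1; last by rewrite max_r//; lra.
  by rewrite max_l; [rewrite [RHS]extend_le0// path_zero|lra].
- by move=> t; rewrite /= extend_val.
Qed.

Lemma path_catp1 (x y : T) (p : {path I from x to y in T}) :
  homotopic (path_cat p (path_cst y)) p.
Proof.
have cval := @val_continuous R.
apply: (@reparam_homotopic _ _ _ (extend p)
  (fun t => Num.min 1 (2 * val t)) val).
- by apply: extend_continuous; exact: cts_fun.
- apply: min_cont; first exact: const_cont.
  by apply: mul_cont => //; exact: const_cont.
- by [].
- rewrite val_zero; case: lerP => ?; lra.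
- rewrite val_one; case: lerP => ?; lra.
- move=> t; rewrite -[LHS]/(cat_fun p (path_cst y) t) /cat_fun.
  rewrite -[RHS]/(extend p (Num.min 1 (2 * val t))).
  have [th|th] := lerP (val t) 2^-1; first by rewrite min_r//; lra.
  by rewrite min_l; [rewrite [RHS]extend_ge1// path_one|lra].
- by move=> t; rewrite /= extend_val.
Qed.

Lemma path_catpV (x y : T) (p : {path I from x to y in T}) :
  homotopic (path_cat p (path_rev p)) (path_cst x).
Proof.
have cval := @val_continuous R.
have c2 : continuous (fun t : I => 2 * val t).
  by apply: mul_cont => //; exact: const_cont.
apply: (@reparam_homotopic _ _ _ (extend p)
  (fun t => Num.min (2 * val t) (2 - 2 * val t)) (cst 0)).
- by apply: extend_continuous; exact: cts_fun.
- apply: min_cont => //.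
  by apply: sub_cont => //; exact: const_cont.
- exact: const_cont.
- rewrite val_zero /=; case: lerP => ?; lra.
- rewrite val_one /=; case: lerP => ?; lra.
- move=> t; rewrite -[LHS]/(cat_fun p (path_rev p) t) /cat_fun.
  rewrite -[RHS]/(extend p (Num.min (2 * val t) (2 - 2 * val t))).
  have t0 := unit_interval_ge0 t; have t1 := unit_interval_le1 t.
  have [th|th] := lerP (val t) 2^-1; first by rewrite min_l//; lra.
  rewrite -[LHS]/(rev_fun p (clamp _)) /rev_fun val_clamp; last first.
    by apply/andP; split; lra.
  by rewrite min_r; [congr extend|]; lra.
- by move=> t /=; rewrite extend_le0// path_zero.
Qed.

Lemma path_catVp (x y : T) (p : {path I from x to y in T}) :
  homotopic (path_cat (path_rev p) p) (path_cst y).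
Proof.
suff {2}<- : path_rev (path_rev p) = p by exact: path_catpV.
apply/path_eqP => t.
have t0 := unit_interval_ge0 t; have t1 := unit_interval_le1 t.
rewrite -[LHS]/(rev_fun p (clamp (1 - val t))) /rev_fun val_clamp; last first.
  by apply/andP; split; lra.
by rewrite subKr extend_val.
Qed.

End Laws.

Section FundamentalGroup.
Variables (T : topologicalType) (x : T).
Local Notation loop := {path I from x to x in T}.

Definition loop_equiv : rel loop := fun p q => `[< homotopic p q >].

Fact loop_equiv_refl : reflexive loop_equiv.
Proof. by move=> p; apply/asboolP; exact: homotopic_refl. Qed.

Fact loop_equiv_sym : symmetric loop_equiv.
Proof. by move=> p q; apply/asboolP/asboolP; exact: homotopic_sym. Qed.

Fact loop_equiv_trans : transitive loop_equiv.
Proof.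
move=> q p r /asboolP pq /asboolP qr; apply/asboolP.
exact: homotopic_trans pq qr.
Qed.

Canonical loop_equiv_rel :=
  EquivRel loop_equiv loop_equiv_refl loop_equiv_sym loop_equiv_trans.

Local Open Scope quotient_scope.

Definition pi1 : Type := {eq_quot loop_equiv}.

HB.instance Definition _ := Choice.on pi1.

Definition loop_class (p : loop) : pi1 := \pi_({eq_quot loop_equiv}) p.

Definition pi1_mul (a b : pi1) : pi1 :=
  loop_class (path_cat (repr a) (repr b)).
Definition pi1_one : pi1 := loop_class (path_cst x).
Definition pi1_inv (a : pi1) : pi1 := loop_class (path_rev (repr a)).

Lemma loop_classP (p q : loop) : loop_class p = loop_class q <-> homotopic p q.
Proof.
split=> [/eqP|pq]; last by apply/eqP; rewrite eqmodE; exact/asboolP.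
by rewrite eqmodE => /asboolP.
Qed.

Lemma repr_loop_class (p : loop) : homotopic (repr (loop_class p)) p.
Proof. by apply/loop_classP; rewrite /loop_class reprK. Qed.

Lemma loop_class_repr (a : pi1) : loop_class (repr a) = a.
Proof. exact: reprK. Qed.

Lemma pi1_mulE (p q : loop) :
  pi1_mul (loop_class p) (loop_class q) = loop_class (path_cat p q).
Proof. by apply/loop_classP/homotopic_cat; exact: repr_loop_class. Qed.

Lemma pi1_invE (p : loop) : pi1_inv (loop_class p) = loop_class (path_rev p).
Proof. by apply/loop_classP/homotopic_rev; exact: repr_loop_class. Qed.

Fact pi1_mulA : associative pi1_mul.
Proof.
move=> a b c; rewrite -(loop_class_repr a) -(loop_class_repr b).
rewrite -(loop_class_repr c) !pi1_mulE.
by apply/loop_classP; exact: path_catA.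
Qed.

Fact pi1_mul1g : left_id pi1_one pi1_mul.
Proof.
move=> a; rewrite -(loop_class_repr a) pi1_mulE.
by apply/loop_classP; exact: path_cat1p.
Qed.

Fact pi1_mulg1 : right_id pi1_one pi1_mul.
Proof.
move=> a; rewrite -(loop_class_repr a) pi1_mulE.
by apply/loop_classP; exact: path_catp1.
Qed.

Fact pi1_mulVg : left_inverse pi1_one pi1_inv pi1_mul.
Proof.
move=> a; rewrite -(loop_class_repr a) pi1_invE pi1_mulE.
by apply/loop_classP; exact: path_catVp.
Qed.

Fact pi1_mulgV : right_inverse pi1_one pi1_inv pi1_mul.
Proof.
move=> a; rewrite -(loop_class_repr a) pi1_invE pi1_mulE.
by apply/loop_classP; exact: path_catpV.
Qed.

HB.instance Definition _ :=
  isGroup.Build pi1 pi1_mulA pi1_mul1g pi1_mulg1 pi1_mulVg pi1_mulgV.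

End FundamentalGroup.
End Homotopy.

Definition path_connected (R : realType) (X : topologicalType) : Prop :=
  inhabited X /\
  forall x y : X, inhabited {path (unit_interval R) from x to y in X}.

Definition simply_connected (R : realType) (X : topologicalType) : Prop :=
  path_connected R X /\ forall (x : X) (a : pi1 R x), a = 1%g.

Definition group_isomorphic (G H : groupType) : Prop :=
  exists f : G -> H, bijective f /\ {morph f : a b / (a * b)%g}.

Definition locally_euclidean (R : realType) (d : nat) (X : topologicalType) :
    Prop :=
  forall x : X, exists (U : set X) (V : set 'rV[R]_d)
      (f : X -> 'rV[R]_d) (g : 'rV[R]_d -> X),
    [/\ open U /\ U x,
        open V,
        {within U, continuous f},
        {within V, continuous g} &
        (forall u, U u -> V (f u) /\ g (f u) = u) /\
        (forall v, V v -> U (g v) /\ f (g v) = v)].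

Definition topological_manifold (R : realType) (d : nat)
    (X : topologicalType) : Prop :=
  [/\ hausdorff_space X, @second_countable X & locally_euclidean R d X].

Section Grassmannian.
Variables (R : realType) (V : vectType R[i]).

Definition Gr (m : nat) : Type := {W : {vspace V} | \dim W == m}.

HB.instance Definition _ m := Choice.on (Gr m).

Definition frame (m : nat) : Type := {v : m.-tuple V | free v}.

HB.instance Definition _ m := Choice.on (frame m).

(* Coordinates of the vectors of a frame in a reference basis of V. The
   topology they induce on frames does not depend on that basis. *)
Definition frame_coord (m : nat) (v : frame m) : 'M[R[i]]_(m, \dim {:V}) :=
  \matrix_(a, b) coord (vbasis {:V}) b (tnth (val v) a).

HB.instance Definition _ m :=
  Topological.copy (frame m) (initial_topology (@frame_coord m)).

Fact dim_frame_span m (v : frame m) : \dim <<val v>> == m.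
Proof. by have := valP v; rewrite /free size_tuple. Qed.

Definition frame_span (m : nat) (v : frame m) : Gr m :=
  exist _ <<val v>>%VS (dim_frame_span v).

(* Quotient topology for the map sending a frame to its span. *)
Definition Gr_open (m : nat) : set (set (Gr m)) :=
  [set U | open (@frame_span m @^-1` U)].

Fact Gr_openT m : Gr_open [set: Gr m].
Proof. by rewrite /Gr_open /= preimage_setT; exact: openT. Qed.

Fact Gr_openI m : setI_closed (@Gr_open m).
Proof. by move=> U W oU oW; rewrite /Gr_open /= preimage_setI; exact: openI. Qed.

Fact Gr_open_bigU m (J : Type) (U : J -> set (Gr m)) :
  (forall j, Gr_open (U j)) -> Gr_open (\bigcup_j U j).
Proof.
move=> oU; rewrite /Gr_open /= preimage_bigcup.
by apply: bigcup_open => j _; exact: oU.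
Qed.

HB.instance Definition _ m :=
  isOpenTopological.Build (Gr m) (@Gr_openT m) (@Gr_openI m) (@Gr_open_bigU m).

End Grassmannian.

Section ConfigurationSpaces.
Variable R : realType.

Definition configurations (h : nat) (M : topologicalType) :
    set {ptws 'I_h -> M} :=
  [set x | forall a b : 'I_h, a != b -> x a != x b].

Definition conf_space (h : nat) (M : topologicalType) : topologicalType :=
  set_type (@configurations h M).

Definition dual_space (n : nat) : vectType R[i] :=
  'Hom('cV[R[i]]_n, (R[i])^o).

Definition dual_Gr (m n : nat) : topologicalType := Gr (dual_space n) m.

Definition dual_conf_space (h i m n : nat) : topologicalType :=
  set_type [set H : {ptws 'I_h -> dual_Gr m n} |
    configurations H /\ \dim (\bigcap_(a < h) val (H a)) = i].

Definition CP (d : nat) : topologicalType := Gr 'cV[R[i]]_d.+1 1.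

End ConfigurationSpaces.

(* Main.v *)
Require Import Defs.
From HB Require Import structures.
From mathcomp Require Import all_boot all_order all_algebra.
From mathcomp Require Import complex.
From mathcomp Require Import all_classical all_reals all_analysis homotopy.
From mathcomp Require Import ring lra zify.

Set Implicit Arguments.
Unset Strict Implicit.
Unset Printing Implicit Defensive.

Import Order.TTheory GRing.Theory Num.Theory numFieldNormedType.Exports.
Local Open Scope classical_set_scope.
Local Open Scope ring_scope.

(** Write m = n - k. In a common chart the subspaces H_a are the row spaces
    of the matrices (1 | Y_a), with Y_a of size m x k, and the intersection
    of the H_a has dimension m - rank N(Y), where N(Y) puts the blocks Y_a -
    Y_0 side by side [dim_bigcap_cocharts]. So the dual configuration space
    X is described in every chart by the same condition [generic_pos]: the
    Y_a are distinct and N(Y) has the largest possible rank. Such a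
    condition [zopen] is open, and its complement meets any complex line
    that is not contained in it in a finite set. Hence nonempty zopen sets
    are dense, meet each other, and are path connected: two points are
    joined by an arc in the complex line through them [zopen_path].

    Simple connectedness comes from the elementary half of the theorem of
    Seifert and van Kampen [simply_connected_cover]: it suffices to cover X
    by open sets with path connected pairwise intersections and nonempty
    triple intersections, such that paths with the same ends in one of them
    are homotopic in X. The open sets are stars: given a chart and a centre
    P, the points Y such that the segment from Y to P satisfies some open
    condition. Intersections of stars are connected as soon as each star
    contains a nonempty zopen set [simply_connected_star].

    If n is not h k, the open condition is generic_pos itself, and a star
    contracts to its centre along segments. Almost every segment is allowed
    because the excluded set has complex codimension at least 2. For the
    rank condition this is made explicit by a classical computation of
    control theory: after a normalization, the pencil spanned by two r x (r
    + 1) matrices consists of matrices of rank r if a Krylov determinant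
    does not vanish [kalman_pencil]; N(Y) contains such a submatrix, or its
    transpose does, since N(Y) is not square [pencil_selector]. For the
    condition that the Y_a are distinct it suffices that they have at least
    two entries, that is, n is not 2 [dist_line].

    If n = h k, the matrix N(Y) is square and the excluded set is a
    hypersurface. But now the last subspace is a complement of the
    intersection K of the other ones, and the complements of K are the
    kernels of the projectors onto K, which form an affine space. So the
    segment condition is only imposed on the first h - 1 subspaces, to which
    the previous argument applies, and the last one follows K as the kernel
    of a projector [slide].

    If n = 2, then k = 1 and distinct lines meet trivially. A linear
    isomorphism of the plane with its dual turns X into the configuration
    space of the projective line [configurations_homeo], and X is path
    connected, so that base points do not matter. *)

(** * Regular functions near a base point *)

(** The functions on a parameter space that are regular at a base point. Two
    instances matter: the functions continuous at a point of a topological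
    space, and the rational functions of one variable without pole at 0.
    They allow one to prove at once that a condition is open and that it
    holds at almost all points of the complex lines that meet it. The last
    axiom says that the values on the zeros of a function nonzero at the
    base point are irrelevant. *)
Record germ (K : fieldType) := Germ {
  germ_sort :> Type;
  gpt : germ_sort;
  greg : (germ_sort -> K) -> Prop;
  greg_cst : forall c, greg (fun=> c);
  greg_add : forall f f', greg f -> greg f' -> greg (fun t => f t + f' t);
  greg_mul : forall f f', greg f -> greg f' -> greg (fun t => f t * f' t);
  greg_inv : forall f, greg f -> f gpt != 0 -> greg (fun t => (f t)^-1);
  greg_loc : forall f f1 f2, greg f -> f gpt != 0 ->
    (forall t, f t != 0 -> f1 t = f2 t) -> greg f1 -> greg f2 }.

Section GermTheory.
Variables (K : fieldType) (G : germ K).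
Implicit Types (f : G -> K).

(** Validity near the base point; in the local ring of a line at 0 this
    means validity off finitely many points. *)
Definition gev (P : G -> Prop) : Prop :=
  exists f, [/\ greg f, f (gpt G) != 0 & forall t, f t != 0 -> P t].

(** Matrices with regular entries. *)
Definition gmx (p q : nat) (F : G -> 'M[K]_(p, q)) : Prop :=
  forall i j, greg (fun t => F t i j).

Lemma greg_eq f f' : f =1 f' -> greg f -> greg f'.
Proof.
by move=> ff'; apply: (@greg_loc _ G (fun=> 1)); rewrite ?oner_eq0//; exact: greg_cst.
Qed.

Lemma greg_sub f f' : greg f -> greg f' -> greg (fun t => f t - f' t).
Proof.
move=> Gf Gf'; apply: greg_add => //.
apply: (@greg_eq (fun t => -1 * f' t)) => [t|]; first by rewrite mulN1r.
exact/greg_mul/Gf'/greg_cst.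
Qed.

Lemma greg_sum (J : Type) (r : seq J) (P : pred J) (F : J -> G -> K) :
  (forall j, greg (F j)) -> greg (fun t => \sum_(j <- r | P j) F j t).
Proof.
move=> GF; elim: r => [|j r IHr].
  by apply: greg_eq (greg_cst G 0) => t; rewrite big_nil.
have [Pj|Pj] := boolP (P j).
  by apply: greg_eq (greg_add (GF j) IHr) => t; rewrite big_cons Pj.
by apply: greg_eq IHr => t; rewrite big_cons (negbTE Pj).
Qed.

Lemma greg_prod (J : Type) (r : seq J) (F : J -> G -> K) :
  (forall j, greg (F j)) -> greg (fun t => \prod_(j <- r) F j t).
Proof.
move=> GF; elim: r => [|j r IHr].
  by apply: greg_eq (greg_cst G 1) => t; rewrite big_nil.
by apply: greg_eq (greg_mul (GF j) IHr) => t; rewrite big_cons.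
Qed.

Lemma gev_all P : (forall t, P t) -> gev P.
Proof.
by move=> PT; exists (fun=> 1); split => //; [exact: greg_cst|exact: oner_neq0].
Qed.

Lemma gevS P Q : (forall t, P t -> Q t) -> gev P -> gev Q.
Proof. by move=> PQ [f [? ? fP]]; exists f; split => // t /fP /PQ. Qed.

Lemma gevI P Q : gev P -> gev Q -> gev (fun t => P t /\ Q t).
Proof.
move=> [f [Gf f0 fP]] [f' [Gf' f'0 fQ]].
exists (fun t => f t * f' t); split; [exact: greg_mul|by rewrite mulf_neq0|].
by move=> t; rewrite mulf_eq0 negb_or => /andP[/fP ? /fQ].
Qed.

Lemma gev_forall (J : finType) (P : J -> G -> Prop) :
  (forall j, gev (P j)) -> gev (fun t => forall j, P j t).
Proof.
move=> evP.
suff: gev (fun t => forall j, j \in enum J -> P j t).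
  by apply: gevS => t Pt j; apply: Pt; rewrite mem_enum.
elim: (enum J) => [|j s IHs]; first exact: gev_all.
apply: gevS (gevI (evP j) IHs) => t [Pj Ps] i.
by rewrite inE => /orP[/eqP->//|/Ps].
Qed.

Lemma gev_neq0 f : greg f -> f (gpt G) != 0 -> gev (fun t => f t != 0).
Proof. by move=> Gf f0; exists f; split. Qed.

Lemma gmx_cst p q (A : 'M[K]_(p, q)) : gmx (fun=> A).
Proof. by move=> i j; exact: greg_cst. Qed.

Lemma gmx_add p q (A B : G -> 'M[K]_(p, q)) :
  gmx A -> gmx B -> gmx (fun t => A t + B t).
Proof.
move=> GA GB i j; apply: greg_eq (greg_add (GA i j) (GB i j)) => t.
by rewrite mxE.
Qed.

Lemma gmx_sub p q (A B : G -> 'M[K]_(p, q)) :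
  gmx A -> gmx B -> gmx (fun t => A t - B t).
Proof.
move=> GA GB i j; apply: greg_eq (greg_sub (GA i j) (GB i j)) => t.
by rewrite !mxE.
Qed.

Lemma gmx_scale p q (a : G -> K) (B : G -> 'M[K]_(p, q)) :
  greg a -> gmx B -> gmx (fun t => a t *: B t).
Proof.
move=> Ga GB i j; apply: greg_eq (greg_mul Ga (GB i j)) => t.
by rewrite mxE.
Qed.

Lemma gmx_mul p q r (A : G -> 'M[K]_(p, q)) (B : G -> 'M[K]_(q, r)) :
  gmx A -> gmx B -> gmx (fun t => A t *m B t).
Proof.
move=> GA GB i j.
apply: (@greg_eq (fun t => \sum_l A t i l * B t l j)) => [t|].
  by rewrite mxE.
by apply: greg_sum => l; exact: greg_mul.
Qed.

Lemma gmx_det p (A : G -> 'M[K]_p) : gmx A -> greg (fun t => \det (A t)).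
Proof.
move=> GA; apply: greg_sum => s; apply: greg_mul; first exact: greg_cst.
by apply: greg_prod => i; exact: GA.
Qed.

Lemma gmx_row' p q (A : G -> 'M[K]_(p, q)) i :
  gmx A -> gmx (fun t => row' i (A t)).
Proof. by move=> GA a b; apply: greg_eq (GA (lift i a) b) => t; rewrite mxE. Qed.

Lemma gmx_col' p q (A : G -> 'M[K]_(p, q)) i :
  gmx A -> gmx (fun t => col' i (A t)).
Proof. by move=> GA a b; apply: greg_eq (GA a (lift i b)) => t; rewrite mxE. Qed.

Lemma gmx_inv p (A : G -> 'M[K]_p) :
  gmx A -> A (gpt G) \in unitmx -> gmx (fun t => invmx (A t)).
Proof.
move=> GA; rewrite unitmxE unitfE => A0 i j.
apply: (greg_loc (gmx_det GA) A0
  (* where the determinant vanishes, invmx is the identity *)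
  (f1 := fun t => (\det (A t))^-1 * cofactor (A t) j i)).
  by move=> t; rewrite /invmx unitmxE unitfE => ->; rewrite !mxE.
apply: greg_mul; first exact: greg_inv (gmx_det GA) A0.
apply: greg_mul; first exact: greg_cst.
exact/gmx_det/gmx_row'/gmx_col'.
Qed.

Lemma gev_unit p (A : G -> 'M[K]_p) :
  gmx A -> A (gpt G) \in unitmx -> gev (fun t => A t \in unitmx).
Proof.
move=> GA; rewrite unitmxE unitfE => A0.
by apply: gevS (gev_neq0 (gmx_det GA) A0) => t; rewrite unitmxE unitfE.
Qed.

Lemma gmx_lsub p q r (A : G -> 'M[K]_(p, q + r)) :
  gmx A -> gmx (fun t => lsubmx (A t)).
Proof. by move=> GA a b; apply: greg_eq (GA a (lshift r b)) => t; rewrite mxE. Qed.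

Lemma gmx_rsub p q r (A : G -> 'M[K]_(p, q + r)) :
  gmx A -> gmx (fun t => rsubmx (A t)).
Proof. by move=> GA a b; apply: greg_eq (GA a (rshift q b)) => t; rewrite mxE. Qed.

Lemma gmx_row_mx p q r (A : G -> 'M[K]_(p, q)) (B : G -> 'M[K]_(p, r)) :
  gmx A -> gmx B -> gmx (fun t => row_mx (A t) (B t)).
Proof.
move=> GA GB a b; case: (split_ordP b) => c ->.
  by apply: greg_eq (GA a c) => t; rewrite row_mxEl.
by apply: greg_eq (GB a c) => t; rewrite row_mxEr.
Qed.

Lemma gmx_col_mx p q r (A : G -> 'M[K]_(p, r)) (B : G -> 'M[K]_(q, r)) :
  gmx A -> gmx B -> gmx (fun t => col_mx (A t) (B t)).
Proof.
move=> GA GB a b; case: (split_ordP a) => c ->.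
  by apply: greg_eq (GA c b) => t; rewrite col_mxEu.
by apply: greg_eq (GB c b) => t; rewrite col_mxEd.
Qed.

Lemma gmx_mxsub p q p' q' (f : 'I_p' -> 'I_p) (g : 'I_q' -> 'I_q)
    (A : G -> 'M[K]_(p, q)) :
  gmx A -> gmx (fun t => mxsub f g (A t)).
Proof. by move=> GA a b; apply: greg_eq (GA (f a) (g b)) => t; rewrite mxE. Qed.

Lemma gmx_tr p q (A : G -> 'M[K]_(p, q)) : gmx A -> gmx (fun t => (A t)^T).
Proof. by move=> GA a b; apply: greg_eq (GA b a) => t; rewrite mxE. Qed.

Lemma gev_row_free p q (A : G -> 'M[K]_(p, q)) :
  gmx A -> row_free (A (gpt G)) -> gev (fun t => row_free (A t)).
Proof.
move=> GA /row_freeP[B AB].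
have: A (gpt G) *m B \in unitmx by rewrite AB unitmx1.
move/(gev_unit (gmx_mul GA (gmx_cst B))); apply: gevS => t; rewrite -row_free_unit.
by rewrite /row_free !eqn_leq !rank_leq_row/= => /leq_trans; apply; exact: mxrankM_maxl.
Qed.

Lemma gev_row_full p q (A : G -> 'M[K]_(p, q)) :
  gmx A -> row_full (A (gpt G)) -> gev (fun t => row_full (A t)).
Proof.
move=> GA A0; have := gev_row_free (gmx_tr GA).
rewrite /row_free mxrank_tr => /(_ A0).
by apply: gevS => t; rewrite mxrank_tr.
Qed.

End GermTheory.

Section RationalGerm.
Variable K : fieldType.

Definition rat_reg (f : K -> K) : Prop :=
  exists p q : {poly K}, q.[0] != 0 /\ forall t, q.[t] != 0 -> f t = p.[t] / q.[t].

Fact rat_cst c : rat_reg (fun=> c).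
Proof.
exists c%:P, 1; rewrite hornerC oner_neq0; split=> // t _.
by rewrite !hornerC divr1.
Qed.

Fact rat_add f g : rat_reg f -> rat_reg g -> rat_reg (fun t => f t + g t).
Proof.
move=> [p [q [q0 fE]]] [p' [q' [q'0 gE]]]; exists (p * q' + p' * q), (q * q').
rewrite hornerM mulf_neq0//; split=> // t.
rewrite hornerM mulf_eq0 negb_or => /andP[qt q't].
by rewrite fE// gE// hornerD !hornerM addf_div.
Qed.

Fact rat_mul f g : rat_reg f -> rat_reg g -> rat_reg (fun t => f t * g t).
Proof.
move=> [p [q [q0 fE]]] [p' [q' [q'0 gE]]]; exists (p * p'), (q * q').
rewrite hornerM mulf_neq0//; split=> // t.
rewrite hornerM mulf_eq0 negb_or => /andP[qt q't].
by rewrite fE// gE// !hornerM mulf_div.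
Qed.

Fact rat_inv f : rat_reg f -> f 0 != 0 -> rat_reg (fun t => (f t)^-1).
Proof.
move=> [p [q [q0 fE]]]; rewrite fE// mulf_eq0 negb_or => /andP[p0 _].
exists (q * q), (p * q); rewrite hornerM mulf_neq0//; split=> // t.
rewrite hornerM mulf_eq0 negb_or => /andP[pt qt].
by rewrite fE// !hornerM invf_div -mulf_div divff// mulr1.
Qed.

Fact rat_loc f f1 f2 : rat_reg f -> f 0 != 0 ->
  (forall t, f t != 0 -> f1 t = f2 t) -> rat_reg f1 -> rat_reg f2.
Proof.
move=> [p [q [q0 fE]]]; rewrite fE// mulf_eq0 negb_or => /andP[p0 _] f12.
move=> [p' [q' [q'0 f1E]]]; exists (p' * (p * q)), (q' * (p * q)).
rewrite !hornerM !mulf_neq0//; split=> // t.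
rewrite !hornerM !mulf_eq0 !negb_or => /andP[q't /andP[pt qt]].
rewrite -f12; last by rewrite fE// mulf_neq0// invr_eq0.
by rewrite f1E// -mulf_div divff ?mulr1// mulf_neq0.
Qed.

Definition rat_germ : germ K := Germ rat_cst rat_add rat_mul rat_inv rat_loc.

Lemma rat_gevP (P : K -> Prop) : @gev K rat_germ P ->
  exists q : {poly K}, q.[0] != 0 /\ forall t, q.[t] != 0 -> P t.
Proof.
move=> [f [[p [q [q0 fE]]] /= f0 fP]]; exists (p * q).
move: f0; rewrite fE// mulf_eq0 negb_or => /andP[p0 _].
rewrite hornerM mulf_neq0//; split=> // t.
rewrite hornerM mulf_eq0 negb_or => /andP[pt qt].
by apply: fP; rewrite fE// mulf_neq0// invr_eq0.
Qed.

Lemma rat_id : rat_reg id.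
Proof.
exists 'X, 1; rewrite hornerC oner_neq0; split=> // t _.
by rewrite hornerX hornerC divr1.
Qed.

End RationalGerm.

(** A nonzero polynomial has finitely many roots. *)
Lemma poly_avoid (K : fieldType) (q : {poly K}) (f : nat -> K) :
  injective f -> q != 0 -> exists j, q.[f j] != 0.
Proof.
move=> fI q0; apply: contrapT => /forallNP qf.
have /(max_poly_roots q0) : all (root q) (map f (iota 0 (size q))).
  by apply/allP => _ /mapP[j _ ->]; apply/rootP/eqP/negPn/negP; exact: qf.
by rewrite map_inj_uniq// iota_uniq size_map size_iota ltnn => /(_ isT).
Qed.

(** * Open conditions on families of matrices *)

Section Gopen.
Variable K : fieldType.

Section Def.
Variables (J : Type) (p q : nat).
Local Notation E := (J -> 'M[K]_(p, q)).

(** Stability along all germs of curves, hence openness both for the usual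
    topology and for the Zariski topology of complex lines. *)
Definition gopen (P : E -> Prop) : Prop :=
  forall (G : germ K) (Y : G -> E), (forall a, gmx (fun t => Y t a)) ->
    P (Y (gpt G)) -> gev (fun t => P (Y t)).

(** The complex line through x and y, with x at time 0 and y at time 1. *)
Definition cline (x y : E) (t : K) : E := fun a => x a + t *: (y a - x a).

Lemma cline0 x y : cline x y 0 = x.
Proof. by apply/funext => a; rewrite /cline scale0r addr0. Qed.

Lemma cline1 x y : cline x y 1 = y.
Proof. by apply/funext => a; rewrite /cline scale1r addrC subrK. Qed.

Lemma cline_rev x y t : cline x y t = cline y x (1 - t).
Proof.
apply/funext => a; apply/matrixP => i j; rewrite /cline !mxE; ring.
Qed.

Lemma cline_cline x y s t : cline x (cline x y s) t = cline x y (s * t).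
Proof.
apply/funext => a; apply/matrixP => i j; rewrite /cline !mxE; ring.
Qed.

Lemma cline_reg x y a : @gmx K (rat_germ K) _ _ (fun t => cline x y t a).
Proof.
apply: (@gmx_add _ (rat_germ K)); first exact: gmx_cst.
by apply: (@gmx_scale _ (rat_germ K)); [exact: rat_id|exact: gmx_cst].
Qed.

Lemma gopen_line P x y : gopen P -> P x ->
  exists q : {poly K}, q.[0] != 0 /\ forall t, q.[t] != 0 -> P (cline x y t).
Proof.
move=> oP Px; apply: rat_gevP.
apply: (oP (rat_germ K) (cline x y)); first exact: cline_reg.
by rewrite /= cline0.
Qed.

Lemma gopenI P Q : gopen P -> gopen Q -> gopen (fun x => P x /\ Q x).
Proof. by move=> oP oQ G Y rY [PY QY]; apply: gevI; [exact: oP|exact: oQ]. Qed.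

Lemma gopen_forall (I : finType) (P : I -> E -> Prop) :
  (forall i, gopen (P i)) -> gopen (fun x => forall i, P i x).
Proof. by move=> oP G Y rY PY; apply: gev_forall => i; exact: oP. Qed.

End Def.

End Gopen.

Lemma poly_horner_neq0 (K : fieldType) (q : {poly K}) x : q.[x] != 0 -> q != 0.
Proof. by apply: contraNneq => ->; rewrite horner0. Qed.

Lemma natr_inj (K : numDomainType) : injective (fun j : nat => j%:R : K).
Proof. by move=> i j /eqP; rewrite eqr_nat => /eqP. Qed.

Section GopenChar0.
Variables (K : numFieldType) (J : Type) (p q : nat).
Local Notation E := (J -> 'M[K]_(p, q)).

(** Each condition holds off finitely many points of the line through x and
    y. *)
Lemma gopen_meet (P Q : E -> Prop) x y : gopen P -> gopen Q -> P x -> Q y ->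
  exists z, P z /\ Q z.
Proof.
move=> oP oQ Px Qy.
have [f [f0 fP]] := gopen_line y oP Px.
have [g [g0 gQ]] := gopen_line x oQ Qy.
have h0 : f * (g \Po (1 - 'X)) != 0.
  rewrite mulf_neq0 ?(poly_horner_neq0 f0)//.
  by rewrite (@poly_horner_neq0 _ _ 1)// horner_comp !hornerE subrr.
have [j] := poly_avoid (@natr_inj K) h0.
rewrite hornerM horner_comp !hornerE mulf_eq0 negb_or => /andP[fj gj].
exists (cline x y j%:R); split; first exact: fP.
by rewrite cline_rev; exact: gQ.
Qed.

Lemma gopen_meet_all (I : finType) (P : I -> E -> Prop) :
  (forall i, gopen (P i)) -> (forall i, exists x, P i x) ->
  exists x, forall i, P i x.
Proof.
move=> oP nP.
suff [x Px] : exists x, forall i, i \in enum I -> P i x.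
  by exists x => i; apply: Px; rewrite mem_enum.
elim: (enum I) => [|i s [x Px]]; first by exists (fun=> 0).
have [y Py] := nP i.
have oS : gopen (fun z => forall i0, i0 \in s -> P i0 z).
  have := gopen_forall (fun k : seq_sub s => oP (val k)).
  move=> oS G Y rY PY; apply: gevS (oS G Y rY _) => [t Pt i0 i0s|k].
    exact: (Pt (SeqSub i0s)).
  by apply: PY; exact: ssvalP.
have [z [Pz Sz]] := gopen_meet (oP i) oS Py Px.
by exists z => i0; rewrite inE => /orP[/eqP->//|/Sz].
Qed.

End GopenChar0.

(** * Functions continuous at a point *)

Section ContinuityGerm.
Variables (R : realType) (T : topologicalType) (x0 : T).
Local Notation C := R[i].

Definition cont_at (f : T -> C) : Prop := f @ x0 --> f x0.

Lemma cont_atP f : cont_at f <->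
  forall A : set C, nbhs (f x0) A -> \forall t \near x0, A (f t).
Proof. by []. Qed.

Fact cont_cst c : cont_at (fun=> c).
Proof. exact: cvg_cst. Qed.

Fact cont_add f g : cont_at f -> cont_at g -> cont_at (fun t => f t + g t).
Proof. by move=> cf cg; exact: (@cvgD C C^o T (nbhs x0) _ f g _ _ cf cg). Qed.

Fact cont_mul f g : cont_at f -> cont_at g -> cont_at (fun t => f t * g t).
Proof. by move=> cf cg; exact: (@cvgM C T (nbhs x0) _ f g _ _ cf cg). Qed.

Fact cont_inv f : cont_at f -> f x0 != 0 -> cont_at (fun t => (f t)^-1).
Proof. by move=> cf f0; exact: (@cvgV C T (nbhs x0) _ f _ f0 cf). Qed.

Lemma cont_near_neq0 f : cont_at f -> f x0 != 0 -> \forall t \near x0, f t != 0.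
Proof.
move=> cf f0; apply: (cf [set z | z != 0]).
apply/(@nbhs_normP C C^o (f x0)).
exists `|f x0|; first by rewrite /= normr_gt0.
move=> z /=; apply: contraTneq => ->.
by rewrite subr0 ltxx.
Qed.

Fact cont_loc f f1 f2 : cont_at f -> f x0 != 0 ->
  (forall t, f t != 0 -> f1 t = f2 t) -> cont_at f1 -> cont_at f2.
Proof.
move=> cf f0 f12 cf1 A; have <- := f12 _ f0 => /cf1.
apply: filterS2 (cont_near_neq0 cf f0) => t /f12.
by rewrite /preimage/= => ->.
Qed.

Definition cont_germ : germ C :=
  Germ cont_cst cont_add cont_mul cont_inv cont_loc.

Lemma cont_gevP (P : T -> Prop) : @gev C cont_germ P -> \forall t \near x0, P t.
Proof.
by move=> [f [cf f0 fP]]; apply: filterS (cont_near_neq0 cf f0) => t /fP.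
Qed.

Lemma cont_mxP p q (F : T -> 'M[C]_(p, q)) :
  F @ x0 --> F x0 <-> @gmx C cont_germ p q F.
Proof.
split=> [cF i j|cF].
  by move=> A nA; apply: (cF [set M | A (M i j)]); 
    exists (fun a b => if (a == i) && (b == j) then A else setT) => [a b|M MA];
    [case: ifP => [/andP[/eqP-> /eqP->]//|_]; exact: filterT
    |have := MA i j; rewrite !eqxx].
move=> A [P nP PA]; apply: filterS PA _.
by do 2 apply: filter_forall => ?; exact/cF/nP.
Qed.

Lemma cont_mx_near p q (F : T -> 'M[C]_(p, q)) (A : set 'M[C]_(p, q)) :
  @gmx C cont_germ p q F -> nbhs (F x0) A -> \forall t \near x0, A (F t).
Proof. by move=> /cont_mxP cF /cF. Qed.

End ContinuityGerm.

(** * Charts of the Grassmannian *)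

Section MatrixBlocks.
Variable F : fieldType.

Lemma lsubmx_mul p q r s (A : 'M[F]_(p, q)) (B : 'M[F]_(q, r + s)) :
  lsubmx (A *m B) = A *m lsubmx B.
Proof. by rewrite -{1}(hsubmxK B) mul_mx_row row_mxKl. Qed.

Lemma rsubmx_mul p q r s (A : 'M[F]_(p, q)) (B : 'M[F]_(q, r + s)) :
  rsubmx (A *m B) = A *m rsubmx B.
Proof. by rewrite -{1}(hsubmxK B) mul_mx_row row_mxKr. Qed.

Lemma row_free_mulr p q r (A : 'M[F]_(p, q)) (B : 'M[F]_(q, r)) :
  row_free (A *m B) -> row_free A.
Proof.
by rewrite /row_free !eqn_leq !rank_leq_row/= => /leq_trans; apply; exact: mxrankM_maxl.
Qed.

Lemma row_free_ker p q (A : 'M[F]_(p, q)) :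
  (forall u : 'rV_p, u *m A = 0 -> u = 0) -> row_free A.
Proof.
move=> A0; rewrite -kermx_eq0; apply/rowV0P => v /sub_kermxP; exact: A0.
Qed.

End MatrixBlocks.

Section RowSpace.
Variables (R : realType) (V : vectType R[i]) (n : nat).
Local Notation C := R[i].
Variables (e : n.-tuple V) (eB : basis_of {:V} e).

Definition vcoord (v : V) : 'rV[C]_n := \row_i coord e i v.

Definition vcomb (u : 'rV[C]_n) : V := \sum_i u 0 i *: e`_i.

Lemma vcomb_linear : linear vcomb.
Proof.
move=> a u w; rewrite /vcomb scaler_sumr -big_split/=; apply: eq_bigr => i _.
by rewrite !mxE scalerDl scalerA.
Qed.
HB.instance Definition _ := GRing.isLinear.Build C _ _ _ vcomb vcomb_linear.

Lemma vcoordK : cancel vcoord vcomb.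
Proof.
move=> v; rewrite [RHS](coord_basis eB (memvf v)).
by apply: eq_bigr => i _; rewrite mxE.
Qed.

Lemma vcombK : cancel vcomb vcoord.
Proof.
move=> u; apply/rowP => i; rewrite mxE /vcomb.
by rewrite coord_sum_free// (basis_free eB).
Qed.

Lemma vcomb_mulmx m (u : 'rV[C]_m) (M : 'M[C]_(m, n)) :
  \sum_i u 0 i *: vcomb (row i M) = vcomb (u *m M).
Proof.
rewrite mulmx_sum_row linear_sum; apply: eq_bigr => i _.
by rewrite linearZ.
Qed.

Definition rowspace p (M : 'M[C]_(p, n)) : {vspace V} :=
  <<[tuple vcomb (row i M) | i < p]>>.

Lemma mem_rowspace p (M : 'M[C]_(p, n)) v :
  (v \in rowspace M) = (vcoord v <= M)%MS.
Proof.
have nthE (i : 'I_p) : [tuple vcomb (row i0 M) | i0 < p]`_i = vcomb (row i M).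
  by rewrite (nth_map i) ?size_enum_ord// nth_ord_enum.
apply/idP/submxP => [/coord_span vE|[u uE]].
  exists (\row_i coord [tuple vcomb (row i M) | i < p] i v).
  apply: (can_inj vcombK); rewrite vcoordK [LHS]vE -vcomb_mulmx.
  by apply: eq_bigr => i _; rewrite nthE mxE.
rewrite -(vcoordK v) uE -vcomb_mulmx; apply: rpred_sum => i _.
by rewrite rpredZ// -nthE memv_span// mem_nth// size_tuple.
Qed.

Lemma rowspaceS p q (M : 'M[C]_(p, n)) (N : 'M[C]_(q, n)) :
  (rowspace M <= rowspace N)%VS = (M <= N)%MS.
Proof.
apply/subvP/row_subP => [MN i|MN v].
  rewrite -[row i M]vcombK -mem_rowspace MN// mem_rowspace vcombK.
  exact: row_sub.
by rewrite !mem_rowspace => /submx_trans; apply; exact/row_subP.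
Qed.

Lemma eq_rowspace p q (M : 'M[C]_(p, n)) (N : 'M[C]_(q, n)) :
  (M :=: N)%MS -> rowspace M = rowspace N.
Proof. by move=> MN; apply/eqP; rewrite eqEsubv !rowspaceS; apply/eqmxP. Qed.

Lemma rowspace_inj p q (M : 'M[C]_(p, n)) (N : 'M[C]_(q, n)) :
  rowspace M = rowspace N -> (M :=: N)%MS.
Proof. by move=> MN; apply/eqmxP; rewrite -!rowspaceS MN subvv. Qed.

Definition frame_mx m (v : m.-tuple V) : 'M[C]_(m, n) :=
  \matrix_i vcoord (tnth v i).

Definition mx_frame m (M : 'M[C]_(m, n)) : m.-tuple V :=
  [tuple vcomb (row i M) | i < m].

Lemma mx_frameK m (M : 'M[C]_(m, n)) : frame_mx (mx_frame M) = M.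
Proof.
by apply/row_matrixP => i; rewrite rowK tnth_mktuple vcombK.
Qed.

Lemma frame_mxK m (v : m.-tuple V) : mx_frame (frame_mx v) = v.
Proof.
by apply: eq_from_tnth => i; rewrite tnth_mktuple rowK vcoordK.
Qed.

Lemma span_frame m (v : m.-tuple V) : <<v>>%VS = rowspace (frame_mx v).
Proof. by rewrite /rowspace -/(mx_frame _) frame_mxK. Qed.

Lemma free_mx_frame m (M : 'M[C]_(m, n)) : row_free M -> free (mx_frame M).
Proof.
move=> fM; apply/freeP => u.
under eq_bigr => i _ do rewrite /= (nth_map i) ?size_enum_ord// nth_ord_enum.
move=> u0 i.
have uM : vcomb ((\row_i u i) *m M) = 0.
  by rewrite -vcomb_mulmx -[RHS]u0; apply: eq_bigr => j _; rewrite mxE.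
have /(row_free_inj fM) : \row_i u i *m M = 0 *m M.
  by apply: (can_inj vcombK); rewrite uM mul0mx linear0.
by move/rowP => /(_ i); rewrite !mxE.
Qed.

Lemma dim_rowspace_free m (M : 'M[C]_(m, n)) :
  row_free M -> \dim (rowspace M) = m.
Proof.
by move=> /free_mx_frame/eqP; rewrite size_tuple.
Qed.

Lemma dim_rowspace p (M : 'M[C]_(p, n)) : \dim (rowspace M) = \rank M.
Proof.
rewrite -(eq_rowspace (eq_row_base M)).
exact: dim_rowspace_free (row_base_free M).
Qed.

Lemma free_frame_mx m (v : m.-tuple V) : free v = row_free (frame_mx v).
Proof. by rewrite /free /row_free size_tuple span_frame dim_rowspace. Qed.

End RowSpace.

Section Charts.
Variables (R : realType) (V : vectType R[i]) (m k : nat).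
Local Notation C := R[i].
Local Notation n := (m + k)%N.
Variables (e : n.-tuple V) (eB : basis_of {:V} e).

Fact dim_rowspace0 : \dim (rowspace e (row_mx 1%:M 0 : 'M[C]_(m, n))) == m.
Proof.
rewrite (dim_rowspace eB); apply/eqP/eqP/row_freeP.
by exists (col_mx 1%:M 0); rewrite mul_row_col mul1mx mul0mx addr0.
Qed.

(** Made total by sending the matrices of another rank to a fixed subspace. *)
Definition Gr_of_mx p (M : 'M[C]_(p, n)) : Gr V m :=
  match pselect (\dim (rowspace e M) == m) with
  | left dM => exist (fun W => \dim W == m) (rowspace e M) dM
  | right _ => exist (fun W => \dim W == m) _ dim_rowspace0
  end.

Lemma val_Gr_of_mx p (M : 'M[C]_(p, n)) : \rank M = m -> val (Gr_of_mx M) = rowspace e M.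
Proof. by move=> rM; rewrite /Gr_of_mx; case: pselect => // -[]; rewrite (dim_rowspace eB) rM. Qed.

Lemma eq_Gr_of_mx p q (M : 'M[C]_(p, n)) (N : 'M[C]_(q, n)) :
  (M :=: N)%MS -> \rank M = m -> Gr_of_mx M = Gr_of_mx N.
Proof.
move=> MN rM; apply: val_inj; rewrite !val_Gr_of_mx -?MN//.
exact: eq_rowspace.
Qed.

Lemma Gr_of_mx_inj p q (M : 'M[C]_(p, n)) (N : 'M[C]_(q, n)) :
  \rank M = m -> \rank N = m -> Gr_of_mx M = Gr_of_mx N -> (M :=: N)%MS.
Proof. by move=> rM rN /(congr1 val); rewrite !val_Gr_of_mx//; exact: rowspace_inj. Qed.

Lemma mx_rep (W : Gr V m) :
  {M : 'M[C]_(m, n) | row_free M & val W = rowspace e M}.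
Proof.
apply: cid2; case: W => W /= /eqP dW.
have [w wW] : exists w : m.-tuple V, <<w>>%VS = W.
  by exists (tcast dW (vbasis W)); rewrite val_tcast (span_basis (vbasisP W)).
exists (frame_mx e w); last by rewrite -(span_frame eB).
rewrite -(free_frame_mx eB) /free.
by rewrite wW size_tuple dW.
Qed.

Definition rep (W : Gr V m) : 'M[C]_(m, n) := s2val (mx_rep W).

Lemma rep_free W : row_free (rep W).
Proof. exact: s2valP (mx_rep W). Qed.

Lemma repK W : Gr_of_mx (rep W) = W.
Proof.
apply: val_inj; rewrite val_Gr_of_mx; last exact/eqP/rep_free.
by rewrite [RHS](s2valP' (mx_rep W)).
Qed.

Lemma rep_Gr_of_mx (M : 'M[C]_(m, n)) : row_free M ->
  exists2 A, A \in unitmx & rep (Gr_of_mx M) = A *m M.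
Proof.
move=> fM; apply/eqmxMunitP/eqmxP; apply: Gr_of_mx_inj.
- exact/eqP/rep_free.
- exact/eqP.
- by rewrite repK.
Qed.

(** The chart of g consists of the row spaces of the matrices M such that
    the first m columns of M *m g are independent. Its coordinate is the
    matrix Y such that M *m g and (1 | Y) have the same row space. *)
Definition in_chart (g : 'M[C]_n) (W : Gr V m) : Prop :=
  lsubmx (rep W *m g) \in unitmx.

Definition chart (g : 'M[C]_n) (W : Gr V m) : 'M[C]_(m, k) :=
  invmx (lsubmx (rep W *m g)) *m rsubmx (rep W *m g).

Definition cochart (g : 'M[C]_n) (Y : 'M[C]_(m, k)) : Gr V m :=
  Gr_of_mx (row_mx 1%:M Y *m invmx g).

Lemma in_chart_Gr_of_mx g (M : 'M[C]_(m, n)) : row_free M ->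
  in_chart g (Gr_of_mx M) <-> lsubmx (M *m g) \in unitmx.
Proof.
move=> /rep_Gr_of_mx[A uA]; rewrite /in_chart => ->.
by rewrite -mulmxA lsubmx_mul unitmx_mul uA.
Qed.

Lemma chart_Gr_of_mx g (M : 'M[C]_(m, n)) : row_free M ->
  lsubmx (M *m g) \in unitmx ->
  chart g (Gr_of_mx M) = invmx (lsubmx (M *m g)) *m rsubmx (M *m g).
Proof.
move=> /rep_Gr_of_mx[A uA]; rewrite /chart => -> uM.
rewrite -mulmxA lsubmx_mul rsubmx_mul.
apply: (can_inj (mulKmx (_ : A *m lsubmx (M *m g) \in unitmx))).
  by rewrite unitmx_mul uA.
rewrite mulKVmx; last by rewrite unitmx_mul uA.
by rewrite -mulmxA mulKVmx.
Qed.

Lemma free_lsub p (M : 'M[C]_(p, n)) (g : 'M[C]_n) :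
  row_free (lsubmx (M *m g)) -> row_free M.
Proof. by rewrite lsubmx_mul; exact: row_free_mulr. Qed.

Lemma cochart_free g (Y : 'M[C]_(m, k)) :
  g \in unitmx -> row_free (row_mx 1%:M Y *m invmx g).
Proof.
move=> ug; apply: (@free_lsub _ _ g).
by rewrite mulmxKV// row_mxKl row_free_unit unitmx1.
Qed.

Lemma in_chart_cochart g Y : g \in unitmx -> in_chart g (cochart g Y).
Proof.
move=> ug; apply/in_chart_Gr_of_mx; first exact: cochart_free.
by rewrite mulmxKV// row_mxKl unitmx1.
Qed.

Lemma cochartK g Y : g \in unitmx -> chart g (cochart g Y) = Y.
Proof.
move=> ug; rewrite chart_Gr_of_mx ?cochart_free// mulmxKV// ?row_mxKl ?unitmx1//.
by rewrite row_mxKr invmx1 mul1mx.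
Qed.

(** Multiplying (1 | Y) by the first m columns of M *m g gives back M *m g. *)
Lemma chartK g W : g \in unitmx -> in_chart g W -> cochart g (chart g W) = W.
Proof.
move=> ug cW; rewrite -[RHS]repK; apply: eq_Gr_of_mx; last exact/eqP/cochart_free.
apply: eqmx_trans (_ : _ :=: lsubmx (rep W *m g) *m
  (row_mx 1%:M (chart g W) *m invmx g))%MS _.
  by apply/eqmx_sym/eqmxMfull; rewrite row_full_unit.
rewrite mulmxA mul_mx_row mulmx1 mulKVmx// hsubmxK mulmxK//.
Qed.

(** Gaussian elimination brings the rows to the form (1 | 0). *)
Lemma exists_chart W : exists2 g, g \in unitmx & in_chart g W.
Proof.
pose M := rep W; exists (invmx (row_ebase M)).
  by rewrite unitmx_inv row_ebase_unit.
rewrite /in_chart -/M -{1}(mulmx_ebase M) mulmxK ?row_ebase_unit//.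
rewrite lsubmx_mul unitmx_mul col_ebase_unit/=.
have /eqP -> := rep_free W.
rewrite (_ : lsubmx _ = 1%:M) ?unitmx1//.
by apply/matrixP => i j; rewrite !mxE/= ltn_ord andbT.
Qed.

End Charts.

(** * Topology of the Grassmannian *)

Lemma row_free_mul_ex (F : fieldType) p q r (M : 'M[F]_(p, q)) :
  \rank M = r -> exists S : 'M[F]_(r, p), row_free (S *m M).
Proof.
move=> <-; have /submxP[S SE] : (row_base M <= M)%MS by rewrite eq_row_base.
by exists S; rewrite -SE row_base_free.
Qed.

Lemma initial_cvg (S : choiceType) (T X : topologicalType) (f : S -> T)
    (g : X -> initial_topology f) (x : X) :
  f \o g @ x --> f (g x) -> g @ x --> g x.
Proof.
move=> cfg A; rewrite (@nbhsE (initial_topology f) (g x)) => -[_ [[B oB <-] Bgx] sA].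
have := cfg B (open_nbhs_nbhs (conj oB Bgx)).
by apply: (@filterS X (nbhs x)) => t Bt; exact: sA.
Qed.

Lemma ptws_cvg (J : Type) (T X : topologicalType) (g : X -> {ptws J -> T})
    (x : X) :
  (forall a, (fun t => g t a) @ x --> g x a) -> g @ x --> g x.
Proof.
move=> cg; apply/cvg_sup => a.
exact: (@initial_cvg _ _ _ (@proj J (fun=> T) a) g x (cg a)).
Qed.

Lemma ptws_proj_cvg (J : eqType) (T X : topologicalType) (g : X -> {ptws J -> T})
    (x : X) a :
  g @ x --> g x -> (fun t => g t a) @ x --> g x a.
Proof.
by move=> cg A nA; exact: (cg _ (@proj_continuous J (fun=> T) a (g x) A nA)).
Qed.

Lemma ptws_near (J : eqType) (T X : topologicalType) (F : X -> {ptws J -> T})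
    (x : X) a (A : set T) :
  F @ x --> F x -> open A -> A (F x a) -> \forall x' \near x, A (F x' a).
Proof. by move=> cF oA Ax; exact: (ptws_proj_cvg cF (open_nbhs_nbhs (conj oA Ax))). Qed.

Section GrTopology.
Variables (R : realType) (V : vectType R[i]) (m k : nat).
Local Notation C := R[i].
Local Notation n := (m + k)%N.
Variables (e : n.-tuple V) (eB : basis_of {:V} e).

Lemma frame_mx_cvg (v0 : frame V m) :
  gmx (G := cont_germ R v0) (fun v : frame V m => frame_mx e (val v)).
Proof.
have /cont_mxP cc : (@frame_coord R V m : frame V m -> _) @ v0 --> frame_coord v0.
  exact: (@initial_continuous _ _ (@frame_coord R V m) v0).
move=> i j.
apply: (@greg_eq _ (cont_germ R v0)
  (fun v => \sum_b frame_coord v i b * vcoord e (vbasis {:V})`_b 0 j)) => [v|].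
  rewrite !mxE [X in _ = coord e j X](coord_basis (vbasisP fullv) (memvf _)).
  rewrite linear_sum; apply: eq_bigr => b _.
  by rewrite !mxE linearZ.
apply: (@greg_sum _ (cont_germ R v0)) => b.
by apply: (@greg_mul _ (cont_germ R v0)); [exact: cc|exact: greg_cst].
Qed.

Lemma frame_spanE (v : frame V m) : frame_span v = Gr_of_mx eB (frame_mx e (val v)).
Proof.
apply: val_inj; rewrite val_Gr_of_mx; first by rewrite /= (span_frame eB).
by apply/eqP; rewrite -[_ == _](free_frame_mx eB) (valP v).
Qed.

(** In coordinates a frame is a matrix with independent rows, so the
    quotient topology can be tested on such matrices. *)
Lemma Gr_openP (P : set (Gr V m)) :
  (forall M : 'M[C]_(m, n), row_free M -> P (Gr_of_mx eB M) ->
    \forall M' \near M, row_free M' -> P (Gr_of_mx eB M')) -> open P.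
Proof.
move=> nP; rewrite /open/= /Gr_open/=; rewrite openE => v /=.
rewrite frame_spanE => Pv.
have fv (w : frame V m) : row_free (frame_mx e (val w)).
  by rewrite -(free_frame_mx eB) (valP w).
have nv : \forall w \near v, row_free (frame_mx e (val w)) ->
    P (Gr_of_mx eB (frame_mx e (val w))) 
  by have := cont_mx_near (@frame_mx_cvg v) (nP _ (fv v) Pv).
by apply: filterS nv => w; rewrite /preimage/= frame_spanE; apply; exact: fv.
Qed.

Lemma cont_id_mx p q (M : 'M[C]_(p, q)) :
  gmx (G := cont_germ R M) (fun N : 'M[C]_(p, q) => N).
Proof. by apply/cont_mxP; exact: cvg_id. Qed.

Lemma in_chart_open g : open [set W : Gr V m | in_chart eB g W].
Proof.
apply: Gr_openP => M fM /= /(in_chart_Gr_of_mx eB g fM) uM.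
have uM' : \forall N \near M, lsubmx (N *m g) \in unitmx.
  apply: (@cont_gevP R _ M); apply: (@gev_unit _ (cont_germ R M)) => //.
  apply: gmx_lsub; apply: gmx_mul; [exact: cont_id_mx|exact: gmx_cst].
by apply: filterS uM' => N uN fN; apply/in_chart_Gr_of_mx.
Qed.

Lemma chart_cont g (W : Gr V m) : in_chart eB g W ->
  gmx (G := cont_germ R W) (chart eB g).
Proof.
move=> cW i j; apply/cont_atP => A nA.
have oA : open (A°) by exact: open_interior.
suff: nbhs W [set W' : Gr V m | in_chart eB g W' /\ A° (chart eB g W' i j)].
  apply: filterS => W' [_]; exact: interior_subset.
apply: open_nbhs_nbhs; split; last by split => //; exact: nbhs_interior.
apply: Gr_openP => M fM /= [/(in_chart_Gr_of_mx eB g fM) uM AM].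
have cM : gmx (G := cont_germ R M) (fun N => N *m g).
  by apply: gmx_mul; [exact: cont_id_mx|exact: gmx_cst].
have uM' : \forall N \near M, lsubmx (N *m g) \in unitmx.
  by apply: (@cont_gevP R _ M); apply: (@gev_unit _ (cont_germ R M)) => //;
    exact: gmx_lsub.
have cM' : gmx (G := cont_germ R M)
    (fun N => invmx (lsubmx (N *m g)) *m rsubmx (N *m g)).
  by apply: gmx_mul; [apply: gmx_inv => //; exact: gmx_lsub|exact: gmx_rsub].
rewrite chart_Gr_of_mx// in AM.
have /cont_atP/(_ _ (open_nbhs_nbhs (conj oA AM))) AM' := cM' i j.
apply: filterS2 uM' AM' => N uN AN fN; split; first exact/in_chart_Gr_of_mx.
by rewrite chart_Gr_of_mx.
Qed.

Lemma frame_cvg (T : topologicalType) (x : T) (F : T -> frame V m) :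
  gmx (G := cont_germ R x) (fun t => frame_mx e (val (F t))) -> F @ x --> F x.
Proof.
move=> cF; apply: (@initial_cvg _ _ _ (@frame_coord R V m)); apply/cont_mxP => i j.
apply: (@greg_eq _ (cont_germ R x)
  (fun t => \sum_b frame_mx e (val (F t)) i b * coord (vbasis {:V}) j e`_b))
  => [t|].
  rewrite /= !mxE [tnth _ i in RHS](coord_basis eB (memvf _)).
  rewrite linear_sum; apply: eq_bigr => b _.
  by rewrite !mxE linearZ.
apply: (@greg_sum _ (cont_germ R x)) => b.
by apply: (@greg_mul _ (cont_germ R x)); [exact: cF|exact: greg_cst].
Qed.

Lemma frame_span_continuous : continuous (@frame_span R V m).
Proof. by apply/continuousP => A oA; exact: oA. Qed.

Lemma mx_frame_ex (M : 'M[C]_(m, n)) : row_free M ->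
  exists v : frame V m, frame_mx e (val v) = M.
Proof.
move=> /(free_mx_frame eB) fM.
by exists (exist (fun v : m.-tuple V => free v) _ fM); rewrite /= mx_frameK.
Qed.

Lemma Gr_of_mx_cvg_free (T : topologicalType) (x : T) (F : T -> 'M[C]_(m, n)) :
  gmx (G := cont_germ R x) F -> row_free (F x) ->
  (fun t => Gr_of_mx eB (F t)) @ x --> Gr_of_mx eB (F x).
Proof.
move=> cF fF.
have [v0 v0E] := mx_frame_ex fF.
have nF : \forall t \near x, row_free (F t).
  by apply: (@cont_gevP R _ x); apply: (@gev_row_free _ (cont_germ R x)).
pose v t : frame V m :=
  if pselect (row_free (F t)) is left fFt then projT1 (cid (mx_frame_ex fFt))
  else v0.
have vE t : row_free (F t) -> frame_mx e (val (v t)) = F t.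
  rewrite /v; case: pselect => // fFt _; exact: projT2 (cid (mx_frame_ex fFt)).
have cv : v @ x --> v x.
  apply: frame_cvg => i j; apply/cont_atP => A; rewrite vE// => nA.
  have /cont_atP/(_ A nA) := cF i j.
  by apply: filterS2 nF => t /vE ->.
have cs := cvg_comp _ _ cv (@frame_span_continuous (v x)).
rewrite -(vE _ fF) -frame_spanE; apply: cvg_trans cs.
apply: near_eq_cvg; apply: filterS nF => t ft.
by rewrite /= frame_spanE vE.
Qed.

(** The combinations of rows that form a basis at x still do so nearby,
    which reduces the statement to matrices with independent rows. *)
Lemma Gr_of_mx_cvg (T : topologicalType) (x : T) p (F : T -> 'M[C]_(p, n)) :
  gmx (G := cont_germ R x) F -> (\forall t \near x, \rank (F t) = m) ->
  (fun t => Gr_of_mx eB (F t)) @ x --> Gr_of_mx eB (F x).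
Proof.
move=> cF rF; have rFx := nbhs_singleton rF.
have [S fS] := row_free_mul_ex rFx.
have cSF : gmx (G := cont_germ R x) (fun t => S *m F t).
  by apply: gmx_mul => //; exact: gmx_cst.
have nS : \forall t \near x, row_free (S *m F t).
  by apply: (@cont_gevP R _ x); apply: (@gev_row_free _ (cont_germ R x)).
have eS : \forall t \near x, Gr_of_mx eB (S *m F t) = Gr_of_mx eB (F t).
  apply: filterS2 rF nS => t rt /eqP ft; apply: eq_Gr_of_mx => //.
  by apply/eqmxP; rewrite -mxrank_leqif_eq ?submxMl// ft rt.
rewrite -(nbhs_singleton eS); apply: cvg_trans (Gr_of_mx_cvg_free cSF fS).
exact: near_eq_cvg.
Qed.

End GrTopology.

(** * Simple connectedness from a cover *)

Section PathTools.
Variables (R : realType) (X : topologicalType).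
Local Notation I := (unit_interval R).

Definition inside (U : set X) (x y : X) (p : {path I from x to y in X}) : Prop :=
  forall t, U (p t).

Lemma inside_zero U (x y : X) (p : {path I from x to y in X}) :
  inside U p -> U x.
Proof. by move=> /(_ zero); rewrite path_zero. Qed.

Lemma inside_one U (x y : X) (p : {path I from x to y in X}) :
  inside U p -> U y.
Proof. by move=> /(_ one); rewrite path_one. Qed.

Lemma path_catE (x y z : X) (p : {path I from x to y in X})
    (q : {path I from y to z in X}) t :
  path_cat p q t =
  if val t <= 2^-1 then p (clamp (2 * val t)) else q (clamp (2 * val t - 1)).
Proof. by []. Qed.

Lemma inside_cat U (x y z : X) (p : {path I from x to y in X})
    (q : {path I from y to z in X}) :
  inside U p -> inside U q -> inside U (path_cat p q).
Proof. by move=> pU qU t; rewrite path_catE; case: ifP. Qed.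

Lemma inside_rev U (x y : X) (p : {path I from x to y in X}) :
  inside U p -> inside U (path_rev p).
Proof. by move=> pU t; exact: pU. Qed.

Lemma path_ext (x y : X) (p q : {path I from x to y in X}) :
  (forall t, p t = q t) -> homotopic p q.
Proof.
by move=> pq; have -> : p = q; [exact/path_eqP|exact: homotopic_refl].
Qed.

Section Segment.
Variables (f : R -> X) (cf : continuous f).

Section Seg.
Variables (u v : R).

Definition seg_fun (t : I) : X := f (u + (v - u) * val t).

Fact seg_continuous : continuous seg_fun.
Proof.
apply: (@comp_continuous I R X (fun t => u + (v - u) * val t)) => //.
apply: add_cont; first exact: const_cont.
by apply: mul_cont; [exact: const_cont|exact: val_continuous].
Qed.

Fact seg_zero : seg_fun zero = f u.
Proof. by rewrite /seg_fun val_zero mulr0 addr0. Qed.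

Fact seg_one : seg_fun one = f v.
Proof. by rewrite /seg_fun val_one mulr1 addrC subrK. Qed.

Definition seg : {path I from f u to f v in X} :=
  mk_path seg_continuous seg_zero seg_one.

Lemma segE t : seg t = f (u + (v - u) * val t).
Proof. by []. Qed.

End Seg.

Lemma seg_cat u v w : homotopic (path_cat (seg u v) (seg v w)) (seg u w).
Proof.
have cval := @val_continuous R.
apply: (@reparam_homotopic _ _ _ _ f
  (fun t => if val t <= 2^-1 then u + (v - u) * (2 * val t)
            else v + (w - v) * (2 * val t - 1))
  (fun t => u + (w - u) * val t)) => //.
- apply: paste_continuous => //.
  + apply: add_cont; first exact: const_cont.
    apply: mul_cont; first exact: const_cont.
    by apply: mul_cont => //; exact: const_cont.
  + apply: add_cont; first exact: const_cont.
    apply: mul_cont; first exact: const_cont.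
    exact: affine_continuous.
  + by move=> t ->; rewrite mulfV ?pnatr_eq0//; lra.
- apply: add_cont; first exact: const_cont.
  by apply: mul_cont => //; exact: const_cont.
- by rewrite val_zero invr_ge0 ler0n; lra.
- rewrite val_one ifF; first by lra.
  by apply/negbTE; rewrite -ltNge; lra.
- move=> t; rewrite path_catE !segE.
  have t0 := unit_interval_ge0 t; have t1 := unit_interval_le1 t.
  rewrite -[RHS]/(f _); case: ifPn => th; rewrite ?segE val_clamp//.
    by apply/andP; split; lra.
  by move: th; rewrite -ltNge => th; apply/andP; split; lra.
Qed.

End Segment.

Section Cover.
Variables (J : Type) (U : J -> set X).
Hypothesis Uopen : forall i, open (U i).
Hypothesis Ucover : forall x, exists i, U i x.
Hypothesis U2 : forall i j x y, U i x -> U j x -> U i y -> U j y ->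
  exists p : {path I from x to y in X}, inside (U i) p /\ inside (U j) p.
Hypothesis U3 : forall i j l, exists z, [/\ U i z, U j z & U l z].
Hypothesis Uhomotopic : forall i x y (p q : {path I from x to y in X}),
  inside (U i) p -> inside (U i) q -> homotopic p q.

(** Whatever members of the cover contain its ends, the path is homotopic to
    one that first stays in the member at its origin, then in the other one. *)
Definition good (x y : X) (p : {path I from x to y in X}) : Prop :=
  forall i j, U i x -> U j y ->
  exists (z : X) (a : {path I from x to z in X}) (b : {path I from z to y in X}),
    [/\ U i z, U j z, inside (U i) a, inside (U j) b & homotopic p (path_cat a b)].

(** The intermediate point is taken in a triple intersection; the new path
    lies in U l as well, where paths with the same ends are homotopic. *)
Lemma good_inside l (x y : X) (p : {path I from x to y in X}) :
  inside (U l) p -> good p.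
Proof.
move=> pU i j Uix Ujy.
have Ulx := inside_zero pU.
have Uly := inside_one pU.
have [z [Uiz Ujz Ulz]] := U3 i j l.
have [a [aUi aUl]] := U2 Uix Ulx Uiz Ulz.
have [b [bUj bUl]] := U2 Ujz Ulz Ujy Uly.
exists z, a, b; split => //.
by apply: (Uhomotopic pU); exact: inside_cat.
Qed.

Lemma good_homotopic (x y : X) (p q : {path I from x to y in X}) :
  homotopic p q -> good p -> good q.
Proof.
move=> pq gp i j Uix Ujy; have [z [a [b [Uiz Ujz aU bU pab]]]] := gp i j Uix Ujy.
exists z, a, b; split => //.
exact: homotopic_trans (homotopic_sym pq) pab.
Qed.

(** Writing p as a b and q as c d, where b and c lie in a member that
    contains the common end, the path b c is good in its turn, and can be
    distributed between the two outer members. *)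
Lemma good_cat (x y w : X) (p : {path I from x to y in X})
    (q : {path I from y to w in X}) :
  good p -> good q -> good (path_cat p q).
Proof.
move=> gp gq i j Uix Ujw; have [l Uly] := Ucover y.
have [z [a [b [Uiz Ulz aU bU pab]]]] := gp i l Uix Uly.
have [z' [c [d [Ulz' Ujz' cU dU qcd]]]] := gq l j Uly Ujw.
have gbc : good (path_cat b c) by apply: (@good_inside l); exact: inside_cat.
have [z2 [a' [d' [Uiz2 Ujz2 a'U d'U bcad]]]] := gbc i j Uiz Ujz'.
exists z2, (path_cat a a'), (path_cat d' d); split => //.
- exact: inside_cat.
- exact: inside_cat.
apply: homotopic_trans (homotopic_cat pab qcd) _.
apply: homotopic_trans (homotopic_sym (path_catA _ _ _)) _.
apply: homotopic_trans (homotopic_cat (homotopic_refl _) (path_catA _ _ _)) _.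
apply: homotopic_trans
  (homotopic_cat (homotopic_refl a) (homotopic_cat bcad (homotopic_refl d))) _.
apply: homotopic_trans
  (homotopic_cat (homotopic_refl a) (homotopic_sym (path_catA _ _ _))) _.
exact: path_catA.
Qed.

(** The points of the line that are joined to u by a good segment form a set
    which is open and closed, since short segments lie in a member of the
    cover. *)
Lemma good_seg (f : R -> X) (cf : continuous f) u v : good (seg cf u v).
Proof.
have gtrans a b c : good (seg cf a b) -> good (seg cf b c) -> good (seg cf a c).
  by move=> gab gbc; exact: good_homotopic (seg_cat cf a b c) (good_cat gab gbc).
have gloc t : exists2 d : R, 0 < d & forall a b, `|t - a| < d -> `|t - b| < d ->
    good (seg cf a b).
  have [l Ult] := Ucover (f t).
  have /nbhs_ballP[d /= d0 dU] := cf t _ (open_nbhs_nbhs (conj (Uopen l) Ult)).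
  exists d => // a b ta tb; apply: (@good_inside l) => s; rewrite segE.
  apply: dU; rewrite /ball/=.
  have s0 := unit_interval_ge0 s; have s1 := unit_interval_le1 s.
  have -> : t - (a + (b - a) * val s) =
    (1 - val s) * (t - a) + val s * (t - b) by ring.
  apply: le_lt_trans (ler_normD _ _) _; rewrite !normrM.
  rewrite [`|1 - _|]ger0_norm ?subr_ge0// [`|val s|]ger0_norm//.
  move: ta tb; set A := `|t - a|; set B := `|t - b| => ta tb.
  have [AB|BA] := lerP A B.
    apply: le_lt_trans tb; rewrite -subr_ge0.
    have -> : B - ((1 - val s) * A + val s * B) = (1 - val s) * (B - A) by ring.
    by rewrite mulr_ge0 ?subr_ge0.
  apply: le_lt_trans ta; rewrite -subr_ge0.
  have -> : A - ((1 - val s) * A + val s * B) = val s * (A - B) by ring.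
  by rewrite mulr_ge0// subr_ge0 ltW.
have grefl a : good (seg cf a a).
  by have [d d0 gd] := gloc a; apply: gd; rewrite subrr normr0.
pose S := [set w | good (seg cf u w)].
suff : S = setT by move=> ST; have : setT v by []; rewrite -ST.
have : connected [set: R] by apply/connected_intervalP => ? ? *.
apply.
- by exists u; exact: grefl.
- exists S; last by rewrite setTI.
  rewrite openE => w Sw; have [d d0 gd] := gloc w.
  apply/nbhs_ballP; exists d => //= w' ww'; apply: gtrans Sw _.
  by apply: gd => //; rewrite subrr normr0.
- exists S; last by rewrite setTI.
  move=> w cw; have [d d0 gd] := gloc w.
  have [w' [Sw' /= ww']] := cw _ (nbhsx_ballx w d d0).
  by apply: gtrans Sw' _; apply: gd => //; rewrite subrr normr0.
Qed.

Lemma good_path (x y : X) (p : {path I from x to y in X}) : good p.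
Proof.
suff H (f : R -> X) (cf : continuous f) : forall x y (p : {path I from x to y in X}),
    f 0 = x -> f 1 = y -> (forall t, p t = f (val t)) -> good p.
  apply: (H (extend p)).
  - by apply: extend_continuous; exact: cts_fun.
  - by rewrite extend_le0// path_zero.
  - by rewrite extend_ge1// path_one.
  - by move=> t; rewrite extend_val.
move=> {p x y} x y p fx fy; subst x y => pf.
apply: (good_homotopic _ (@good_seg f cf 0 1)).
by apply: path_ext => t; rewrite segE pf subr0 mul1r add0r.
Qed.

(** A loop is homotopic to a loop in a single member of the cover, where it
    is trivial. Triple intersections allow the members to have no common
    point. *)
Theorem simply_connected_cover (x : X) (p : {path I from x to x in X}) :
  homotopic p (path_cst R x).
Proof.
have [i Uix] := Ucover x.
have [z [a [b [Uiz _ aU bU pab]]]] := good_path p Uix Uix.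
apply: homotopic_trans pab _.
by apply: (Uhomotopic (inside_cat aU bU)) => t.
Qed.

End Cover.

(** Each path is homotopic to the one that follows the track of x to the
    point c and comes back along the track of y, and the latter does not
    depend on the path. *)
Lemma contract_homotopic (U : set X) (F : X -> R -> X) (c : X) :
  (forall z, U z -> F z 0 = z) -> (forall z, U z -> F z 1 = c) ->
  (forall p : I -> X, continuous p -> (forall t, U (p t)) ->
    continuous (fun w : R * R => F (extend p w.1) (clampR w.2))) ->
  forall x y (p q : {path I from x to y in X}),
  inside U p -> inside U q -> homotopic p q.
Proof.
move=> F0 F1 cF x y p q pU qU.
have clamp_le0 (a : R) : a <= 0 -> clampR a = 0.
  by move=> a0; rewrite /clampR max_l// ge_min a0 orbT.
have clamp_ge1 (a : R) : 1 <= a -> clampR a = 1.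
  by move=> a1; rewrite /clampR min_l// max_r.
have clamp0 := clamp_le0 0 (lexx 0).
have clamp1 := clamp_ge1 1 (lexx 1).
(* on the middle third the deformed path is F (p (3 t - 1)) 1 = c *)
pose v1 (t : I) : R := clampR (3 * val t - 1).
pose v2 (t : I) : R := Num.min (3 * val t) (3 - 3 * val t).
have cval := @val_continuous R.
have cv1 : continuous v1.
  apply: (@comp_continuous I R R (fun t => 3 * val t - 1)).
    exact: affine_continuous.
  exact: clampR_continuous.
have c3 : continuous (fun t : I => 3 * val t).
  by apply: mul_cont => //; exact: const_cont.
have cv2 : continuous v2.
  by apply: min_cont => //; apply: sub_cont => //; exact: const_cont.
have v10 : v1 zero = 0 by rewrite /v1 val_zero clamp_le0//; lra.
have v11 : v1 one = 1 by rewrite /v1 val_one clamp_ge1//; lra.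
have v20 : v2 zero = 0 by rewrite /v2 val_zero min_l; lra.
have v21 : v2 one = 0 by rewrite /v2 val_one min_r; lra.
pose G (p : I -> X) (w : R * R) := F (extend p w.1) (clampR w.2).
pose mid (p : I -> X) (t : I) : X := G p (v1 t, v2 t).
have Gp (r : {path I from x to y in X}) : inside U r -> continuous (G r).
  by move=> ?; apply: cF => //; exact: cts_fun.
have midc (r : {path I from x to y in X}) : inside U r -> continuous (mid r).
  move=> pU'; apply: (@comp_continuous I (R * R)%type X (fun t => (v1 t, v2 t))).
    exact: pair_continuous.
  exact: Gp.
have mid0 (r : {path I from x to y in X}) : inside U r -> mid r zero = x.
  move=> pU'; rewrite /mid /G/= v10 v20 extend_le0// clamp0 F0 ?path_zero//.
  exact: inside_zero pU'.
have mid1 (r : {path I from x to y in X}) : inside U r -> mid r one = y.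
  move=> pU'; rewrite /mid /G/= v11 v21 extend_ge1// clamp0 F0 ?path_one//.
  exact: inside_one pU'.
have main (r : {path I from x to y in X}) (pU' : inside U r) :
    homotopic r (mk_path (midc r pU') (mid0 r pU') (mid1 r pU')).
  exists (fun w => G r (val w.1 + val w.2 * (v1 w.1 - val w.1),
                        val w.2 * v2 w.1)); split.
  - apply: (@comp_continuous (I * I)%type (R * R)%type X (fun w : I * I =>
      (val w.1 + val w.2 * (v1 w.1 - val w.1), val w.2 * v2 w.1))); last exact: Gp.
    have cf : continuous (fun w : I * I => val w.1).
      exact: comp_continuous (@fst_cont _ _) cval.
    have cs : continuous (fun w : I * I => val w.2).
      exact: comp_continuous (@snd_cont _ _) cval.
    apply: pair_continuous.
      apply: add_cont => //; apply: mul_cont => //; apply: sub_cont => //.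
      exact: comp_continuous (@fst_cont _ _) cv1.
    apply: mul_cont => //.
    exact: comp_continuous (@fst_cont _ _) cv2.
  - move=> t; cbn [fst snd]; rewrite val_zero val_one !mul0r !mul1r addr0.
    rewrite /G/= extend_val clamp0 F0; last exact: pU'.
    by split=> //; rewrite addrC subrK.
  - move=> s; cbn [fst snd].
    rewrite val_zero val_one v10 v11 v20 v21 !subrr !mulr0 !addr0 /G/=.
    rewrite clamp0 extend_le0// extend_ge1// path_zero path_one.
    by rewrite !F0//; [exact: inside_one pU'|exact: inside_zero pU'].
apply: homotopic_trans (main p pU) _; apply: homotopic_sym.
apply: homotopic_trans (main q qU) _; apply: path_ext => t.
have t0 := unit_interval_ge0 t; have t1 := unit_interval_le1 t.
rewrite -[LHS]/(mid q t) -[RHS]/(mid p t) /mid /G; cbn [fst snd].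
have [ta|ta] := lerP (3 * val t) 1.
  by rewrite /v1 clamp_le0 ?extend_le0 ?path_zero//; lra.
have [tb|tb] := lerP 2 (3 * val t).
  by rewrite /v1 clamp_ge1 ?extend_ge1 ?path_one//; lra.
rewrite [clampR (v2 t)]clamp_ge1; last by rewrite /v2 le_min; apply/andP; split; lra.
by rewrite !F1//; [exact: pU|exact: qU].
Qed.

Lemma pi1_trivial (x : X) :
  (forall p : {path I from x to x in X}, homotopic p (path_cst R x)) ->
  forall a : pi1 R x, a = 1%g.
Proof. by move=> tr a; rewrite -(loop_class_repr a); apply/loop_classP. Qed.

End PathTools.

(** * Continuity of complex functions *)

Section ComplexContinuity.
Variables (R : realType) (T : topologicalType) (x0 : T).
Local Notation C := R[i].

Lemma cont_real (f : T -> R) : f @ x0 --> f x0 ->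
  cont_at x0 (fun t => (f t)%:C%C : C).
Proof.
move=> cf; apply/cont_atP => A /(@nbhs_normP C C^o (f x0)%:C%C)[e /= e0 eA].
have e0' : 0 < complex.Re e by move: e0; rewrite ltcE => /andP[].
have eE : e = (complex.Re e)%:C%C.
  by move: e0; rewrite ltcE /= => /andP[/eqP]; case: (e) => a b /= ->.
move/cvgrPdist_lt : cf => /(_ _ e0'); apply: filterS => t fe; apply: eA => /=.
by rewrite -rmorphB/= normc_def/= expr0n addr0 sqrtr_sqr eE ltcR.
Qed.

Lemma cont_Re (f : T -> C) : cont_at x0 f ->
  (fun t => complex.Re (f t)) @ x0 --> complex.Re (f x0).
Proof.
move=> /cont_atP cf; apply/cvgrPdist_lt => e e0.
have : nbhs (f x0) [set z : C | `|f x0 - z| < e%:C%C].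
  apply/(@nbhs_normP C C^o (f x0)); exists e%:C%C => //=.
  by rewrite ltcR.
move=> /cf; apply: filterS => t.
rewrite -ltcR; apply: le_lt_trans; apply: le_trans (normc_ge_Re _).
by case: (f x0) => ? ?; case: (f t) => ? ?.
Qed.

Lemma cont_conj (f : T -> C) : cont_at x0 f ->
  cont_at x0 (fun t => (f t)^*%C).
Proof.
move=> cf; have := cont_real (cont_Re cf).
move=> /(cont_mul (@cont_cst R T x0 2)) c2.
apply: (@greg_eq _ (cont_germ R x0) _ _ _
  (@greg_sub _ (cont_germ R x0) _ _ c2 cf)) => t /=.
by case: (f t) => a b; apply/eqP; rewrite eq_complex /=; apply/andP; split;
  apply/eqP; ring.
Qed.

Lemma cont_Im (f : T -> C) : cont_at x0 f ->
  (fun t => complex.Im (f t)) @ x0 --> complex.Im (f x0).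
Proof.
move=> cf; have := cont_Re (cont_mul (@cont_cst R T x0 (- 'i)%C) cf).
have E (z : C) : complex.Re ((- 'i)%C * z) = complex.Im z.
  by case: z => a b /=; ring.
move=> H; rewrite -(E (f x0)).
have -> : (fun t => complex.Im (f t)) = (fun t => complex.Re ((- 'i)%C * f t)).
  by apply/funext => t; rewrite (E (f t)).
exact: H.
Qed.

Lemma cont_complex (f g : T -> R) : f @ x0 --> f x0 -> g @ x0 --> g x0 ->
  cont_at x0 (fun t => (f t +i* g t)%C : C).
Proof.
move=> /cont_real cf /cont_real cg.
apply: (@greg_eq _ (cont_germ R x0)
  (fun t => (f t)%:C%C + 'i%C * (g t)%:C%C)) => [t|].
  by apply/eqP; rewrite eq_complex /=; apply/andP; split; apply/eqP; ring.
apply: (@greg_add _ (cont_germ R x0)); first exact: cf.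
apply: (@greg_mul _ (cont_germ R x0)); [exact: greg_cst|exact: cg].
Qed.

End ComplexContinuity.

(** * Zariski open conditions on tuples of subspaces *)

(** The arcs s + i c s (1 - s) from 0 to 1 only meet at their ends, so each
    root lies on at most one of them. *)
Lemma path_avoid (R : realType) (q : {poly R[i]}) : q != 0 ->
  exists c : R, forall s : R, 0 < s < 1 -> q.[(s +i* (c * (s * (1 - s))))%C] != 0.
Proof.
move=> q0; apply: contrapT => /forallNP Nc.
have {}Nc j : exists s : R, 0 < s < 1 /\ root q (s +i* (j%:R * (s * (1 - s))))%C.
  have /existsNP[s /not_implyP[s01 /negP]] := Nc j%:R.
  by rewrite negbK => ?; exists s.
have [s sP] := choice Nc.
pose z j : R[i] := (s j +i* (j%:R * (s j * (1 - s j))))%C.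
have zI : injective z.
  move=> j j' [sE]; rewrite -sE.
  have [/andP[s0 s1] _] := sP j.
  have /mulIf/[apply]/eqP : s j * (1 - s j) != 0.
    by rewrite mulf_neq0// ?gt_eqF// subr_gt0.
  by rewrite eqr_nat => /eqP.
have [j /negP] := poly_avoid zI q0; apply.
by have [_ /rootP ->] := sP j.
Qed.

Lemma small_nonroot (R : realType) (q : {poly R[i]}) (N : R -> Prop) : q != 0 ->
  (\forall u \near (0 : R), N u) ->
  exists2 d : R, q.[1 - d%:C%C] != 0 & forall u, 0 <= u <= 1 -> N (d * u).
Proof.
move=> q0 nN; have nN' : nbhs (0 : R) [set u | N u] by [].
have /nbhs_ballP[d /= d0 dN] := nN'.
have [j jq] : exists j : nat, q.[1 - (d / j.+2%:R)%:C%C] != 0.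
  apply: (@poly_avoid _ _ (fun j : nat => 1 - (d / j.+2%:R)%:C%C)) => //.
  move=> i j /addrI/oppr_inj/complexI/(mulfI (lt0r_neq0 d0))/invr_inj/eqP.
  by rewrite eqr_nat => /eqP[].
exists (d / j.+2%:R) => // u /andP[u0 u1].
have ep0 : 0 < d / j.+2%:R by rewrite divr_gt0.
have epd : d / j.+2%:R < d by rewrite ltr_pdivrMr// ltr_pMr// ltr1n.
apply: dN; rewrite /ball/= sub0r normrN ger0_norm ?mulr_ge0// 1?ltW//.
by apply: le_lt_trans epd; rewrite ler_piMr// ltW.
Qed.

Section ZariskiOpen.
Variables (R : realType) (V : vectType R[i]) (m k h : nat).
Local Notation C := R[i].
Local Notation I := (unit_interval R).
Local Notation n := (m + k)%N.
Variables (e : n.-tuple V) (eB : basis_of {:V} e).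
Local Notation Z := {ptws 'I_h -> Gr V m}.
Local Notation E := ('I_h -> 'M[C]_(m, k)).

Definition charts (g : 'M[C]_n) (x : Z) : E := fun a => chart eB g (x a).
Definition cocharts (g : 'M[C]_n) (Y : E) : Z := fun a => cochart eB g (Y a).
Definition in_charts (g : 'M[C]_n) (x : Z) : Prop := forall a, in_chart eB g (x a).

Lemma chartsK g x : g \in unitmx -> in_charts g x -> cocharts g (charts g x) = x.
Proof. by move=> ug cx; apply/funext => a; exact: chartK. Qed.

Lemma cochartsK g Y : g \in unitmx -> charts g (cocharts g Y) = Y.
Proof. by move=> ug; apply/funext => a; exact: cochartK. Qed.

Lemma in_cocharts g Y : g \in unitmx -> in_charts g (cocharts g Y).
Proof. by move=> ug a; exact: in_chart_cochart. Qed.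

(** For one subspace the suitable g form a nonempty gopen condition, and
    finitely many such conditions can be satisfied together. *)
Lemma common_chart_gopen (J : finType) (x : J -> Gr V m) :
  let P (Y : 'I_1 -> 'M[C]_n) :=
    Y ord0 \in unitmx /\ forall j, in_chart eB (Y ord0) (x j) in
  gopen P /\ exists Y, P Y.
Proof.
pose P (o : option J) (Y : 'I_1 -> 'M[C]_n) : Prop :=
  if o is Some j then in_chart eB (Y ord0) (x j) else Y ord0 \in unitmx.
have oP o : gopen (P o).
  case: o => [j|] G Y rY /= PY; last exact: gev_unit.
  rewrite /in_chart; apply: (@gev_unit _ _ _ (fun t => lsubmx (rep eB (x j) *m Y t ord0))) => //.
  by apply: gmx_lsub; apply: gmx_mul => //; exact: gmx_cst.
have nP o : exists Y, P o Y.
  case: o => [j|] /=.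
    by have [g _ gx] := exists_chart eB (x j); exists (fun=> g).
  by exists (fun=> 1%:M); exact: unitmx1.
split=> [G Y rY [uY cY]|].
  have PY o : P o (Y (gpt G)) by case: o => [j|] /=.
  apply: gevS (gopen_forall oP rY PY) => t Pt.
  by split; [exact: (Pt None)|move=> j; exact: (Pt (Some j))].
have [Y PY] := gopen_meet_all oP nP.
by exists Y; split; [exact: (PY None)|move=> j; exact: (PY (Some j))].
Qed.

Lemma common_chart (J : finType) (x : J -> Gr V m) :
  exists2 g, g \in unitmx & forall j, in_chart eB g (x j).
Proof. by have [_ [Y [uY cY]]] := common_chart_gopen x; exists (Y ord0). Qed.

Lemma common_charts2 (x y : Z) :
  exists g, [/\ g \in unitmx, in_charts g x & in_charts g y].
Proof.
have [g ug gxy] := common_chart (fun j : 'I_h + 'I_h =>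
  match j with inl a => x a | inr a => y a end).
by exists g; split => // a; [exact: (gxy (inl a))|exact: (gxy (inr a))].
Qed.

(** Openness with a thin complement: in each chart, a complex line through a
    point of P leaves P at finitely many points only. *)
Definition zopen (P : set Z) : Prop :=
  forall g, g \in unitmx -> gopen (fun Y : E => P (cocharts g Y)).

Lemma zopenI P Q : zopen P -> zopen Q -> zopen (P `&` Q).
Proof. by move=> oP oQ g ug; exact: gopenI (oP g ug) (oQ g ug). Qed.

Lemma zopen_meet P Q x y : zopen P -> zopen Q -> P x -> Q y ->
  exists z, P z /\ Q z.
Proof.
move=> oP oQ Px Qy; have [g [ug gx gy]] := common_charts2 x y.
rewrite -(chartsK ug gx) in Px; rewrite -(chartsK ug gy) in Qy.
have [Y PQY] := gopen_meet (oP g ug) (oQ g ug) Px Qy.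
by exists (cocharts g Y).
Qed.

Lemma cocharts_cvg (T : topologicalType) (x : T) g (Y : T -> E) :
  g \in unitmx -> (forall a, gmx (G := cont_germ R x) (fun t => Y t a)) ->
  (fun t => cocharts g (Y t)) @ x --> cocharts g (Y x).
Proof.
move=> ug cY; apply: ptws_cvg => a.
apply: (Gr_of_mx_cvg_free (F := fun t => row_mx 1%:M (Y t a) *m invmx g)).
  apply: gmx_mul; last exact: gmx_cst.
  by apply: gmx_row_mx; [exact: gmx_cst|exact: cY].
exact: cochart_free.
Qed.

Lemma gmx_cline_var (G : germ C) (s : G -> C) (x y : G -> E) a :
  greg s -> gmx (fun t => x t a) -> gmx (fun t => y t a) ->
  gmx (fun t => cline (x t) (y t) (s t) a).
Proof.
move=> rs rx ry; apply: gmx_add; first exact: rx.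
by apply: gmx_scale; [exact: rs|exact: gmx_sub].
Qed.

Lemma gmx_cline (G : germ C) (s : G -> C) (x y : E) a :
  greg s -> gmx (fun t => cline x y (s t) a).
Proof. by move=> rs; apply: gmx_cline_var => //; exact: gmx_cst. Qed.

(** In a chart that contains both points, an arc of the complex line through
    them avoids the finitely many points outside P. *)
Lemma zopen_path P x y : zopen P -> P x -> P y ->
  exists f : I -> Z,
    [/\ continuous f, f zero = x, f one = y & forall t, P (f t)].
Proof.
move=> oP Px Py; have [g [ug gx gy]] := common_charts2 x y.
have [q [q0 qP]] := gopen_line (charts g y) (oP g ug)
  (eq_ind_r P Px (chartsK ug gx)).
have [c cq] := path_avoid (poly_horner_neq0 q0).
pose s (t : I) : C := (val t +i* (c * (val t * (1 - val t))))%C.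
have cs t : cont_at t s.
  have cval := @val_continuous R.
  apply: (@cont_complex _ _ t val (fun t => c * (val t * (1 - val t)))).
    exact: cval.
  have : continuous (fun t : I => c * (val t * (1 - val t))).
    apply: mul_cont; first exact: const_cont.
    by apply: mul_cont => //; apply: sub_cont => //; exact: const_cont.
  by apply.
exists (fun t => cocharts g (cline (charts g x) (charts g y) (s t))); split.
- move=> t; apply: (cocharts_cvg (Y := fun t => _)) => // a.
  by apply: (@gmx_cline (cont_germ R t)); exact: cs.
- by rewrite /s val_zero mul0r mulr0 cline0 chartsK.
- by rewrite /s val_one subrr !mulr0 cline1 chartsK.
move=> t; have := unit_interval_ge0 t; rewrite le_eqVlt => /predU1P[t0|t0].
  by rewrite /s -t0 mul0r mulr0 cline0 chartsK.
have := unit_interval_le1 t; rewrite le_eqVlt => /predU1P[t1|t1].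
  by rewrite /s t1 subrr !mulr0 cline1 chartsK.
by apply: qP; apply: cq; rewrite t0.
Qed.

(** On the complex line from x to a point of P, arbitrarily small real times
    lie in P. *)
Lemma zopen_dense_path S P (O : set Z) x y : zopen S -> zopen P -> open O ->
  S x -> O x -> P y ->
  exists f : I -> Z, [/\ continuous f, f zero = x, P (f one) &
    forall t, S (f t) /\ O (f t)].
Proof.
move=> oS oP oO Sx Ox Py; have [g [ug gx gy]] := common_charts2 x y.
have [q [q0 qP]] := gopen_line (charts g x) (oP g ug)
  (eq_ind_r P Py (chartsK ug gy)).
pose f (u : R) := cocharts g (cline (charts g x) (charts g y) (u%:C)%C).
have cr (T : topologicalType) (t : T) (u : T -> R) a : u @ t --> u t ->
    gmx (G := cont_germ R t)
      (fun t => cline (charts g x) (charts g y) ((u t)%:C)%C a).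
  move=> cu; apply: (@gmx_cline (cont_germ R t)); exact: cont_real.
have cf (u : R) : f @ u --> f u.
  by apply: cocharts_cvg => // a; apply: cr; exact: cvg_id.
have f0 : f 0 = x by rewrite /f cline0 chartsK.
have nO : \forall u \near (0 : R), O (f u).
  by apply: cf; apply: open_nbhs_nbhs; split => //; rewrite f0.
have nS : \forall u \near (0 : R), S (f u).
  apply: (@cont_gevP R R 0).
  apply: (oS g ug (cont_germ R (0 : R))
    (fun u : R => cline (charts g x) (charts g y) (u%:C)%C)).
    by move=> a; apply: cr; exact: cvg_id.
  by rewrite /= -/(f 0) f0.
have [ep epq epN] := small_nonroot (poly_horner_neq0 q0) (filterI nS nO).
exists (fun t => f (ep * val t)); split.
- move=> t; apply: (@continuous_comp _ _ _ (fun t : I => ep * val t) f); last exact: cf.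
  have : continuous (fun t : I => ep * val t).
    by apply: mul_cont; [exact: const_cont|exact: val_continuous].
  by apply.
- by rewrite val_zero mulr0.
- rewrite val_one mulr1 /f cline_rev; exact: qP.
by move=> t; apply: epN; rewrite unit_interval_ge0 unit_interval_le1.
Qed.

End ZariskiOpen.

(** * Star-shaped covers *)

Section Lift.
Variables (Z : topologicalType) (S : set Z).
Let X : topologicalType := set_type S.

Lemma lift_cvg (T : topologicalType) (x : T) (F : T -> X) :
  (fun t => val (F t)) @ x --> val (F x) -> F @ x --> F x.
Proof. by move=> cF; apply: (@initial_cvg _ _ _ (set_val : X -> Z)). Qed.

Lemma lift_path (R : realType) (f : unit_interval R -> Z) (x y : X) :
  continuous f -> (forall t, S (f t)) -> f zero = val x -> f one = val y ->
  exists p : {path (unit_interval R) from x to y in X}, forall t, val (p t) = f t.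
Proof.
move=> cf Sf f0 f1.
pose F t : X := exist (fun z => z \in S) (f t) (mem_set (Sf t)).
have cF : continuous F by move=> t; apply: lift_cvg; exact: cf.
have F0 : F zero = x by exact: val_inj.
have F1 : F one = y by exact: val_inj.
by exists (mk_path cF F0 F1).
Qed.

Lemma setval_cvg (x : X) : (val : X -> Z) @ x --> val x.
Proof. exact: (@initial_continuous _ _ (set_val : X -> Z)). Qed.

Lemma setval_in (x : X) : S (val x).
Proof. exact/set_mem/(valP x). Qed.

Lemma subtype_open (U : set X) : open U -> exists2 B : set Z, open B &
  forall x : X, U x <-> B (val x).
Proof. by move=> [B oB <-]; exists B. Qed.

End Lift.

Section StarCover.
Variables (R : realType) (V : vectType R[i]) (m k h : nat).
Local Notation C := R[i].
Local Notation I := (unit_interval R).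
Local Notation n := (m + k)%N.
Variables (e : n.-tuple V) (eB : basis_of {:V} e).
Local Notation Z := {ptws 'I_h -> Gr V m}.
Local Notation E := ('I_h -> 'M[C]_(m, k)).
Variable S : set Z.
Let X : topologicalType := set_type S.

Hypothesis S_zopen : zopen eB S.
Hypothesis S_neq0 : exists z, S z.

Lemma zopen_path_connected : path_connected R X.
Proof.
split; first by have [z Sz] := S_neq0; split; exists z; exact: mem_set.
move=> x y.
have [f [cf f0 f1 Sf]] := zopen_path S_zopen (setval_in x) (setval_in y).
by have [p _] := lift_path cf Sf f0 f1.
Qed.

(** The stars are taken with respect to an open condition Om on the
    coordinates of the points of S. Their centres are restricted by ctr so
    that almost all segments from a centre P satisfy Om, namely those that
    end at a point Y with gen P Y. *)
Variable Om : E -> Prop.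
Hypothesis Om_gopen : gopen Om.
Hypothesis S_Om : forall g z, g \in unitmx -> S z -> in_charts eB g z ->
  Om (charts eB g z).
Variable ctr : E -> Prop.
Hypothesis ctr_gopen : gopen ctr.
Hypothesis ctr_neq0 : exists P, ctr P.
Variable gen : E -> E -> Prop.
Hypothesis gen_gopen : forall P, ctr P -> gopen (gen P).
Hypothesis gen_neq0 : forall P, ctr P -> exists Y, gen P Y.
Hypothesis gen_Om : forall P Y (s : R), ctr P -> gen P Y -> 0 <= s <= 1 ->
  Om (cline Y P (s%:C)%C).

Definition star (g : 'M[C]_n) (P : E) : set X :=
  [set x : X | in_charts eB g (val x) /\
    forall s : R, 0 <= s <= 1 -> Om (cline (charts eB g (val x)) P (s%:C)%C)].

Definition gstar (g : 'M[C]_n) (P : E) : set Z :=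
  [set z | in_charts eB g z /\ gen P (charts eB g z)].

Lemma charts_cvg (T : topologicalType) (t : T) (F : T -> Z) g a :
  F @ t --> F t -> in_chart eB g (F t a) ->
  gmx (G := cont_germ R t) (fun u => charts eB g (F u) a).
Proof.
move=> cF cFa i j; apply/cont_atP => A nA.
have /cont_atP/(_ A nA) := @chart_cont R V m k e eB g (F t a) cFa i j.
exact: (@ptws_proj_cvg _ _ _ F t a cF).
Qed.

Lemma in_chart_near (x : X) g a : in_chart eB g (val x a) ->
  \forall x' \near x, in_chart eB g (val x' a).
Proof.
move=> cx.
exact: (ptws_near (F := fun x : X => val x) (@setval_cvg Z S x)
  (in_chart_open eB g) cx).
Qed.

Lemma in_charts_near (x : X) g : in_charts eB g (val x) ->
  \forall x' \near x, in_charts eB g (val x').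
Proof.
move=> cx.
pose f (a : 'I_h) : set X := [set x' | in_chart eB g (val x' a)].
suff : \forall x' \near x, forall a, f a x' by [].
have FF : Filter (nbhs x) by exact: nbhs_filter.
exact: (@filter_forall _ _ f (nbhs x) FF (fun a => in_chart_near (cx a))).
Qed.

(** By compactness of the unit interval. *)
Lemma star_open g P : open (star g P).
Proof.
rewrite openE => x [cx Omx].
have nc := in_charts_near cx.
have ncov := proj1 (@compact_near_coveringP R `[(0:R), 1]) (@segment_compact R 0 1).
have FF : Filter (nbhs x) by exact: nbhs_filter.
pose Q (x' : X) (s : R) : Prop :=
  Om (cline (charts eB g (val x')) P (s%:C)%C).
have ns : \forall x' \near x, `[(0:R), 1] `<=` Q x'.
  apply: (ncov X (nbhs x) Q FF) => s; rewrite /= in_itv/= => s01; rewrite /Q.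
  have H := Om_gopen (G := cont_germ R (s, x))
    (Y := fun w : R * X => cline (charts eB g (val w.2)) P (w.1%:C)%C).
  apply: (cont_gevP (H _ (Omx s s01))) => a.
  have cw : (fun w : R * X => val w.2) @ (s, x) --> val x.
    apply: (@cvg_comp _ _ _ (fun w : R * X => w.2) (fun y : X => val y)).
      exact: cvg_snd.
    exact: setval_cvg.
  have cch : gmx (G := cont_germ R (s, x)) (fun w => charts eB g (val w.2) a).
    exact: (@charts_cvg _ (s, x) (fun w : R * X => val w.2) g a cw (cx a)).
  apply: (@gmx_cline_var _ _ _ _ (cont_germ R (s, x)) (fun w => (w.1%:C)%C)
    (fun w => charts eB g (val w.2)) (fun=> P) a).
  - by apply: (@cont_real _ _ (s, x) (fun w : R * X => w.1)); exact: cvg_fst.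
  - exact: cch.
  - exact: gmx_cst.
by apply: filterS2 nc ns => x' cx' sx'; split=> // s s01; apply: sx'; rewrite /= in_itv.
Qed.

(** The coordinates in the chart of g are rational functions of the
    coordinates in any other chart. *)
Lemma gstar_zopen g P : g \in unitmx -> ctr P -> zopen eB (gstar g P).
Proof.
move=> ug cP g' ug' G Y rY [cY gY].
pose M t a : 'M[C]_(m, n) := row_mx 1%:M (Y t a) *m invmx g' *m g.
have rM a : gmx (fun t => M t a).
  apply: gmx_mul; last exact: gmx_cst.
  apply: gmx_mul; last exact: gmx_cst.
  by apply: gmx_row_mx; [exact: gmx_cst|exact: rY].
have cE t a : in_chart eB g (cocharts eB g' (Y t) a) <->
    lsubmx (M t a) \in unitmx.
  by apply: in_chart_Gr_of_mx; exact: cochart_free.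
have uM a : gev (fun t => lsubmx (M t a) \in unitmx).
  apply: (@gev_unit _ _ _ (fun t => lsubmx (M t a))); first exact: gmx_lsub.
  exact: (proj1 (cE _ _) (cY a)).
pose Y' t a : 'M[C]_(m, k) := invmx (lsubmx (M t a)) *m rsubmx (M t a).
have Y'E t : (forall a, lsubmx (M t a) \in unitmx) ->
    charts eB g (cocharts eB g' (Y t)) = Y' t.
  move=> u; apply/funext => a; apply: chart_Gr_of_mx; first exact: cochart_free.
  exact: u.
have uM0 a : lsubmx (M (gpt G) a) \in unitmx by exact: (proj1 (cE _ _) (cY a)).
have rY' a : gmx (fun t => Y' t a).
  by apply: gmx_mul; [apply: gmx_inv; [exact: gmx_lsub|exact: uM0]|exact: gmx_rsub].
have gY' : gen P (Y' (gpt G)) by rewrite -Y'E.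
apply: gevS (gevI (gev_forall uM) (gen_gopen cP rY' gY')) => t [ut gt].
by split; [move=> a; apply/cE|rewrite Y'E].
Qed.

Lemma gstar_neq0 g P : g \in unitmx -> ctr P -> exists z, gstar g P z.
Proof.
move=> ug cP; have [Y gY] := gen_neq0 cP.
exists (cocharts eB g Y); split; first exact: in_cocharts.
by rewrite cochartsK.
Qed.

Lemma gstar_star g P (x : X) : ctr P -> gstar g P (val x) -> star g P x.
Proof. by move=> cP [cx gx]; split=> // s; exact: gen_Om. Qed.

(** The centre is taken close to x on the complex line from x to some
    admissible centre, so that the segment from x to it still satisfies Om. *)
Lemma star_cover (x : X) :
  exists g P, [/\ g \in unitmx, ctr P & star g P x].
Proof.
have [g ug cx] := common_chart eB (val x : 'I_h -> Gr V m).
have [P0 cP0] := ctr_neq0.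
set Y := charts eB g (val x).
have OY : Om Y by apply: S_Om => //; exact: setval_in.
have [q [q0 qP]] := gopen_line Y ctr_gopen cP0.
have nO : \forall u \near (0 : R), Om (cline Y P0 (u%:C)%C).
  apply: (@cont_gevP R R 0).
  apply: (Om_gopen (G := cont_germ R (0 : R))
    (Y := fun u : R => cline Y P0 (u%:C)%C)).
    move=> a; apply: (@gmx_cline _ _ _ _ (cont_germ R (0 : R))).
    by apply: cont_real; exact: cvg_id.
  by rewrite /= cline0.
have [d dq dO] := small_nonroot (poly_horner_neq0 q0) nO.
exists g, (cline P0 Y (1 - d%:C%C)); split; [exact: ug|exact: qP|].
split; first exact: cx.
move=> s s01; have := dO s s01.
by rewrite -(cline_rev Y P0 (d%:C)%C) cline_cline rmorphM.
Qed.

Local Notation J := {gP : 'M[C]_n * E | gP.1 \in unitmx /\ ctr gP.2}.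

Lemma dense_path_in (O : set X) (P : set Z) (x : X) y :
  open O -> zopen eB P -> O x -> P y ->
  exists (x' : X) (p : {path I from x to x' in X}), P (val x') /\ inside O p.
Proof.
move=> /subtype_open[B oB OB] zP Ox Py.
have Bx : B (val x) by apply/OB.
have [f [cf f0 Pf SBf]] := zopen_dense_path S_zopen zP oB (setval_in x) Bx Py.
have Sf t : S (f t) by have [] := SBf t.
pose x' : X := exist (fun z => z \in S) (f one) (mem_set (Sf one)).
have [p pE] := @lift_path _ _ _ f x x' cf Sf f0 erefl.
exists x', p; split; first exact: Pf.
by move=> t; apply/OB; rewrite pE; have [] := SBf t.
Qed.

Lemma generic_path (P : set Z) (x y : X) :
  zopen eB P -> P (val x) -> P (val y) -> P `<=` S ->
  exists p : {path I from x to y in X}, forall t, P (val (p t)).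
Proof.
move=> zP Px Py PS.
have [f [cf f0 f1 Pf]] := zopen_path zP Px Py.
have [p pE] := lift_path cf (fun t => PS _ (Pf t)) f0 f1.
by exists p => t; rewrite pE.
Qed.

Hypothesis star_contract : forall g P, g \in unitmx -> ctr P ->
  forall (x y : X) (p q : {path I from x to y in X}),
  inside (star g P) p -> inside (star g P) q -> homotopic p q.

(** A point of an intersection of stars can be moved inside it to a general
    point [dense_path_in], and general points are joined by a path made of
    general points [generic_path]. *)
Theorem simply_connected_star : simply_connected R X.
Proof.
split; first exact: zopen_path_connected.
move=> x; apply: pi1_trivial => p.
have [z0 Sz0] := S_neq0.
pose U (i : J) : set X := star (proj1_sig i).1 (proj1_sig i).2.
have zU (i : J) : zopen eB (gstar (proj1_sig i).1 (proj1_sig i).2).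
  by have [? ?] := proj2_sig i; exact: gstar_zopen.
have nU (i : J) : exists z, gstar (proj1_sig i).1 (proj1_sig i).2 z.
  by have [? ?] := proj2_sig i; exact: gstar_neq0.
have GU (i : J) (x' : X) : gstar (proj1_sig i).1 (proj1_sig i).2 (val x') -> U i x'.
  by have [? ?] := proj2_sig i; exact: gstar_star.
have meet (i j : J) : exists z,
    S z /\ (gstar (proj1_sig i).1 (proj1_sig i).2 z /\ gstar (proj1_sig j).1 (proj1_sig j).2 z).
  have [zi Gi] := nU i; have [zj Gj] := nU j.
  have [z Gz] := zopen_meet (zU i) (zU j) Gi Gj.
  exact: (zopen_meet S_zopen (zopenI (zU i) (zU j)) Sz0 Gz).
apply: (@simply_connected_cover R X J U).
- by move=> i; exact: star_open.
- move=> x'; have [g [P [ug cP sx']]] := star_cover x'.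
  by exists (exist _ (g, P) (conj ug cP)).
- move=> i j x1 y1 Uix Ujx Uiy Ujy.
  have [z Gz] := meet i j.
  have zG := zopenI S_zopen (zopenI (zU i) (zU j)).
  have oO : open (U i `&` U j) by apply: openI; exact: star_open.
  have [x2 [a [Gx2 aO]]] := dense_path_in oO zG (conj Uix Ujx) Gz.
  have [y2 [b [Gy2 bO]]] := dense_path_in oO zG (conj Uiy Ujy) Gz.
  have [c cG] := generic_path zG Gx2 Gy2 (fun z Gz => proj1 Gz).
  have cO : inside (U i `&` U j) c.
    by move=> t; have [_ [Gi Gj]] := cG t; split; exact: GU.
  have pO := inside_cat aO (inside_cat cO (inside_rev bO)).
  by exists (path_cat a (path_cat c (path_rev b))); split=> t; have [] := pO t.
- move=> i j l; have [z1 Gz1] := meet i j; have [zl Gl] := nU l.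
  have [z [[Sz [Gi Gj]] {}Gl]] :=
    zopen_meet (zopenI S_zopen (zopenI (zU i) (zU j))) (zU l) Gz1 Gl.
  by exists (exist (fun z => z \in S) z (mem_set Sz)); split; exact: GU.
- move=> i x1 y1 a b; have [ui ci] := proj2_sig i; exact: star_contract.
Qed.

End StarCover.

(** * Pencils of matrices *)

Section Kalman.
Variables (F : fieldType) (r : nat).
Implicit Types (B D : 'M[F]_(r, r + 1)).

(** If B = (B1 | b) and D = (D1 | d) with B1 invertible, row and column
    operations turn s B + t D into (s + t X | t y), with X = kal_x B D and y
    = kal_y B D. The columns of the matrix kalman B D are y, X y, X^2 y and
    so on. *)
Definition kal_x B D : 'M[F]_r := invmx (lsubmx B) *m lsubmx D.
Definition kal_y B D : 'cV[F]_r :=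
  invmx (lsubmx B) *m rsubmx D - kal_x B D *m (invmx (lsubmx B) *m rsubmx B).
Definition kalman B D : 'M[F]_r :=
  \matrix_(i, j) iter j (mulmx (kal_x B D)) (kal_y B D) i 0.

(** A row vector w that kills (a + b X | b y) is an eigenvector of X when b
    is not 0, and kills y, hence all the X^j y, hence w = 0. *)
Lemma kalman_pencil B D (a b : F) :
  lsubmx B \in unitmx -> kalman B D \in unitmx -> (a != 0) || (b != 0) ->
  row_free (a *: B + b *: D).
Proof.
move=> uB uK ab; apply: row_free_ker => u uBD.
pose w := u *m lsubmx B; set X := kal_x B D.
suff w0 : w = 0 by rewrite -[u](mulmxK uB) -/w w0 mul0mx.
have wX : a *: w + b *: (w *m X) = 0.
  have := congr1 lsubmx uBD; rewrite lsubmx_mul raddf0 linearD !linearZ/=.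
  rewrite mulmxDr -!scalemxAr => <-.
  by rewrite /w /X /kal_x -mulmxA mulKVmx.
set c := invmx (lsubmx B) *m rsubmx B.
have wc : a *: (w *m c) + b *: (w *m (kal_y B D + X *m c)) = 0.
  have := congr1 rsubmx uBD; rewrite rsubmx_mul raddf0 linearD !linearZ/=.
  rewrite mulmxDr -!scalemxAr => <-.
  by rewrite /kal_y subrK /w /c -!mulmxA !mulKVmx.
have [b0|b0] := eqVneq b 0.
  move: wX ab; rewrite b0 scale0r addr0 eqxx orbF => /eqP.
  by rewrite scaler_eq0 => /orP[/eqP->|/eqP//]; rewrite eqxx.
have wXE : w *m X = - (a / b) *: w.
  apply: (scalerI b0); rewrite scalerA mulrN mulrC divfK// scaleNr.
  by apply/eqP; rewrite -addr_eq0 addrC wX.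
have wy : w *m kal_y B D = 0.
  have : b *: (w *m kal_y B D) = 0.
    rewrite -[RHS]wc (mulmxDr w (kal_y B D)) (mulmxA w X) wXE -scalemxAl scalerDr scalerA.
    by rewrite mulrN mulrC divfK// scaleNr addrCA addrN addr0.
  by move/eqP; rewrite scaler_eq0 (negbTE b0) => /eqP.
have wK : w *m kalman B D = 0.
  apply/rowP => j; rewrite !mxE.
  have : w *m iter j (mulmx X) (kal_y B D) = 0.
    elim: (nat_of_ord j) => //= i IHi.
    by rewrite mulmxA wXE -scalemxAl IHi scaler0.
  move/matrixP => /(_ 0 0); rewrite !mxE => E; rewrite -[RHS]E.
  by apply: eq_bigr => i _; congr (_ * _); rewrite /kalman mxE.
by rewrite -[w](mulmxK uK) wK mul0mx.
Qed.

(** Realized by a shift X and the first basis vector y. *)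
Lemma kalman_ex B : lsubmx B \in unitmx -> exists D, kalman B D \in unitmx.
Proof.
move=> uB.
pose X : 'M[F]_r := \matrix_(i, j) (i == j.+1 :> nat)%:R.
pose y : 'cV[F]_r := \col_i (i == 0 :> nat)%:R.
set c := invmx (lsubmx B) *m rsubmx B.
pose D : 'M[F]_(r, r + 1) := row_mx (lsubmx B *m X) (lsubmx B *m (y + X *m c)).
have XE : kal_x B D = X by rewrite /kal_x row_mxKl mulKmx.
have yE : kal_y B D = y by rewrite /kal_y XE row_mxKr mulKmx// addrK.
exists D; suff -> : kalman B D = 1%:M by exact: unitmx1.
apply/matrixP => i j; rewrite !mxE XE yE.
have itE (l : nat) (a : 'I_r) : (l < r)%N ->
    iter l (mulmx X) y a 0 = (a == l :> nat)%:R.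
  elim: l a => [|l IHl] a lr; first by rewrite !mxE.
  rewrite iterS mxE (bigD1 (Ordinal (ltnW lr)))//= IHl ?(ltnW lr)// eqxx mulr1.
  rewrite big1 ?addr0 ?mxE// => l' /negbTE l'l; rewrite IHl ?(ltnW lr)//.
  by rewrite -[l' == _ :> nat]/(l' == Ordinal (ltnW lr)) l'l mulr0.
by rewrite itE.
Qed.

Lemma kalman_reg (G : germ F) B (D : G -> 'M[F]_(r, r + 1)) :
  gmx D -> gmx (fun t => kalman B (D t)).
Proof.
move=> rD.
have rx : gmx (fun t => kal_x B (D t)).
  by apply: gmx_mul; [exact: gmx_cst|exact: gmx_lsub].
have ry : gmx (fun t => kal_y B (D t)).
  apply: gmx_sub; apply: gmx_mul => //; [exact: gmx_cst|exact: gmx_rsub|exact: gmx_cst].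
move=> i j.
have rit l : gmx (fun t => iter l (mulmx (kal_x B (D t))) (kal_y B (D t))).
  by elim: l => [|l IHl] //=; exact: gmx_mul.
by apply: greg_eq (rit j i 0) => t; rewrite mxE.
Qed.

End Kalman.

(** A matrix that is not square contains, up to transposition, a submatrix
    with one more column than rows whose rank, if maximal, forces that of
    the matrix to be maximal. *)
Lemma pencil_selector (F : fieldType) p c : p <> c ->
  exists r (L : 'M[F]_(p, c) -> 'M[F]_(r, r + 1)),
  [/\ forall a b A B, L (a *: A + b *: B) = a *: L A + b *: L B,
      forall (G : germ F) (A : G -> 'M[F]_(p, c)), gmx A -> gmx (fun t => L (A t)),
      forall D, exists A, L A = D &
      forall A, row_free (L A) -> \rank A = minn p c].
Proof.
move=> /eqP; rewrite neq_ltn => /orP[pc|cp].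
- have pc1 : (p + 1 <= c)%N by rewrite addn1.
  exists p, (mxsub id (widen_ord pc1)); split.
  + by move=> a b A B; apply/matrixP => i j; rewrite !mxE.
  + by move=> G A rA; exact: gmx_mxsub.
  + move=> D; exists (\matrix_(i, j) if insub (val j) is Some j' then D i j' else 0).
    apply/matrixP => i j; rewrite !mxE/= insubT//= => lj.
    by congr (D i _); exact: val_inj.
  move=> A /eqP rA; apply/eqP; rewrite eqn_leq (minn_idPl (ltnW pc)).
  rewrite rank_leq_row/= -{1}rA.
  rewrite [mxsub _ _ _](_ : _ = A *m (colsub (widen_ord pc1) 1%:M)).
    exact: mxrankM_maxl.
  by rewrite mulmx_colsub mulmx1.
- have cp1 : (c + 1 <= p)%N by rewrite addn1.
  exists c, (fun A => (mxsub (widen_ord cp1) id A)^T); split.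
  + by move=> a b A B; apply/matrixP => i j; rewrite !mxE.
  + by move=> G A rA; apply: gmx_tr; exact: gmx_mxsub.
  + move=> D; exists (\matrix_(i, j) if insub (val i) is Some i' then D j i' else 0).
    apply/matrixP => i j; rewrite !mxE/= insubT//= => li.
    by congr (D i _); exact: val_inj.
  move=> A; rewrite /row_free mxrank_tr => /eqP rA; apply/eqP.
  rewrite eqn_leq (minn_idPr (ltnW cp)) rank_leq_col/= -{1}rA.
  rewrite [mxsub _ _ _](_ : _ = (rowsub (widen_ord cp1) 1%:M) *m A).
    exact: mxrankM_maxr.
  by rewrite mul_rowsub_mx mul1mx.
Qed.

(** * Intersections of subspaces in a chart *)

Section Differences.
Variables (F : fieldType) (m k h : nat).
Local Notation E := ('I_h.+1 -> 'M[F]_(m, k)).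

(** The blocks Y_a - Y_0 side by side, for a > 0. *)
Definition blockdiff (Y : E) : 'M[F]_(m, h * k) :=
  \matrix_(i, c) mxvec (\matrix_(a, j) (Y (lift ord0 a) i j - Y ord0 i j)) 0 c.

Lemma blockdiffE Y i a j :
  blockdiff Y i (mxvec_index a j) = Y (lift ord0 a) i j - Y ord0 i j.
Proof. by rewrite mxE mxvecE mxE. Qed.

Lemma blockdiff_cline (x y : E) t :
  blockdiff (cline x y t) = t *: blockdiff y + (1 - t) *: blockdiff x.
Proof.
apply/matrixP => i c; case/mxvec_indexP: c => a j.
by rewrite !mxE !mxvecE !mxE; ring.
Qed.

Lemma blockdiff_surj D : exists Y : E, blockdiff Y = D.
Proof.
exists (fun a => if unlift ord0 a is Some b
  then \matrix_(i, j) D i (mxvec_index b j) else 0).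
apply/matrixP => i c; case/mxvec_indexP: c => a j.
by rewrite blockdiffE liftK unlift_none !mxE subr0.
Qed.

Lemma blockdiff_reg (G : germ F) (Y : G -> E) :
  (forall a, gmx (fun t => Y t a)) -> gmx (fun t => blockdiff (Y t)).
Proof.
move=> rY i c; case/mxvec_indexP: c => a j.
apply: (@greg_eq _ _ (fun t => Y t (lift ord0 a) i j - Y t ord0 i j)).
  by move=> t; rewrite blockdiffE.
by apply: greg_sub; exact: rY.
Qed.

Lemma mul_blockdiff_eq0 (Y : E) p (u : 'M[F]_(p, m)) :
  u *m blockdiff Y = 0 <-> forall a, u *m Y a = u *m Y ord0.
Proof.
split=> [uY a|uY].
  have [<-//|/unlift_some[b -> _]] := eqVneq ord0 a.
  apply/matrixP => i j; apply/eqP; rewrite -subr_eq0; apply/eqP.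
  have /matrixP/(_ i (mxvec_index b j)) := uY; rewrite !mxE => E0.
  rewrite -[RHS]E0 -sumrB; apply: eq_bigr => l _.
  by rewrite blockdiffE mulrBr.
apply/matrixP => i c; case/mxvec_indexP: c => a j; rewrite !mxE.
have /matrixP/(_ i j) := uY (lift ord0 a); rewrite !mxE => /eqP.
rewrite -subr_eq0 -sumrB => /eqP E0; rewrite -[RHS]E0; apply: eq_bigr => l _.
by rewrite blockdiffE mulrBr.
Qed.

End Differences.

Section Intersection.
Variables (R : realType) (V : vectType R[i]) (m k h : nat).
Local Notation C := R[i].
Local Notation n := (m + k)%N.
Variables (e : n.-tuple V) (eB : basis_of {:V} e).
Local Notation E := ('I_h.+1 -> 'M[C]_(m, k)).

Lemma val_cochart g (Y : 'M[C]_(m, k)) : g \in unitmx ->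
  val (cochart eB g Y) = rowspace e (row_mx 1%:M Y *m invmx g).
Proof. by move=> ug; rewrite val_Gr_of_mx//; exact/eqP/cochart_free. Qed.

Lemma cochart_inj g : g \in unitmx -> injective (cochart eB g).
Proof. by move=> ug; exact: (can_inj (fun Y => cochartK eB Y ug)). Qed.

Lemma memv_bigcap (J : finType) (U : J -> {vspace V}) v :
  reflect (forall j, v \in U j) (v \in (\bigcap_j U j)%VS).
Proof.
rewrite memvE; apply: (iffP subv_bigcapP) => H j; have := H j; rewrite -memvE//.
exact.
Qed.

(** A vector of all the row spaces is u (1 | Y_a) with the same u for all a,
    so that u Y_a does not depend on a. *)
Lemma bigcap_cocharts g (Y : E) : g \in unitmx ->
  (\bigcap_(a < h.+1) val (cocharts eB g Y a))%VS =
  rowspace e (kermx (blockdiff Y) *m row_mx 1%:M (Y ord0) *m invmx g).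
Proof.
move=> ug; apply/vspaceP => v; apply/memv_bigcap/idP => [vY|].
  have /submxP[u uE] : (vcoord e v <= row_mx 1%:M (Y ord0) *m invmx g)%MS.
    by rewrite -(mem_rowspace eB) -val_cochart//; exact: vY.
  have uY : u *m blockdiff Y = 0.
    apply/mul_blockdiff_eq0 => a.
    have := vY a; rewrite val_cochart// (mem_rowspace eB) uE => /submxP[w].
    rewrite !mulmxA => /(can_inj (mulmxKV ug)).
    by rewrite !mul_mx_row !mulmx1 => /eq_row_mx[-> ->].
  rewrite (mem_rowspace eB) uE -mulmxA submxMr//; exact/sub_kermxP.
rewrite (mem_rowspace eB) -mulmxA => /submxP[w wE] a.
rewrite val_cochart// (mem_rowspace eB) wE.
have := proj1 (mul_blockdiff_eq0 Y _) (mulmx_ker (blockdiff Y)) a.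
move: (kermx _) => K KY; apply/submxP; exists (w *m K).
by rewrite !mulmxA !mul_mx_row !mulmx1 -!mulmxA KY.
Qed.

Lemma dim_bigcap_cocharts g (Y : E) : g \in unitmx ->
  \dim (\bigcap_(a < h.+1) val (cocharts eB g Y a))%VS = (m - \rank (blockdiff Y))%N.
Proof.
move=> ug; rewrite bigcap_cocharts// (dim_rowspace eB) -mulmxA.
by rewrite mxrankMfree ?mxrank_ker//; exact: cochart_free.
Qed.

Definition generic_pos (Y : E) : Prop :=
  (forall a b, a != b -> Y a != Y b) /\ \rank (blockdiff Y) = minn m (h * k).

Definition generic_set (i : nat) : set {ptws 'I_h.+1 -> Gr V m} :=
  [set H : {ptws 'I_h.+1 -> Gr V m} | configurations H /\ \dim (\bigcap_(a < h.+1) val (H a)) = i].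

Lemma generic_setP g (Y : E) : g \in unitmx ->
  generic_set (maxn 0 (n - h.+1 * k)) (cocharts eB g Y) <-> generic_pos Y.
Proof.
move=> ug; rewrite /generic_set /generic_pos /= dim_bigcap_cocharts//.
have -> : maxn 0 (n - h.+1 * k) = (m - h * k)%N by lia.
have rm : (\rank (blockdiff Y) <= m)%N := rank_leq_row _.
have rhk : (\rank (blockdiff Y) <= h * k)%N := rank_leq_col _.
split=> -[dY rY]; split; [|lia| |lia] => a b ab; apply: contra (dY a b ab).
  by rewrite /cocharts => /eqP ->.
by move=> /eqP/(cochart_inj ug) ->.
Qed.

Lemma rank_minP p q (A : 'M[C]_(p, q)) :
  \rank A = minn p q <-> (if (p <= q)%N then row_free A else row_full A).
Proof.
by case: leqP => pq; rewrite /row_free /row_full; split=> [->|/eqP].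
Qed.

Lemma gev_rank_min (G : germ C) p q (A : G -> 'M[C]_(p, q)) : gmx A ->
  \rank (A (gpt G)) = minn p q -> gev (fun t => \rank (A t) = minn p q).
Proof.
move=> rA /rank_minP A0; apply: (@gevS _ _ (fun t =>
  if (p <= q)%N then row_free (A t) else row_full (A t))).
  by move=> t /rank_minP.
by case: ifP A0 => _ A0; [exact: gev_row_free|exact: gev_row_full].
Qed.

Lemma gev_neq (G : germ C) p q (A B : G -> 'M[C]_(p, q)) : gmx A -> gmx B ->
  A (gpt G) != B (gpt G) -> gev (fun t => A t != B t).
Proof.
move=> rA rB /eqP AB.
have [i [j ABij]] : exists i j, A (gpt G) i j - B (gpt G) i j != 0.
  apply: contrapT => NAB; apply: AB; apply/matrixP => i j; apply/eqP.
  rewrite -subr_eq0; apply/negPn/negP => ABij; apply: NAB; by exists i, j.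
apply: gevS (gev_neq0 (greg_sub (rA i j) (rB i j)) ABij) => t.
by apply: contraNneq => ->; rewrite subrr.
Qed.

Lemma gopen_distinct : gopen (fun Y : E => forall a b, a != b -> Y a != Y b).
Proof.
move=> G Y rY dY; apply: gev_forall => a; apply: gev_forall => b.
have [->|ab] := eqVneq a b; first exact: gev_all.
by apply: gevS (gev_neq (rY a) (rY b) (dY a b ab)) => t ? _.
Qed.

Lemma generic_pos_gopen : gopen generic_pos.
Proof.
apply: gopenI; first exact: gopen_distinct.
by move=> G Y rY rkY; exact: (gev_rank_min (blockdiff_reg rY) rkY).
Qed.

Lemma generic_set_zopen : zopen eB (generic_set (maxn 0 (n - h.+1 * k))).
Proof.
move=> g ug G Y rY /(generic_setP _ ug) PY.
by apply: gevS (generic_pos_gopen rY PY) => t /(generic_setP _ ug).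
Qed.

Lemma distinct_ex (a b : 'I_h.+1) : (0 < m)%N -> (0 < k)%N -> a != b ->
  exists Y : E, Y a != Y b.
Proof.
move=> m0 k0 ab.
exists (fun c => if c == a then const_mx 1 else 0).
rewrite eqxx [b == a]eq_sym (negbTE ab); apply/eqP => /matrixP.
move=> /(_ (Ordinal m0) (Ordinal k0)); rewrite !mxE => /eqP.
by rewrite oner_eq0.
Qed.

Lemma generic_pos_neq0 : (0 < m)%N -> (0 < k)%N -> exists Y, generic_pos Y.
Proof.
move=> m0 k0.
have [Y [dY rY]] : exists Y : E,
    (forall a b, a != b -> Y a != Y b) /\ \rank (blockdiff Y) = minn m (h * k).
  have [Y0 dY0] : exists Y : E, forall ab : 'I_h.+1 * 'I_h.+1,
      ab.1 != ab.2 -> Y ab.1 != Y ab.2.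
    apply: gopen_meet_all => -[a b] /=; last first.
      have [->|ab] := eqVneq a b; first by exists (fun=> 0).
      by have [Y Yab] := distinct_ex m0 k0 ab; exists Y.
    move=> G Y rY dY.
    have [->|ab] := eqVneq a b; first exact: gev_all.
    by apply: gevS (gev_neq (rY a) (rY b) (dY ab)) => t ? _.
  have [Y1 rY1] := blockdiff_surj (pid_mx (minn m (h * k)) : 'M[C]_(m, h * k)).
  have := gopen_meet (x := Y0) (y := Y1) gopen_distinct
    (_ : gopen (fun Y : E => \rank (blockdiff Y) = minn m (h * k))).
  apply.
  - by move=> G Y rY rkY; exact: (gev_rank_min (blockdiff_reg rY) rkY).
  - by move=> a b ab; exact: (dY0 (a, b)).
  - by rewrite rY1 rank_pid_mx ?geq_minl ?geq_minr.
by exists Y.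
Qed.

Lemma generic_set_neq0 : (0 < m)%N -> (0 < k)%N ->
  exists z, generic_set (maxn 0 (n - h.+1 * k)) z.
Proof.
move=> m0 k0; have [Y PY] := generic_pos_neq0 m0 k0.
by exists (cocharts eB 1%:M Y); apply/generic_setP => //; exact: unitmx1.
Qed.

Lemma generic_set_charts g z : g \in unitmx ->
  generic_set (maxn 0 (n - h.+1 * k)) z -> in_charts eB g z ->
  generic_pos (charts eB g z).
Proof. by move=> ug Sz cz; apply/(generic_setP _ ug); rewrite chartsK. Qed.

End Intersection.

(** * The case where n is not h k *)

(** The deformation may be given in the ambient space, provided that it
    stays in S. *)
Lemma contract_homotopic_in (R : realType) (Z : topologicalType) (S : set Z)
    (U : set (set_type S)) (f : Z -> R -> Z) (c : Z) :
  (forall z : set_type S, U z -> f (val z) 0 = val z) ->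
  (forall z : set_type S, U z -> f (val z) 1 = c) ->
  (forall (z : set_type S) s, U z -> 0 <= s <= 1 -> S (f (val z) s)) ->
  (forall p : unit_interval R -> set_type S, continuous p -> (forall t, U (p t)) ->
    continuous (fun w : R * R => f (val (extend p w.1)) (clampR w.2))) ->
  forall (x y : set_type S)
    (p q : {path (unit_interval R) from x to y in set_type S}),
  inside U p -> inside U q -> homotopic p q.
Proof.
move=> f0 f1 Sf cf x y p q pU qU.
have Ux := inside_zero pU.
have Sc : S c by rewrite -(f1 _ Ux); apply: Sf => //; rewrite ler01 lexx.
pose c' : set_type S := exist (fun z => z \in S) c (mem_set Sc).
pose F (z : set_type S) s : set_type S := insubd z (f (val z) s).
have FE (z : set_type S) s : U z -> 0 <= s <= 1 -> val (F z s) = f (val z) s.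
  by move=> Uz s01; rewrite val_insubd (mem_set (Sf _ _ Uz s01)).
apply: (@contract_homotopic R (set_type S) U F c' _ _ _ x y p q pU qU).
- by move=> z Uz; apply: val_inj; rewrite FE ?f0// lexx ler01.
- by move=> z Uz; apply: val_inj; rewrite FE ?f1// lexx ler01.
- move=> r cr Ur w; apply: lift_cvg.
  have E (w' : R * R) : val (F (extend r w'.1) (clampR w'.2)) =
      f (val (extend r w'.1)) (clampR w'.2).
    rewrite FE//; first exact: Ur.
    by have := clampR_itv w'.2; rewrite inE/= in_itv.
  have -> : (fun t : R * R => val (F (extend r t.1) (clampR t.2))) =
      (fun t : R * R => f (val (extend r t.1)) (clampR t.2)).
    by apply/funext => w'; exact: E.
  by rewrite E; exact: cf.
Qed.

Section PencilPosition.
Variables (F : fieldType) (m k h : nat) (p c r : nat).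
Local Notation E := ('I_h.+1 -> 'M[F]_(m, k)).
Variable N : E -> 'M[F]_(p, c).
Hypothesis N_reg : forall (G : germ F) (Y : G -> E),
  (forall a, gmx (fun t => Y t a)) -> gmx (fun t => N (Y t)).
Hypothesis N_cline : forall x y t, N (cline x y t) = t *: N y + (1 - t) *: N x.
Hypothesis N_surj : forall D, exists Y, N Y = D.
Variable L : 'M[F]_(p, c) -> 'M[F]_(r, r + 1).
Hypothesis L_linear : forall a b A B, L (a *: A + b *: B) = a *: L A + b *: L B.
Hypothesis L_reg : forall (G : germ F) (A : G -> 'M[F]_(p, c)),
  gmx A -> gmx (fun t => L (A t)).
Hypothesis L_surj : forall D, exists A, L A = D.

(** Conditions on the ends P and Y of a segment which ensure that N has
    maximal rank along the complex line through them: N is affine along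
    lines, so it describes a pencil. *)
Definition pencil_ctr (P : E) : Prop := lsubmx (L (N P)) \in unitmx.
Definition pencil_gen (P Y : E) : Prop := kalman (L (N P)) (L (N Y)) \in unitmx.

Lemma pencil_ctr_gopen : gopen pencil_ctr.
Proof.
move=> G Y rY; apply: (@gev_unit _ _ _ (fun t => lsubmx (L (N (Y t))))).
exact/gmx_lsub/L_reg/N_reg.
Qed.

Lemma pencil_ctr_neq0 : exists P, pencil_ctr P.
Proof.
have [A AE] := L_surj (row_mx 1%:M 0); have [P PE] := N_surj A.
by exists P; rewrite /pencil_ctr PE AE row_mxKl unitmx1.
Qed.

Lemma pencil_gen_gopen P : gopen (pencil_gen P).
Proof.
move=> G Y rY; apply: (@gev_unit _ _ _ (fun t => kalman (L (N P)) (L (N (Y t))))).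
exact/kalman_reg/L_reg/N_reg.
Qed.

Lemma pencil_gen_neq0 P : pencil_ctr P -> exists Y, pencil_gen P Y.
Proof.
move=> cP; have [D uD] := kalman_ex cP.
have [A AE] := L_surj D; have [Y YE] := N_surj A.
by exists Y; rewrite /pencil_gen YE AE.
Qed.

Lemma pencil_line P Y t : pencil_ctr P -> pencil_gen P Y ->
  row_free (L (N (cline Y P t))).
Proof.
move=> cP gP; rewrite N_cline L_linear; apply: kalman_pencil => //.
by have [->|//] := eqVneq t 0; rewrite subr0 oner_neq0.
Qed.

End PencilPosition.

Section DistinctPosition.
Variables (F : fieldType) (m k h : nat).
Local Notation E := ('I_h -> 'M[F]_(m, k)).
Variables (i1 i2 : 'I_m) (j1 j2 : 'I_k).

Definition dist_ctr (P : E) : Prop :=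
  forall a b, a != b -> P a i1 j1 - P b i1 j1 != 0.
(** The vectors of the entries (i1, j1) and (i2, j2) of P_a - P_b and of Y_a
    - Y_b are linearly independent, so that no combination of them vanishes. *)
Definition dist_gen (P Y : E) : Prop := forall a b, a != b ->
  (P a i1 j1 - P b i1 j1) * (Y a i2 j2 - Y b i2 j2) -
  (P a i2 j2 - P b i2 j2) * (Y a i1 j1 - Y b i1 j1) != 0.

Lemma dist_line P Y t : dist_gen P Y ->
  forall a b, a != b -> cline Y P t a != cline Y P t b.
Proof.
move=> gP a b ab; apply: contraNneq (gP a b ab) => /matrixP E.
have E1 := E i1 j1; have E2 := E i2 j2; move: E1 E2; rewrite /cline !mxE.
set pa := P a i1 j1; set pb := P b i1 j1; set ya := Y a i1 j1; set yb := Y b i1 j1.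
set qa := P a i2 j2; set qb := P b i2 j2; set za := Y a i2 j2; set zb := Y b i2 j2.
move=> /eqP; rewrite -subr_eq0 => /eqP E1 /eqP; rewrite -subr_eq0 => /eqP E2.
set d := (X in X == 0).
have td : t * d = 0.
  rewrite (_ : t * d = (ya + t * (pa - ya) - (yb + t * (pb - yb))) * (za - zb) -
    (za + t * (qa - za) - (zb + t * (qb - zb))) * (ya - yb)); last by rewrite /d; ring.
  by rewrite E1 E2 !mul0r subrr.
have td1 : (1 - t) * d = 0.
  rewrite (_ : (1 - t) * d = (za + t * (qa - za) - (zb + t * (qb - zb))) * (pa - pb) -
    (ya + t * (pa - ya) - (yb + t * (pb - yb))) * (qa - qb)); last by rewrite /d; ring.
  by rewrite E1 E2 !mul0r subrr.
by rewrite -[d]mul1r -[1](subrK t) mulrDl td td1 addr0.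
Qed.

End DistinctPosition.

Section DistinctPosition0.
Variables (F : numFieldType) (m k h : nat).
Local Notation E := ('I_h -> 'M[F]_(m, k)).
Variables (i1 i2 : 'I_m) (j1 j2 : 'I_k).
Hypothesis ij12 : (i1, j1) != (i2, j2).

Lemma dist_pair_gopen (f : E -> 'I_h -> 'I_h -> F) :
  (forall (G : germ F) (Y : G -> E) a b, (forall a, gmx (fun t => Y t a)) ->
     greg (fun t => f (Y t) a b)) ->
  gopen (fun Y => forall a b, a != b -> f Y a b != 0).
Proof.
move=> rf G Y rY fY; apply: gev_forall => a; apply: gev_forall => b.
have [->|ab] := eqVneq a b; first exact: gev_all.
by apply: gevS (gev_neq0 (rf _ _ a b rY) (fY a b ab)) => t ? _.
Qed.

Lemma dist_ctr_gopen : gopen (@dist_ctr F m k h i1 j1).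
Proof.
apply: dist_pair_gopen => G Y a b rY.
by apply: greg_sub; exact: rY.
Qed.

Lemma dist_gen_gopen (P : E) : gopen (dist_gen i1 i2 j1 j2 P).
Proof.
apply: dist_pair_gopen => G Y a b rY.
apply: greg_sub; apply: greg_mul; try exact: greg_cst.
  by apply: greg_sub; exact: rY.
by apply: greg_sub; exact: rY.
Qed.

Lemma dist_pair_ex (f : E -> 'I_h -> 'I_h -> F) :
  (forall (G : germ F) (Y : G -> E) a b, (forall a, gmx (fun t => Y t a)) ->
     greg (fun t => f (Y t) a b)) ->
  (forall a b, a != b -> exists Y, f Y a b != 0) ->
  exists Y, forall a b, a != b -> f Y a b != 0.
Proof.
move=> rf ef.
have [Y fY] : exists Y, forall ab : 'I_h * 'I_h, ab.1 != ab.2 -> f Y ab.1 ab.2 != 0.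
  apply: gopen_meet_all => -[a b] /=.
    move=> G Y rY fY; have [->|ab] := eqVneq a b; first exact: gev_all.
    by apply: gevS (gev_neq0 (rf _ _ a b rY) (fY ab)) => t ? _.
  have [->|/ef[Y Yab]] := eqVneq a b; first by exists (fun=> 0).
  by exists Y.
by exists Y => a b; exact: (fY (a, b)).
Qed.

Lemma dist_ctr_neq0 : exists P : E, dist_ctr i1 j1 P.
Proof.
apply: dist_pair_ex => [G Y a b rY|a b ab]; first by apply: greg_sub; exact: rY.
exists (fun c => if c == a then const_mx 1 else 0).
by rewrite eqxx [b == a]eq_sym (negbTE ab) !mxE subr0 oner_neq0.
Qed.

Lemma dist_gen_neq0 (P : E) : dist_ctr i1 j1 P -> exists Y, dist_gen i1 i2 j1 j2 P Y.
Proof.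
move=> cP; apply: dist_pair_ex => [G Y a b rY|a b ab].
  apply: greg_sub; apply: greg_mul; try exact: greg_cst.
    by apply: greg_sub; exact: rY.
  by apply: greg_sub; exact: rY.
exists (fun c => if c == a then delta_mx i2 j2 else 0).
rewrite eqxx [b == a]eq_sym (negbTE ab) !mxE !eqxx.
have -> : (i1 == i2) && (j1 == j2) = false by apply/negbTE.
by rewrite !subr0 mulr0 subr0 mulr1; exact: cP.
Qed.

End DistinctPosition0.

Lemma two_entries m k : (2 <= m * k)%N ->
  exists (i1 i2 : 'I_m) (j1 j2 : 'I_k), (i1, j1) != (i2, j2).
Proof.
have -> : (m * k)%N = #|{: 'I_m * 'I_k}| by rewrite card_prod !card_ord.
move=> /card_gt1P.
by move=> [[i1 j1] [[i2 j2] [_ _ ij]]]; exists i1, i2, j1, j2.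
Qed.

Section GenericCase.
Variables (R : realType) (V : vectType R[i]) (m k h : nat).
Local Notation C := R[i].
Local Notation n := (m + k)%N.
Variables (e : n.-tuple V) (eB : basis_of {:V} e).
Local Notation E := ('I_h.+1 -> 'M[C]_(m, k)).
Local Notation S := (@generic_set R V m h (maxn 0 (n - h.+1 * k))).

Lemma cocharts_path_cont (T : topologicalType) (w : T) g (Y : T -> E) (P : E)
    (s : T -> R) : g \in unitmx ->
  (forall a, gmx (G := cont_germ R w) (fun t => Y t a)) -> s @ w --> s w ->
  (fun t => cocharts eB g (cline (Y t) P ((s t)%:C)%C)) @ w -->
  cocharts eB g (cline (Y w) P ((s w)%:C)%C).
Proof.
move=> ug cY cs.
apply: (@cocharts_cvg R V m k h.+1 e eB T w g
  (fun t => cline (Y t) P ((s t)%:C)%C) ug) => a.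
apply: (@gmx_cline_var _ _ _ _ (cont_germ R w) (fun t => (s t)%:C%C) Y (fun=> P)).
- exact: cont_real.
- exact: cY.
- exact: gmx_cst.
Qed.

(** Stars contract to their centres along segments. *)
Theorem generic_simply_connected : (0 < m)%N -> (0 < k)%N ->
  m <> (h * k)%N -> (2 <= m * k)%N -> simply_connected R (set_type S).
Proof.
move=> m0 k0 mhk mk2.
have [i1 [i2 [j1 [j2 ij]]]] := two_entries mk2.
have [r [L [Llin Lreg Lsurj Lrank]]] := pencil_selector C mhk.
refine (@simply_connected_star R V m k h.+1 e eB S
  (@generic_set_zopen R V m k h e eB) (generic_set_neq0 h eB m0 k0) (@generic_pos R m k h)
  (@generic_pos_gopen R m k h) _
  (fun P => dist_ctr i1 j1 P /\ pencil_ctr (@blockdiff C m k h) L P) _ _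
  (fun P Y => dist_gen i1 i2 j1 j2 P Y /\ pencil_gen (@blockdiff C m k h) L P Y) _ _ _ _).
- by move=> g z ug Sz cz; exact: generic_set_charts.
- apply: gopenI; first exact: dist_ctr_gopen.
  by apply: pencil_ctr_gopen => //; exact: blockdiff_reg.
- have [P1 cP1] := @dist_ctr_neq0 C m k h.+1 i1 j1.
  have [P2 cP2] := pencil_ctr_neq0 (@blockdiff_surj C m k h) Lsurj.
  apply: (gopen_meet _ _ cP1 cP2); first exact: dist_ctr_gopen.
  by apply: pencil_ctr_gopen => //; exact: blockdiff_reg.
- move=> P _; apply: gopenI; first exact: dist_gen_gopen.
  by apply: pencil_gen_gopen => //; exact: blockdiff_reg.
- move=> P [cP1 cP2].
  have [Y1 gY1] := dist_gen_neq0 ij cP1.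
  have [Y2 gY2] := pencil_gen_neq0 (@blockdiff_surj C m k h) Lsurj cP2.
  apply: (gopen_meet _ _ gY1 gY2); first exact: dist_gen_gopen.
  by apply: pencil_gen_gopen => //; exact: blockdiff_reg.
- move=> P Y s [cP1 cP2] [gY1 gY2] _; split; first exact: dist_line gY1.
  by apply: Lrank; exact: (pencil_line (@blockdiff_cline C m k h) Llin).
move=> g P ug _ x y p q; apply: (@contract_homotopic_in R _ S _
  (fun z s => cocharts eB g (cline (charts eB g z) P (s%:C)%C)) (cocharts eB g P)).
- by move=> z [cz _]; rewrite cline0 chartsK.
- by move=> z _; rewrite cline1.
- by move=> z s [cz sz] s01; apply/generic_setP => //; exact: sz.
move=> f cf Uf w.
apply: (@cocharts_path_cont _ w g (fun w => charts eB g (val (extend f w.1))) P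
  (fun w => clampR w.2) ug).
- move=> a; apply: (@charts_cvg R V m k h.+1 e eB _ w (fun w => val (extend f w.1))).
    have ce : continuous (fun w : R * R => val (extend f w.1)).
      move=> v; apply: (@cvg_comp _ _ _ (fun w : R * R => extend f w.1) val).
        exact: (comp_continuous (@fst_cont _ _) (extend_continuous cf)).
      exact: setval_cvg.
    exact: ce.
  by have [+ _] := Uf (clamp w.1); apply.
- have cc : continuous (fun w : R * R => clampR w.2).
    exact: (comp_continuous (@snd_cont _ _) (@clampR_continuous R)).
  exact: cc.
Qed.

End GenericCase.

(** * Projectors onto the intersection of all subspaces but the last *)

Section Gram.
Variable R : realType.
Local Notation C := R[i].

Definition adjmx p q (A : 'M[C]_(p, q)) : 'M[C]_(q, p) := (map_mx (@conjc R) A)^T.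

Lemma adjmxM p q r (A : 'M[C]_(p, q)) (B : 'M[C]_(q, r)) :
  adjmx (A *m B) = adjmx B *m adjmx A.
Proof. by rewrite /adjmx map_mxM trmx_mul. Qed.

Lemma adjmxK p q (A : 'M[C]_(p, q)) : adjmx (adjmx A) = A.
Proof. by apply/matrixP => i j; rewrite !mxE conjcK. Qed.

Lemma gram_col_eq0 p (v : 'cV[C]_p) : adjmx v *m v = 0 -> v = 0.
Proof.
move=> /matrixP/(_ 0 0); rewrite !mxE => /eqP.
rewrite psumr_eq0 => [/allP v0|i _]; last first.
  by rewrite !mxE mulrC -sqr_normc exprn_ge0.
apply/colP => i; rewrite mxE.
have := v0 i (mem_index_enum i); rewrite !mxE mulrC -sqr_normc.
by rewrite sqrf_eq0 normr_eq0 => /eqP.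
Qed.

Lemma gram_unit p q (A : 'M[C]_(p, q)) : row_full A -> adjmx A *m A \in unitmx.
Proof.
move=> /row_fullP[B BA]; rewrite -row_free_unit; apply: row_free_ker => u uA.
have : A *m adjmx u = 0.
  apply: gram_col_eq0; rewrite adjmxM adjmxK mulmxA -(mulmxA u) uA.
  by rewrite mul0mx.
move=> /(congr1 (mulmx B)); rewrite mulmxA BA mul1mx mulmx0 => u0.
by rewrite -[u]adjmxK u0; apply/matrixP => i j; rewrite !mxE conjc0.
Qed.

(** Unlike an arbitrary left inverse, it depends continuously on the matrix. *)
Definition linv p q (A : 'M[C]_(p, q)) : 'M[C]_(q, p) :=
  invmx (adjmx A *m A) *m adjmx A.

Lemma linvK p q (A : 'M[C]_(p, q)) : row_full A -> linv A *m A = 1%:M.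
Proof. by move=> fA; rewrite /linv -mulmxA mulVmx// gram_unit. Qed.

Lemma linv_cont (T : topologicalType) (x : T) p q (A : T -> 'M[C]_(p, q)) :
  gmx (G := cont_germ R x) A -> row_full (A x) ->
  gmx (G := cont_germ R x) (fun t => linv (A t)).
Proof.
move=> cA fA.
have cadj : gmx (G := cont_germ R x) (fun t => adjmx (A t)).
  move=> i j; have := cont_conj (cA j i).
  by apply: (@greg_eq _ (cont_germ R x)) => t; rewrite !mxE.
apply: gmx_mul => //; apply: gmx_inv; first exact: gmx_mul.
exact: gram_unit.
Qed.

End Gram.

Lemma mxvec_index_eq p q (a a' : 'I_p) (j j' : 'I_q) :
  (mxvec_index a j == mxvec_index a' j') = (a == a') && (j == j').
Proof. by rewrite /mxvec_index (inj_eq (@cast_ord_inj _ _ _)) (inj_eq enum_rank_inj). Qed.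

Section BigcapDimension.
Variables (K : fieldType) (V : vectType K).

(** Each intersection lowers the dimension by at most d. *)
Lemma dim_bigcap_ge (J : Type) (U : J -> {vspace V}) (d : nat) (s : seq J) :
  (forall j, d + \dim (U j) >= \dim {:V})%N ->
  (\dim {:V} <= size s * d + \dim (\bigcap_(j <- s) U j)%VS)%N.
Proof.
move=> dU; elim: s => [|j s IHs]; first by rewrite big_nil.
rewrite big_cons /=; have := dimv_sum_cap (U j) (\bigcap_(j <- s) U j)%VS.
have := dimvS (subvf (U j + \bigcap_(j <- s) U j)%VS).
have := dU j; rewrite mulSn; move: IHs; lia.
Qed.

End BigcapDimension.

Section Complement.
Variables (R : realType) (m k l : nat).
Local Notation C := R[i].
Local Notation n := (m + k)%N.
Local Notation E := ('I_l.+2 -> 'M[C]_(m, k)).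
Implicit Type Y : E.

(** The index ord_max of the last subspace is left out. *)
Definition front Y (a : 'I_l.+1) : 'M[C]_(m, k) := Y (widen_ord (leqnSn _) a).
Definition fdiff Y : 'M[C]_(m, l * k) := blockdiff (front Y).

Lemma front0 Y : front Y ord0 = Y ord0.
Proof. by congr Y; exact: val_inj. Qed.

Lemma fdiffE Y i a j :
  fdiff Y i (mxvec_index a j) =
  blockdiff Y i (mxvec_index (widen_ord (leqnSn _) a) j).
Proof.
rewrite /fdiff !blockdiffE front0; congr (Y _ i j - _).
exact: val_inj.
Qed.

Lemma fdiff_full Y : row_full (blockdiff Y) -> row_full (fdiff Y).
Proof.
move=> /row_fullP[J JY]; apply/row_fullP.
exists (\matrix_(c, i) mxvec (\matrix_(a, j)
  J (mxvec_index (widen_ord (leqnSn _) a) j) i) 0 c).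
apply/matrixP => c c'; case/mxvec_indexP: c => a j; case/mxvec_indexP: c' => a' j'.
have /matrixP/(_ (mxvec_index (widen_ord (leqnSn _) a) j)
  (mxvec_index (widen_ord (leqnSn _) a') j')) := JY.
rewrite !mxE !mxvec_index_eq -[widen_ord _ a == _]/(a == a') => <-.
by apply: eq_bigr => i _; rewrite mxE mxvecE mxE fdiffE.
Qed.

(** The rows of A lie in the intersection K of the row spaces of the (1 |
    Y_a), where a is not the last index. *)
Definition inK Y p (A : 'M[C]_(p, n)) : Prop :=
  exists2 w : 'M[C]_(p, m), w *m fdiff Y = 0 & A = w *m row_mx 1%:M (Y ord0).

(** If fdiff Y has independent columns, a projector onto K that depends
    continuously on Y: it sends (u | v) to u Pi (1 | Y_0), where Pi is the
    orthogonal projector onto the left kernel of fdiff Y. *)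
Definition rho Y : 'M[C]_n :=
  let Pi := 1%:M - fdiff Y *m linv (fdiff Y) in
  col_mx (row_mx Pi (Pi *m Y ord0)) 0.

Lemma rho_inK Y p (A : 'M[C]_(p, n)) : row_full (fdiff Y) -> inK Y (A *m rho Y).
Proof.
move=> fY; pose Pi := 1%:M - fdiff Y *m linv (fdiff Y).
exists (lsubmx A *m Pi).
  by rewrite -mulmxA mulmxBl mul1mx -mulmxA linvK// mulmx1 subrr mulmx0.
rewrite -{1}(hsubmxK A) /rho mul_row_col mulmx0 addr0 -/Pi.
by rewrite -[RHS]mulmxA [Pi *m row_mx _ _]mul_mx_row mulmx1.
Qed.

Lemma inK_rho Y p (A : 'M[C]_(p, n)) : inK Y A -> A *m rho Y = A.
Proof.
move=> [w wY ->]; rewrite /rho -mulmxA mul_row_col mul1mx mulmx0 addr0.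
set Pi := 1%:M - _.
have wPi : w *m Pi = w.
  by rewrite /Pi mulmxBr mulmx1 (mulmxA w (fdiff Y)) wY mul0mx subr0.
by rewrite !mul_mx_row (mulmxA w Pi) wPi mulmx1.
Qed.

Lemma inK_mul Y p q (A : 'M[C]_(p, n)) (B : 'M[C]_(q, p)) : inK Y A -> inK Y (B *m A).
Proof.
by move=> [w wY ->]; exists (B *m w); rewrite -!mulmxA ?wY ?mulmx0.
Qed.

Lemma inKD Y p (A B : 'M[C]_(p, n)) : inK Y A -> inK Y B -> inK Y (A + B).
Proof.
move=> [w wY ->] [u uY ->]; exists (w + u); last by rewrite mulmxDl.
by rewrite mulmxDl wY uY addr0.
Qed.

Lemma inKZ Y p (A : 'M[C]_(p, n)) c : inK Y A -> inK Y (c *: A).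
Proof.
by move=> [w wY ->]; exists (c *: w); rewrite -scalemxAl ?wY ?scaler0.
Qed.

(** P is a projector onto K, acting on rows from the right: its image lies
    in K, and it is the identity on K. *)
Definition is_proj Y (P : 'M[C]_n) : Prop :=
  inK Y P /\ forall p (A : 'M[C]_(p, n)), inK Y A -> A *m P = A.

Lemma rho_proj Y : row_full (fdiff Y) -> is_proj Y (rho Y).
Proof.
move=> fY; split; last by move=> p A; exact: inK_rho.
by have := rho_inK 1%:M fY; rewrite mul1mx.
Qed.

(** The projectors onto K form an affine space; this is the line through rho
    Y at c = 0 which, if Q is itself a projector onto K, reaches Q at c = 1.
    For other Q it still consists of projectors onto K. *)
Definition mix Y (c : C) (Q : 'M[C]_n) : 'M[C]_n :=
  rho Y + c *: ((1%:M - rho Y) *m Q *m rho Y).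

Lemma mix_proj Y c Q : row_full (fdiff Y) -> is_proj Y (mix Y c Q).
Proof.
move=> fY; have [K1 K2] := rho_proj fY; split.
  by apply: inKD => //; apply: inKZ; exact: inK_mul.
move=> p A KA; rewrite /mix mulmxDr (K2 _ A KA) -scalemxAr.
rewrite (mulmxA A (_ *m Q)) (mulmxA A) mulmxBr mulmx1 (K2 _ A KA).
by rewrite subrr !mul0mx scaler0 addr0.
Qed.

Lemma mix1 Y Q : row_full (fdiff Y) -> is_proj Y Q -> mix Y 1 Q = Q.
Proof.
move=> fY [K1 K2]; have [KR _] := rho_proj fY.
rewrite /mix scale1r -mulmxA inK_rho// mulmxBl mul1mx (K2 _ _ KR).
by rewrite addrC subrK.
Qed.

(** K has dimension k, and 1 - P has for row space the kernel of P. *)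
Lemma rank_proj Y P : m = (l.+1 * k)%N -> row_full (fdiff Y) -> is_proj Y P ->
  \rank (1%:M - P) = m.
Proof.
move=> mlk fY [K1 K2].
have PP : P *m P = P by exact: K2.
have rP : \rank P = k.
  have -> : \rank P = \rank (kermx (fdiff Y)).
    have rK : \rank (kermx (fdiff Y) *m row_mx 1%:M (Y ord0)) =
              \rank (kermx (fdiff Y)).
      apply: mxrankMfree; apply: (@row_free_mulr _ _ _ _ _ (col_mx 1%:M 0)).
      by rewrite mul_row_col mulmx0 addr0 mulmx1 row_free_unit unitmx1.
    rewrite -rK; apply/eqmx_rank/andP; split.
      have [w wY ->] := K1; apply: submxMr; exact/sub_kermxP.
    rewrite -(K2 _ (kermx (fdiff Y) *m row_mx 1%:M (Y ord0))); first exact: submxMl.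
    by exists (kermx (fdiff Y)) => //; exact: mulmx_ker.
  rewrite mxrank_ker; have /eqP -> := fY; rewrite mlk mulSn; lia.
have -> : \rank (1%:M - P) = \rank (kermx P).
  apply/eqmx_rank/andP; split.
    by apply/sub_kermxP; rewrite mulmxBl mul1mx PP subrr.
  apply/submxP; exists (kermx P).
  by rewrite mulmxBr mulmx1 mulmx_ker subr0.
by rewrite mxrank_ker rP addnK.
Qed.

(** If blockdiff Y is invertible, the projector onto K along the row space
    of (1 | Y_max): the latter is the kernel of the column (Y_max; -1), and
    the rows J (1 | Y_0) form a basis of K on which this column is the
    identity. *)
Definition proj_last Y : 'M[C]_n :=
  let J : 'M[C]_(k, m) := \matrix_(j, i) linv (blockdiff Y) (mxvec_index ord_max j) i in
  col_mx (Y ord_max) (- 1%:M) *m (J *m row_mx 1%:M (Y ord0)).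

Lemma proj_last0 Y : row_mx 1%:M (Y ord_max) *m proj_last Y = 0.
Proof.
by rewrite mulmxA mul_row_col mul1mx mulmxN mulmx1 subrr mul0mx.
Qed.

(** J is the block of rows of a left inverse of blockdiff Y which
    corresponds to the last block of columns: it kills the other blocks. A
    row vector w with w (fdiff Y) = 0 is recovered as w (Y_max - Y_0) J,
    since both have the same product with blockdiff Y. *)
Lemma proj_lastP Y : row_full (blockdiff Y) -> row_free (blockdiff Y) ->
  is_proj Y (proj_last Y).
Proof.
move=> fY frY; rewrite /proj_last; set J : 'M[C]_(k, m) := \matrix_(j, i) _.
have JE j a j' :
    (J *m (Y (lift ord0 a) - Y ord0)) j j' = ((ord_max == a) && (j == j'))%:R.
  rewrite -mxvec_index_eq.
  have /matrixP/(_ (mxvec_index ord_max j) (mxvec_index a j')) := linvK fY.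
  rewrite !mxE => <-; apply: eq_bigr => i _; rewrite mxE blockdiffE; congr (_ * _).
  by rewrite !mxE.
have max_lift : lift ord0 ord_max = ord_max :> 'I_l.+2 by exact: val_inj.
have JT : J *m (Y ord_max - Y ord0) = 1%:M.
  by apply/matrixP => j j'; rewrite -max_lift JE eqxx mxE.
have JN : J *m fdiff Y = 0.
  apply/mul_blockdiff_eq0 => a; rewrite front0.
  have [<-|/unlift_some[b -> _]] := eqVneq ord0 a; first by rewrite front0.
  apply/eqP; rewrite -subr_eq0 -mulmxBr; apply/eqP/matrixP => j j'.
  rewrite /front (_ : widen_ord _ _ = lift ord0 (widen_ord (leqnSn _) b)).
    rewrite JE [RHS]mxE [_ && _](_ : _ = false)//.
    by apply/negbTE; rewrite negb_and -val_eqE /= gtn_eqF// ltn_ord.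
  exact: val_inj.
split.
  exists (col_mx (Y ord_max) (- 1%:M) *m J); last by rewrite mulmxA.
  by rewrite -mulmxA JN mulmx0.
move=> p A [w wY ->]; rewrite !mulmxA; congr (_ *m _).
rewrite -(mulmxA w) mul_row_col mul1mx mulmxN mulmx1.
apply/eqP; rewrite -subr_eq0; apply/eqP.
apply: (row_free_inj frY); rewrite mul0mx; apply/mul_blockdiff_eq0 => a.
apply/eqP; rewrite -subr_eq0 -mulmxBr mulmxBl -!mulmxA; apply/eqP.
have [<-|/unlift_some[b -> _]] := eqVneq ord0 a; first by rewrite (subrr (Y ord0)) !mulmx0 subrr.
have [->|bm] := eqVneq b ord_max.
  by rewrite max_lift JT mulmx1 subrr.
have [c cE] : exists c : 'I_l.+1, lift ord0 b = widen_ord (leqnSn _) c.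
  have lb : (b.+1 < l.+1)%N.
    by have := ltn_ord b; rewrite ltnS leq_eqVlt -[_ == _]/(b == ord_max) (negbTE bm).
  by exists (Ordinal lb); exact: val_inj.
have frontE : Y (lift ord0 b) = front Y c by rewrite cE.
rewrite frontE -front0 !mulmxBr.
rewrite (proj1 (mul_blockdiff_eq0 (front Y) _) JN).
rewrite (proj1 (mul_blockdiff_eq0 (front Y) _) wY).
by rewrite !subrr.
Qed.

Lemma fdiff_reg (G : germ C) (Y : G -> E) :
  (forall a, gmx (fun t => Y t a)) -> gmx (fun t => fdiff (Y t)).
Proof. by move=> rY; apply: blockdiff_reg => a; exact: rY. Qed.

Lemma fdiff_cline (x y : E) t :
  fdiff (cline x y t) = t *: fdiff y + (1 - t) *: fdiff x.
Proof. exact: blockdiff_cline. Qed.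

Lemma fdiff_surj D : exists Y, fdiff Y = D.
Proof.
have [Y YD] := blockdiff_surj D.
exists (fun a => if insub (val a) is Some b then Y b else 0).
rewrite -YD /fdiff; congr blockdiff; apply/funext => a.
by rewrite /front /= insubT//= => la; congr Y; exact: val_inj.
Qed.

Lemma rho_cont (T : topologicalType) (x : T) (Y : T -> E) :
  (forall a, gmx (G := cont_germ R x) (fun t => Y t a)) ->
  row_full (fdiff (Y x)) -> gmx (G := cont_germ R x) (fun t => rho (Y t)).
Proof.
move=> cY fY.
have cPi : gmx (G := cont_germ R x)
    (fun t => 1%:M - fdiff (Y t) *m linv (fdiff (Y t))).
  apply: gmx_sub; first exact: gmx_cst.
  apply: gmx_mul; first exact: fdiff_reg.
  apply: linv_cont => //; exact: (@fdiff_reg (cont_germ R x)).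
apply: gmx_col_mx; last exact: gmx_cst.
apply: gmx_row_mx; first exact: cPi.
by apply: gmx_mul; [exact: cPi|exact: cY].
Qed.

Lemma proj_last_cont (T : topologicalType) (x : T) (Y : T -> E) :
  (forall a, gmx (G := cont_germ R x) (fun t => Y t a)) ->
  row_full (blockdiff (Y x)) -> gmx (G := cont_germ R x) (fun t => proj_last (Y t)).
Proof.
move=> cY fY; apply: gmx_mul.
  by apply: gmx_col_mx; [exact: cY|exact: gmx_cst].
apply: gmx_mul; last by apply: gmx_row_mx; [exact: gmx_cst|exact: cY].
have cl : gmx (G := cont_germ R x) (fun t => linv (blockdiff (Y t))).
  by apply: linv_cont => //; exact: (@blockdiff_reg _ _ _ _ (cont_germ R x)).
move=> j i; have := cl (mxvec_index ord_max j) i.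
by apply: (@greg_eq _ (cont_germ R x)) => t; rewrite [RHS]mxE.
Qed.

End Complement.

(** * The case n = h k *)

Section CriticalCase.
Variables (R : realType) (V : vectType R[i]) (m k l : nat).
Local Notation C := R[i].
Local Notation n := (m + k)%N.
Variables (e : n.-tuple V) (eB : basis_of {:V} e).
Local Notation E := ('I_l.+2 -> 'M[C]_(m, k)).
Local Notation S := (@generic_set R V m l.+1 (maxn 0 (n - l.+2 * k))).
Hypothesis k_gt0 : (0 < k)%N.
Hypothesis mE : m = (l.+1 * k)%N.

Lemma dim_fullv : \dim {:V} = n.
Proof. by rewrite (size_basis eB). Qed.

(** Two equal subspaces would leave at most h - 1 of them, whose
    intersection has dimension at least n - (h - 1) k = k, where h = l + 2. *)
Lemma generic_set_dim0 (z : {ptws 'I_l.+2 -> Gr V m}) :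
  (\bigcap_(a < l.+2) val (z a))%VS = 0%VS -> S z.
Proof.
move=> z0; split; last by rewrite /= z0 dimv0; lia.
move=> a b ab; apply/eqP => zab.
pose A := predC1 b.
have : (\bigcap_(c in A) val (z c) <= \bigcap_(c < l.+2) val (z c))%VS.
  apply/subv_bigcapP => c _; have [->|cb] := eqVneq c b.
    by rewrite -zab; exact: (bigcapv_inf a ab (subvv _)).
  exact: (bigcapv_inf c cb (subvv _)).
rewrite z0 subv0 => /eqP Kb.
have := @dim_bigcap_ge _ V 'I_l.+2 (fun c => val (z c)) k (enum A).
rewrite -cardE cardC1 card_ord big_enum Kb dimv0 addn0 dim_fullv => H.
have : (n <= l.+1 * k)%N by apply: H => c; rewrite addnC; have /eqP -> := valP (z c).
by lia.
Qed.

(** All subspaces but the last move along segments to those of P. The last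
    one is at each time the kernel of a projector onto their intersection K,
    that is, the row space of its difference with 1; at time 1 the projector
    is rho P, which only depends on P. *)
Definition slide (g : 'M[C]_n) (P : E) (z : {ptws 'I_l.+2 -> Gr V m}) (s : R) :
    {ptws 'I_l.+2 -> Gr V m} :=
  fun a => if a == ord_max
    then Gr_of_mx eB ((1%:M - mix (cline (charts eB g z) P (s%:C)%C) (1 - s%:C)%C
                   (proj_last (charts eB g z))) *m invmx g)
    else cochart eB g (cline (charts eB g z) P (s%:C)%C a).

Lemma rank_fdiff_full (Y : E) :
  \rank (fdiff Y) = minn m (l * k) <-> row_full (fdiff Y).
Proof.
have -> : minn m (l * k) = (l * k)%N by apply/minn_idPr; lia.
by rewrite /row_full; split=> [->//|/eqP].
Qed.

Lemma slide_rank g (Y : E) Q c : g \in unitmx -> row_full (fdiff Y) ->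
  \rank ((1%:M - mix Y c Q) *m invmx g) = m.
Proof.
move=> ug fY; rewrite mxrankMfree ?row_free_unit ?unitmx_inv//.
by rewrite (rank_proj mE fY)//; exact: mix_proj.
Qed.

(** A vector of the first subspaces is fixed by a projector onto K, and a
    vector of the last one is killed by it. *)
Lemma slide_in g P z s : g \in unitmx ->
  row_full (fdiff (cline (charts eB g z) P (s%:C)%C)) -> S (slide g P z s).
Proof.
move=> ug; rewrite /slide.
move: (cline (charts eB g z) P (s%:C)%C) (proj_last (charts eB g z)) => Y Q fY.
have [K1 K2] := mix_proj (1 - s%:C)%C Q fY.
apply: generic_set_dim0; apply/eqP; rewrite -subv0; apply/subvP => v.
move=> /memv_bigcap vU; rewrite memv0.
pose A := vcoord e v *m g.
have vA (a : 'I_l.+2) : a != ord_max -> exists u, A = u *m row_mx 1%:M (Y a).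
  move=> am; have := vU a; rewrite (negbTE am) val_cochart// (mem_rowspace eB).
  by move=> /submxP[u uE]; exists u; rewrite /A uE mulmxA mulmxKV.
have KA : inK Y A.
  have [//|u uE] := vA ord0; exists u => //; apply/mul_blockdiff_eq0 => a.
  have [|w] := vA (widen_ord (leqnSn _) a).
    by rewrite -val_eqE /= ltn_eqF// ltn_ord.
  rewrite uE !mul_mx_row !mulmx1 => /eq_row_mx[<- uY].
  by rewrite front0 uY.
have A0 : A = 0.
  rewrite -(K2 _ _ KA).
  have := vU ord_max; rewrite eqxx val_Gr_of_mx ?slide_rank// (mem_rowspace eB).
  move=> /submxP[w wE]; rewrite /A wE mulmxA mulmxKV//.
  by rewrite -mulmxA mulmxBl mul1mx (K2 _ _ K1) subrr mulmx0.
by rewrite -[v](vcoordK eB) -[vcoord e v](mulmxK ug) -/A A0 mul0mx linear0.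
Qed.

Lemma slide0 g P z : g \in unitmx -> in_charts eB g z ->
  row_full (blockdiff (charts eB g z)) -> row_free (blockdiff (charts eB g z)) ->
  slide g P z 0 = z.
Proof.
move=> ug cz fY frY; have fY' := fdiff_full fY.
apply/funext => a; rewrite /slide; case: eqVneq => [->|_]; last first.
  by rewrite cline0 chartK//; exact: cz.
rewrite cline0 subr0 mix1//; last exact: proj_lastP.
rewrite -[RHS](chartK ug (cz ord_max)).
set Y := charts eB g z.
have rk : \rank ((1%:M - proj_last Y) *m invmx g) = m.
  by rewrite -(mix1 fY' (proj_lastP fY frY)) slide_rank.
apply: eq_Gr_of_mx => //; apply: eqmx_sym; apply/eqmxP.
rewrite -mxrank_leqif_eq.
  by rewrite rk; have /eqP -> := cochart_free (chart eB g (z ord_max)) ug.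
rewrite submxMr//.
have := proj_last0 Y; rewrite -[Y ord_max]/(chart eB g (z ord_max)) => H.
by apply/submxP; exists (row_mx 1%:M (chart eB g (z ord_max)));
  rewrite mulmxBr mulmx1 H subr0.
Qed.

(** The matrix fdiff Y has more rows than columns, so pencils apply to it. *)
Theorem critical_simply_connected : simply_connected R (set_type S).
Proof.
have m0 : (0 < m)%N by rewrite mE mulSn; lia.
have mlk : m <> (l * k)%N by rewrite mE mulSn; lia.
have [r [L [Llin Lreg Lsurj Lrank]]] := pencil_selector C mlk.
have Om_gopen : gopen (fun Y : E => \rank (fdiff Y) = minn m (l * k)).
  by move=> G Y rY rkY; exact: (gev_rank_min (fdiff_reg rY) rkY).
have S_full g z : g \in unitmx -> S z -> in_charts eB g z ->
    row_full (blockdiff (charts eB g z)) /\ row_free (blockdiff (charts eB g z)).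
  move=> ug Sz cz; have [_] := @generic_set_charts R V m k l.+1 e eB g z ug Sz cz.
  by rewrite /row_full /row_free => ->; rewrite -mE minnn eqxx.
refine (@simply_connected_star R V m k l.+2 e eB S
  (@generic_set_zopen R V m k l.+1 e eB) (generic_set_neq0 l.+1 eB m0 k_gt0)
  _ Om_gopen _
  (fun P => pencil_ctr (@fdiff R m k l) L P) _ _
  (fun P Y => pencil_gen (@fdiff R m k l) L P Y) _ _ _ _).
- move=> g z ug Sz cz; apply/rank_fdiff_full; apply: fdiff_full.
  by have [] := S_full g z ug Sz cz.
- by apply: pencil_ctr_gopen => // G Y; exact: fdiff_reg.
- exact: (pencil_ctr_neq0 (@fdiff_surj R m k l) Lsurj).
- by move=> P _; apply: pencil_gen_gopen => // G Y; exact: fdiff_reg.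
- move=> P cP; exact: (pencil_gen_neq0 (@fdiff_surj R m k l) Lsurj cP).
- move=> P Y s cP gY _; apply: Lrank.
  exact: (pencil_line (@fdiff_cline R m k l) Llin).
move=> g P ug cP x y p q.
apply: (@contract_homotopic_in R _ S _ (slide g P) (fun a => if a == ord_max
  then Gr_of_mx eB ((1%:M - rho P) *m invmx g) else cochart eB g (P a))).
- move=> z [cz _]; have [fz frz] := S_full g _ ug (setval_in z) cz.
  exact: slide0.
- move=> z _; apply/funext => a; rewrite /slide cline1 subrr.
  by rewrite /mix scale0r addr0.
- move=> z s [cz sz] s01; apply: slide_in => //.
  by apply/rank_fdiff_full; exact: sz.
move=> f cf Uf w.
have ce : continuous (fun w : R * R => val (extend f w.1)).
  move=> v; apply: (@cvg_comp _ _ _ (fun w : R * R => extend f w.1) val).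
    exact: (comp_continuous (@fst_cont _ _) (extend_continuous cf)).
  exact: setval_cvg.
have cs : continuous (fun w : R * R => clampR w.2).
  exact: (comp_continuous (@snd_cont _ _) (@clampR_continuous R)).
pose Y (w : R * R) : E := charts eB g (val (extend f w.1)).
have cY a : gmx (G := cont_germ R w) (fun w => Y w a).
  apply: (@charts_cvg R V m k l.+2 e eB _ w (fun w => val (extend f w.1))).
    exact: ce.
  by have [+ _] := Uf (clamp w.1); apply.
pose Yc (w : R * R) : E := cline (Y w) P ((clampR w.2)%:C)%C.
have cr : cont_at w (fun w : R * R => ((clampR w.2)%:C)%C).
  by apply: cont_real; exact: cs.
have cYc a : gmx (G := cont_germ R w) (fun w => Yc w a).
  apply: (@gmx_cline_var _ _ _ _ (cont_germ R w)
    (fun w => ((clampR w.2)%:C)%C) Y (fun=> P) a); first exact: cr.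
    exact: cY.
  exact: gmx_cst.
have fYc w' : row_full (fdiff (Yc w')).
  have [_ sz] := Uf (clamp w'.1); apply/rank_fdiff_full; apply: sz.
  by have := clampR_itv w'.2; rewrite inE/= in_itv.
have fY w' : row_full (blockdiff (Y w')).
  have [cz _] := Uf (clamp w'.1).
  by have [] := S_full g _ ug (setval_in (f (clamp w'.1))) cz.
apply: ptws_cvg => a; rewrite /slide; case: eqVneq => _; last first.
  apply: (Gr_of_mx_cvg_free (F := fun w => row_mx 1%:M (Yc w a) *m invmx g)).
    apply: gmx_mul; last exact: gmx_cst.
    by apply: gmx_row_mx; [exact: gmx_cst|exact: cYc].
  exact: cochart_free.
apply: (Gr_of_mx_cvg (F := fun w : R * R =>
  (1%:M - mix (Yc w) (1 - (clampR w.2)%:C)%C (proj_last (Y w))) *m invmx g)).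
  apply: gmx_mul; last exact: gmx_cst.
  apply: gmx_sub; first exact: gmx_cst.
  have crho : gmx (G := cont_germ R w) (fun w => rho (Yc w)).
    by apply: rho_cont.
  apply: gmx_add; first exact: crho.
  apply: gmx_scale.
    by apply: (@greg_sub _ (cont_germ R w)); [exact: greg_cst|exact: cr].
  apply: gmx_mul; last exact: crho.
  apply: gmx_mul; last exact: proj_last_cont.
  by apply: gmx_sub; [exact: gmx_cst|exact: crho].
have FF : Filter (nbhs w) by exact: nbhs_filter.
by apply: (nearW FF) => w'; exact: slide_rank.
Qed.

End CriticalCase.

(** * Manifold structure *)

Lemma cluster_real (R : realType) (T : topologicalType) (u : T -> R) (p q : T) :
  cluster (nbhs p) q -> u @ p --> u p -> u @ q --> u q -> u p = u q.
Proof.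
move=> pq cp cq; apply/eqP; apply: contrapT => /negP upq.
have e0 : 0 < `|u p - u q| / 2 by rewrite divr_gt0// normr_gt0 subr_eq0.
have /cvgrPdist_lt/(_ _ e0) np := cp.
have /cvgrPdist_lt/(_ _ e0) nq := cq.
have [t [/= tp tq]] := pq _ _ np nq.
have : `|u p - u q| < `|u p - u q| / 2 + `|u p - u q| / 2.
  rewrite -{1}(subrK (u t) (u p)) -addrA.
  apply: le_lt_trans (ler_normD _ _) _; apply: ltrD; first exact: tp.
  by rewrite distrC; exact: tq.
by rewrite -splitr ltxx.
Qed.

Lemma near_dist (R : realType) (T : topologicalType) (u : T -> R) (x : T) (q r : R) :
  u @ x --> u x -> `|u x - q| < r -> \forall y \near x, `|u y - q| < r.
Proof.
move=> cu uxq; have e0 : 0 < r - `|u x - q| by rewrite subr_gt0.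
have /cvgrPdist_lt/(_ _ e0) := cu; apply: filterS => y yu.
have -> : u y - q = (u y - u x) + (u x - q) by rewrite addrA subrK.
by apply: le_lt_trans (ler_normD _ _) _; rewrite -ltrBrDr distrC.
Qed.

Lemma dist_lt_double (R : realType) (a b q r : R) :
  `|a - q| < r -> `|b - q| < r -> `|a - b| < 2 * r.
Proof.
move=> aq bq; rewrite mulr2n mulrDl !mul1r -(subrK q a) -addrA.
by apply: le_lt_trans (ler_normD _ _) _; apply: ltrD; rewrite // distrC.
Qed.

Lemma near_forall (T : topologicalType) (J : finType) (x : T) (f : J -> T -> Prop) :
  (forall j, \forall t \near x, f j t) -> \forall t \near x, forall j, f j t.
Proof. by move=> nf; apply: filter_forall. Qed.

Section Manifold.
Variables (R : realType) (V : vectType R[i]) (m k h : nat).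
Local Notation C := R[i].
Local Notation n := (m + k)%N.
Variables (e : n.-tuple V) (eB : basis_of {:V} e).
Local Notation Z := {ptws 'I_h -> Gr V m}.
Local Notation E := ('I_h -> 'M[C]_(m, k)).
Variable S : set Z.
Let X : topologicalType := set_type S.
Hypothesis S_zopen : zopen eB S.

Lemma mx_cvg (T U : topologicalType) (x : T) p q (F : T -> 'M[U]_(p, q)) :
  (forall i j, (fun t => F t i j) @ x --> F x i j) -> F @ x --> F x.
Proof.
move=> cF A [P nP PA].
have FF : Filter (nbhs x) by exact: nbhs_filter.
suff : \forall t \near x, forall i j, P i j (F t i j).
  by apply: filterS => t Pt; exact: PA.
by apply: filter_forall => i; apply: filter_forall => j; exact: cF.
Qed.

Lemma cvg_near_eq (T U : topologicalType) (x : T) (P : T -> Prop)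
    (F G : T -> U) :
  (forall t, P t -> F t = G t) -> (\forall t \near x, P t) ->
  G @ x --> G x -> F @ x --> F x.
Proof.
move=> FG nP cG; rewrite (FG _ (nbhs_singleton nP)); apply: cvg_trans cG.
apply: near_eq_cvg; have FF : Filter (nbhs x) by exact: nbhs_filter.
by apply: filterS nP => t /FG.
Qed.

(** Indices of the real coordinates of a family of complex matrices; the
    boolean selects the real or the imaginary part. *)
Definition cindex : finType := ('I_h * ('I_m * ('I_k * bool)))%type.
Local Notation d := #|{: cindex}|.

Definition real_coord (Y : E) : 'rV[R]_d :=
  \row_c (let p := enum_val c in
    let z := Y p.1 p.2.1 p.2.2.1 in
    if p.2.2.2 then complex.Re z else complex.Im z).

Definition of_real_coord (v : 'rV[R]_d) : E := fun a => \matrix_(i, j)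
  (v 0 (enum_rank ((a, (i, (j, true))) : cindex)) +i*
   v 0 (enum_rank ((a, (i, (j, false))) : cindex)))%C.

Lemma real_coordK Y : of_real_coord (real_coord Y) = Y.
Proof.
apply/funext => a; apply/matrixP => i j; rewrite !mxE !enum_rankK /=.
by case: (Y a i j).
Qed.

Lemma of_real_coordK v : real_coord (of_real_coord v) = v.
Proof.
apply/rowP => c; rewrite mxE; case E0 : (enum_val c) => [a [i [j b]]] /=.
by rewrite -[in RHS](enum_valK c) E0 mxE; case: b {E0}.
Qed.

Lemma of_real_coord_cont (v : 'rV[R]_d) a :
  gmx (G := cont_germ R v) (fun v => of_real_coord v a).
Proof.
move=> i j.
apply: (@greg_eq _ (cont_germ R v) (fun v : 'rV[R]_d =>
  (v 0 (enum_rank ((a, (i, (j, true))) : cindex)) +i*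
   v 0 (enum_rank ((a, (i, (j, false))) : cindex)))%C)) => [t|].
  by rewrite mxE.
by apply: cont_complex; exact: coord_continuous.
Qed.

Lemma cocharts_real_cvg g (v : 'rV[R]_d) : g \in unitmx ->
  (fun v => cocharts eB g (of_real_coord v)) @ v -->
  cocharts eB g (of_real_coord v).
Proof.
move=> ug; apply: (@cocharts_cvg R V m k h e eB _ v g of_real_coord ug) => a.
exact: of_real_coord_cont.
Qed.

Definition coordX g (x : X) : 'rV[R]_d := real_coord (charts eB g (val x)).

Lemma coordX_entry_cvg g (x : X) c : in_charts eB g (val x) ->
  (fun y => coordX g y 0 c) @ x --> coordX g x 0 c.
Proof.
move=> cx; rewrite /coordX; pose p := enum_val c.
have cz : cont_at x (fun y : X => charts eB g (val y) p.1 p.2.1 p.2.2.1).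
  have := @charts_cvg R V m k h e eB X x (fun y => val y) g p.1.
  apply; [exact: setval_cvg|exact: cx].
have E0 : (fun y : X => real_coord (charts eB g (val y)) 0 c) =
    (fun y : X => let z := charts eB g (val y) p.1 p.2.1 p.2.2.1 in
      if p.2.2.2 then complex.Re z else complex.Im z).
  by apply/funext => y; rewrite mxE.
rewrite E0 mxE -/p /=; case: p.2.2.2; [exact: cont_Re cz|exact: cont_Im cz].
Qed.

Lemma coordX_cvg g (x : X) : in_charts eB g (val x) -> coordX g @ x --> coordX g x.
Proof.
move=> cx; apply: mx_cvg => i c; rewrite (ord1 i); exact: coordX_entry_cvg.
Qed.

Lemma coordXK g (x : X) : g \in unitmx -> in_charts eB g (val x) ->
  cocharts eB g (of_real_coord (coordX g x)) = val x.
Proof. by move=> ug cx; rewrite real_coordK chartsK. Qed.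

Lemma in_charts_open g : open [set x : X | in_charts eB g (val x)].
Proof. by rewrite openE => x cx; exact: (@in_charts_near R V m k h e eB S x g cx). Qed.

Lemma zopen_locally_euclidean : locally_euclidean R d X.
Proof.
move=> x; have [g ug cx] := common_chart eB (val x : 'I_h -> Gr V m).
pose G (v : 'rV[R]_d) : X := insubd x (cocharts eB g (of_real_coord v)).
have GE v : S (cocharts eB g (of_real_coord v)) ->
    val (G v) = cocharts eB g (of_real_coord v).
  by move=> Sv; rewrite val_insubd (mem_set Sv).
have nV v : S (cocharts eB g (of_real_coord v)) ->
    \forall w \near v, S (cocharts eB g (of_real_coord w)).
  move=> Sv; apply: (@cont_gevP R _ v).
  apply: (S_zopen ug (G := cont_germ R v) (Y := of_real_coord)) => // a.
  exact: of_real_coord_cont.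
exists [set y | in_charts eB g (val y)],
  [set v | S (cocharts eB g (of_real_coord v))], (coordX g), G; split.
- by split; [exact: in_charts_open|exact: cx].
- by rewrite openE => v; exact: nV.
- rewrite continuous_open_subspace; last exact: in_charts_open.
  by move=> y /set_mem cy; exact: coordX_cvg.
- rewrite continuous_open_subspace; last by rewrite openE => v; exact: nV.
  move=> v /set_mem Sv; apply: lift_cvg.
  exact: (@cvg_near_eq 'rV[R]_d Z v
    (fun w => S (cocharts eB g (of_real_coord w))) (fun w => val (G w))
    (fun w => cocharts eB g (of_real_coord w)) GE (nV v Sv)
    (@cocharts_real_cvg g v ug)).
split=> [y cy|v Sv] /=.
  have yE := coordXK ug cy.
  have Sy : S (cocharts eB g (of_real_coord (coordX g y))).
    by rewrite yE; exact: setval_in.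
  by split=> //; apply: val_inj; rewrite GE.
have vE := GE _ Sv; split; first by rewrite vE; exact: in_cocharts.
by rewrite /coordX vE cochartsK// of_real_coordK.
Qed.

(** Two points lie in a common chart, where coordinates separate them. *)
Lemma zopen_hausdorff : hausdorff_space X.
Proof.
move=> p q pq; have [g [ug cp cq]] := common_charts2 eB (val p) (val q).
have pqE : coordX g p = coordX g q.
  apply/rowP => c; apply: (cluster_real (u := fun y => coordX g y 0 c) pq).
    exact: coordX_entry_cvg.
  exact: coordX_entry_cvg.
by apply: val_inj; rewrite -(coordXK ug cp) pqE coordXK.
Qed.

(** Entries are made integral one at a time, by moving along a complex line. *)
Lemma gopen_nat_point (P : ('I_1 -> 'M[C]_n) -> Prop) Y : gopen P -> P Y ->
  exists N : 'M[nat]_n, P (fun=> map_mx (fun j => j%:R) N).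
Proof.
move=> oP PY.
have [Y' [PY' Y'N]] : exists Y', P Y' /\ forall ij, ij \in enum {: 'I_n * 'I_n} ->
    exists j : nat, Y' ord0 ij.1 ij.2 = j%:R.
  elim: (enum _) => [|p s [Y' [PY' Y's]]]; first by exists Y; split.
  pose D : 'I_1 -> 'M[C]_n := fun a => Y' a + delta_mx p.1 p.2.
  have [q [q0 qP]] := gopen_line D oP PY'.
  have [j jq] : exists j : nat, q.[j%:R - Y' ord0 p.1 p.2] != 0.
    apply: (@poly_avoid _ _ (fun j : nat => j%:R - Y' ord0 p.1 p.2)).
      by move=> i j /addIr/natr_inj.
    exact: poly_horner_neq0 q0.
  exists (cline Y' D (j%:R - Y' ord0 p.1 p.2)); split; first exact: qP.
  move=> ij; rewrite inE /cline /D !mxE addrAC subrr add0r => ijs.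
  have [->|ijp] := eqVneq ij p.
    by exists j; rewrite !eqxx mulr1 addrC subrK.
  move: ijs; rewrite (negbTE ijp) /= => /Y's[j' j'E]; exists j'.
  rewrite (_ : (ij.1 == p.1) && (ij.2 == p.2) = false) ?mulr0 ?addr0//.
  by apply: contraNF ijp => /andP[/eqP e1 /eqP e2]; rewrite -pair_eqE /pair_eq e1 e2 !eqxx.
have [N NE] := choice (fun ij : 'I_n * 'I_n => Y'N ij (mem_enum _ ij)).
exists (\matrix_(i, j) N (i, j)).
suff <- : Y' = (fun=> map_mx (fun j => j%:R) (\matrix_(i, j) N (i, j))) by [].
by apply/funext => a; apply/matrixP => i j; rewrite !mxE (ord1 a) -(NE (i, j)).
Qed.

(** Countably many charts suffice, as g can be taken with integral entries;
    in each of them one takes the cubes with rational centres and radii 1 /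
    (r + 1). *)
Lemma zopen_second_countable : @second_countable X.
Proof.
pose B (p : 'M[nat]_n * {ffun 'I_d -> rat} * nat) : set X :=
  let g := map_mx (fun j => j%:R) p.1.1 : 'M[C]_n in
  [set x | in_charts eB g (val x) /\
    forall c, `|coordX g x 0 c - ratr (p.1.2 c)| < p.2.+1%:R^-1].
exists (range B).
  by apply: card_le_trans (card_image_le _ _) _; exact: countableP.
split.
  move=> _ [p _ <-]; rewrite openE => x [cx xp].
  have nc := @in_charts_near R V m k h e eB S x _ cx.
  have nd c := near_dist (u := fun y => coordX _ y 0 c) (coordX_entry_cvg cx) (xp c).
  by apply: filterS2 nc (near_forall nd) => y; split.
move=> x O; rewrite /= nbhsE => -[W [oW Wx] WO].
have [D oD DO] := subtype_open oW.
have [oP [Y PY]] := common_chart_gopen eB (val x : 'I_h -> Gr V m).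
have [N [uN cN]] := gopen_nat_point oP PY.
set g : 'M[C]_n := map_mx _ _ in uN cN.
have nD : nbhs (coordX g x) [set v | D (cocharts eB g (of_real_coord v))].
  apply: (@cocharts_real_cvg g (coordX g x) uN); apply: open_nbhs_nbhs; split=> //.
  by rewrite coordXK//; exact/DO.
have /nbhs_ballP[ep /= ep0 epD] := nD.
have [r rep] : exists r : nat, 2 * r.+1%:R^-1 < ep.
  have ep2 : 0 < ep / 2 by rewrite divr_gt0.
  have [r _ /(_ r (leqnn _))] := near_infty_natSinv_lt (PosNum ep2).
  by rewrite /= ltr_pdivlMr// mulrC; exists r.
have [q qE] : exists q : 'I_d -> rat,
    forall c, `|coordX g x 0 c - ratr (q c)| < r.+1%:R^-1.
  suff H c : exists q : rat, `|coordX g x 0 c - ratr q| < r.+1%:R^-1.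
    by have [q qE] := choice H; exists q.
  have lt_rx : coordX g x 0 c - r.+1%:R^-1 < coordX g x 0 c + r.+1%:R^-1.
    by rewrite ltrD2l gtrN// invr_gt0.
  have [q] := rat_in_itvoo lt_rx; rewrite in_itv /= => /andP[q1 q2].
  by exists q; rewrite ltr_distlC q1 q2.
exists (B (N, finfun q, r)); first split.
- by exists (N, finfun q, r).
- by split=> [|c]; [exact: cN|rewrite ffunE; exact: qE].
move=> y [/= cy yq]; apply: WO; apply/DO; rewrite -(coordXK uN cy).
apply: epD; rewrite /ball /= /mx_ball; split=> // i c; rewrite (ord1 i).
apply: lt_trans rep; apply: (dist_lt_double (qE c)).
by have := yq c; rewrite ffunE.
Qed.

Theorem zopen_manifold : topological_manifold R d X.
Proof.
split; [exact: zopen_hausdorff|exact: zopen_second_countable|].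
exact: zopen_locally_euclidean.
Qed.

End Manifold.

(** * Fundamental groups of homeomorphic spaces *)

Section Pi1Isomorphisms.
Variable R : realType.
Local Notation I := (unit_interval R).

Lemma group_isomorphic_trans (G H K : groupType) :
  group_isomorphic G H -> group_isomorphic H K -> group_isomorphic G K.
Proof.
move=> [f [bf fM]] [g [bg gM]]; exists (g \o f); split; first exact: bij_comp.
by move=> a b; rewrite /= fM gM.
Qed.

Section BasePoint.
Variables (X : topologicalType).

Lemma path_revK (x y : X) (p : {path I from x to y in X}) :
  path_rev (path_rev p) = p.
Proof.
apply/path_eqP => t.
have t0 := unit_interval_ge0 t; have t1 := unit_interval_le1 t.
rewrite -[LHS]/(rev_fun p (clamp (1 - val t))) /rev_fun val_clamp; last first.
  by apply/andP; split; lra.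
by rewrite subKr extend_val.
Qed.

Lemma path_catKp (x y z : X) (p : {path I from x to y in X})
    (q : {path I from x to z in X}) :
  homotopic (path_cat p (path_cat (path_rev p) q)) q.
Proof.
apply: homotopic_trans (path_catA _ _ _) _.
apply: homotopic_trans
  (homotopic_cat (path_catpV p) (homotopic_refl q)) (path_cat1p q).
Qed.

Definition move_base (x y : X) (p : {path I from x to y in X})
    (a : pi1 R x) : pi1 R y :=
  loop_class (path_cat (path_rev p) (path_cat (repr a) p)).

Lemma move_baseE (x y : X) (p : {path I from x to y in X}) q :
  move_base p (loop_class q) = loop_class (path_cat (path_rev p) (path_cat q p)).
Proof.
apply/loop_classP/homotopic_cat; first exact: homotopic_refl.
apply: homotopic_cat; [exact: repr_loop_class|exact: homotopic_refl].
Qed.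

Lemma move_baseK (x y : X) (p : {path I from x to y in X}) :
  cancel (move_base p) (move_base (path_rev p)).
Proof.
move=> a; rewrite -(loop_class_repr a) !move_baseE path_revK; apply/loop_classP.
set q := repr a.
apply: homotopic_trans
  (homotopic_cat (homotopic_refl p) (homotopic_sym (path_catA _ _ _))) _.
apply: homotopic_trans (path_catKp p _) _.
apply: homotopic_trans (homotopic_sym (path_catA _ _ _)) _.
apply: homotopic_trans (homotopic_cat (homotopic_refl q) (path_catpV p)) _.
exact: path_catp1.
Qed.

Lemma move_baseM (x y : X) (p : {path I from x to y in X}) :
  {morph move_base p : a b / (a * b)%g}.
Proof.
move=> a b; rewrite -(loop_class_repr a) -(loop_class_repr b).
set q := repr a; set r := repr b.
rewrite [(loop_class q * loop_class r)%g]pi1_mulE !move_baseE.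
rewrite [RHS]pi1_mulE; apply/loop_classP; apply: homotopic_sym.
apply: homotopic_trans (homotopic_sym (path_catA _ _ _)) _.
apply: homotopic_cat; first exact: homotopic_refl.
apply: homotopic_trans (homotopic_sym (path_catA _ _ _)) _.
apply: homotopic_trans _ (path_catA _ _ _).
apply: homotopic_cat; first exact: homotopic_refl.
exact: path_catKp.
Qed.

Lemma pi1_base_iso (x y : X) (p : {path I from x to y in X}) :
  group_isomorphic (pi1 R x) (pi1 R y).
Proof.
exists (move_base p); split; last exact: move_baseM.
exists (move_base (path_rev p)); first exact: move_baseK.
by have := @move_baseK _ _ (path_rev p); rewrite path_revK.
Qed.

End BasePoint.

Section Homeomorphism.
Variables (X Y : topologicalType) (f : X -> Y) (g : Y -> X).
Hypotheses (cf : continuous f) (cg : continuous g).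
Hypotheses (fK : cancel f g) (gK : cancel g f).

Section MapPath.
Variables (A B : topologicalType) (u : A -> B) (cu : continuous u).
Variables (x y : A) (x' y' : B) (ux : u x = x') (uy : u y = y').

Fact map_path_continuous (p : {path I from x to y in A}) :
  continuous (fun t => u (p t)).
Proof. exact: comp_continuous (@cts_fun _ _ p) cu. Qed.

Fact map_path_zero (p : {path I from x to y in A}) : u (p zero) = x'.
Proof. by rewrite path_zero. Qed.

Fact map_path_one (p : {path I from x to y in A}) : u (p one) = y'.
Proof. by rewrite path_one. Qed.

Definition map_path (p : {path I from x to y in A}) : {path I from x' to y' in B} :=
  mk_path (@map_path_continuous p) (map_path_zero p) (map_path_one p).

Lemma map_path_homotopic p q : homotopic p q -> homotopic (map_path p) (map_path q).
Proof.
move=> [H [cH Hpq Hxy]]; exists (fun w => u (H w)); split.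
- exact: comp_continuous cH cu.
- by move=> t; have [-> ->] := Hpq t.
- by move=> s; have [-> ->] := Hxy s.
Qed.

End MapPath.

Variables (x : X) (y : Y) (fx : f x = y).

Let gy : g y = x. Proof. by rewrite -fx fK. Qed.

Definition pi1_map (a : pi1 R x) : pi1 R y := loop_class (map_path cf fx fx (repr a)).

Lemma pi1_mapE p : pi1_map (loop_class p) = loop_class (map_path cf fx fx p).
Proof. by apply/loop_classP/map_path_homotopic; exact: repr_loop_class. Qed.

Definition pi1_map_inv (b : pi1 R y) : pi1 R x :=
  loop_class (map_path cg gy gy (repr b)).

Lemma pi1_map_invE p : pi1_map_inv (loop_class p) = loop_class (map_path cg gy gy p).
Proof. by apply/loop_classP/map_path_homotopic; exact: repr_loop_class. Qed.

Lemma pi1_homeo_iso : group_isomorphic (pi1 R x) (pi1 R y).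
Proof.
exists pi1_map; split.
  exists pi1_map_inv => a; rewrite -(loop_class_repr a).
    rewrite pi1_mapE pi1_map_invE; apply/loop_classP/path_ext => t.
    exact: fK.
  rewrite pi1_map_invE pi1_mapE; apply/loop_classP/path_ext => t.
  exact: gK.
move=> a b; rewrite -(loop_class_repr a) -(loop_class_repr b).
rewrite [(loop_class (repr a) * _)%g]pi1_mulE !pi1_mapE [RHS]pi1_mulE.
apply/loop_classP/path_ext => t.
rewrite [RHS]path_catE -[LHS]/(f (path_cat (repr a) (repr b) t)) path_catE.
by case: ifP.
Qed.

End Homeomorphism.
End Pi1Isomorphisms.

(** * Grassmannians of isomorphic spaces *)

Section GrTransfer.
Variables (R : realType) (m k : nat).
Local Notation C := R[i].
Local Notation n := (m + k)%N.

(** The image under the linear isomorphism that maps one basis to the other. *)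
Definition Gr_transfer (V V' : vectType C) (e : n.-tuple V) (eB : basis_of {:V} e)
    (e' : n.-tuple V') (eB' : basis_of {:V'} e') (W : Gr V m) : Gr V' m :=
  Gr_of_mx eB' (rep eB W).

Variables (V V' : vectType C) (e : n.-tuple V) (eB : basis_of {:V} e).
Variables (e' : n.-tuple V') (eB' : basis_of {:V'} e').

Lemma Gr_transfer_Gr_of_mx (M : 'M[C]_(m, n)) : row_free M ->
  Gr_transfer eB eB' (Gr_of_mx eB M) = Gr_of_mx eB' M.
Proof.
move=> fM; have [A uA repE] := rep_Gr_of_mx eB fM.
rewrite /Gr_transfer; apply: eq_Gr_of_mx; last exact/eqP/rep_free.
by rewrite repE; apply/eqmxMfull; rewrite row_full_unit.
Qed.

Lemma Gr_transfer_continuous : continuous (Gr_transfer eB eB').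
Proof.
apply/continuousP => A oA; apply: (@Gr_openP R V m k e eB) => M fM.
rewrite /= Gr_transfer_Gr_of_mx// => AM.
have nA : \forall N \near M, A (Gr_of_mx eB' N).
  have := @Gr_of_mx_cvg_free R V' m k e' eB' _ M id (@cont_id_mx R _ _ M) fM.
  by move=> /(_ _ (open_nbhs_nbhs (conj oA AM))).
by apply: filterS nA => N AN fN; rewrite Gr_transfer_Gr_of_mx.
Qed.

End GrTransfer.

Lemma Gr_transferK (R : realType) (m k : nat) (V V' : vectType R[i])
    (e : (m + k).-tuple V) (eB : basis_of {:V} e)
    (e' : (m + k).-tuple V') (eB' : basis_of {:V'} e') :
  cancel (Gr_transfer eB eB') (Gr_transfer eB' eB).
Proof.
move=> W; rewrite {2}/Gr_transfer Gr_transfer_Gr_of_mx ?repK//.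
exact: rep_free.
Qed.

Section LinesInThePlane.
Variable R : realType.
Local Notation C := R[i].

Lemma basis_tuple (V : vectType C) n : \dim {:V} = n ->
  exists e : n.-tuple V, basis_of {:V} e.
Proof. by move=> <-; exists (vbasis {:V}); exact: vbasisP. Qed.

Lemma homeo_subset (Z Z' : topologicalType) (T : Z -> Z') (T' : Z' -> Z)
    (S : set Z) (S' : set Z') :
  continuous T -> continuous T' -> cancel T T' -> cancel T' T ->
  (forall z, S z <-> S' (T z)) ->
  exists (f : set_type S -> set_type S') (g : set_type S' -> set_type S),
    [/\ continuous f, continuous g, cancel f g & cancel g f].
Proof.
move=> cT cT' TK T'K SS'.
have S'S z : S' z -> S (T' z) by move=> Sz; apply/SS'; rewrite T'K.
pose f (x : set_type S) : set_type S' :=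
  exist (fun z => z \in S') (T (val x)) (mem_set (proj1 (SS' _) (setval_in x))).
pose g (x : set_type S') : set_type S :=
  exist (fun z => z \in S) (T' (val x)) (mem_set (S'S _ (setval_in x))).
exists f, g; split.
- move=> x; apply: lift_cvg.
  exact: (@cvg_comp _ _ _ (fun x : set_type S => val x) T _ _ _ (@setval_cvg _ S x)
    (cT _)).
- move=> x; apply: lift_cvg.
  exact: (@cvg_comp _ _ _ (fun x : set_type S' => val x) T' _ _ _ (@setval_cvg _ S' x)
    (cT' _)).
- by move=> x; apply: val_inj; rewrite /= TK.
- by move=> x; apply: val_inj; rewrite /= T'K.
Qed.

(** The intersection of two distinct lines is trivial. *)
Lemma lines_bigcap (V : vectType C) h (z : {ptws 'I_h -> Gr V 1}) : (2 <= h)%N ->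
  configurations z -> \dim (\bigcap_(a < h) val (z a))%VS = 0.
Proof.
move=> h2 cz; pose a : 'I_h := Ordinal (ltnW h2); pose b : 'I_h := Ordinal h2.
set K := (\bigcap_(a < h) _)%VS.
have Kle c : (K <= val (z c))%VS by exact: (bigcapv_inf c isT (subvv _)).
have dz c : \dim (val (z c)) = 1%N by apply/eqP; exact: (valP (z c)).
apply/eqP; rewrite -leqn0 leqNgt; apply/negP => K0.
have KE c : K = val (z c) by apply/eqP; rewrite eqEdim Kle dz.
have /negP := cz a b isT; apply; apply/eqP/val_inj.
by rewrite -[LHS]KE -[RHS]KE.
Qed.

Lemma dim_dual_space n : \dim {:dual_space R n} = n.
Proof. by rewrite dimvf; rewrite /dim /=; rewrite /dim /= ?muln1. Qed.

End LinesInThePlane.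

Lemma configurations_homeo (R : realType) (m k h : nat) (V V' : vectType R[i])
    (e : (m + k).-tuple V) (eB : basis_of {:V} e)
    (e' : (m + k).-tuple V') (eB' : basis_of {:V'} e')
    (S : set {ptws 'I_h -> Gr V m}) :
  (forall z, S z <-> configurations z) ->
  exists (f : set_type S -> conf_space h (Gr V' m))
         (g : conf_space h (Gr V' m) -> set_type S),
    [/\ continuous f, continuous g, cancel f g & cancel g f].
Proof.
move=> Sz.
pose T (z : {ptws 'I_h -> Gr V m}) : {ptws 'I_h -> Gr V' m} :=
  fun a => Gr_transfer eB eB' (z a).
pose T' (z : {ptws 'I_h -> Gr V' m}) : {ptws 'I_h -> Gr V m} :=
  fun a => Gr_transfer eB' eB (z a).
apply: (@homeo_subset _ _ T T').
- move=> z; apply: ptws_cvg => a.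
  apply: (@cvg_comp _ _ _ (fun z : {ptws 'I_h -> Gr V m} => z a)).
    exact: (@ptws_proj_cvg _ _ _ id z a cvg_id).
  exact: Gr_transfer_continuous.
- move=> z; apply: ptws_cvg => a.
  apply: (@cvg_comp _ _ _ (fun z : {ptws 'I_h -> Gr V' m} => z a)).
    exact: (@ptws_proj_cvg _ _ _ id z a cvg_id).
  exact: Gr_transfer_continuous.
- by move=> z; apply/funext => a; exact: Gr_transferK.
- by move=> z; apply/funext => a; exact: Gr_transferK.
move=> z; rewrite Sz; split=> cz a b ab; apply: contra (cz a b ab) => /eqP zab.
  by apply/eqP; apply: (can_inj (Gr_transferK eB eB')).
by rewrite /T zab.
Qed.

(** * Topology of the dual configuration spaces *)

Theorem mainTheorem3 (R : realType) (n k h : nat)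
    (k_gt0 : (0 < k)%N) (k_lt_n : (k < n)%N) (h_ge2 : (2 <= h)%N) :
  let F := dual_conf_space R h (maxn 0 (n - h * k)) (n - k) n in
  (n <> 2%N ->
    simply_connected R F /\ (exists d : nat, topological_manifold R d F)) /\
  (n = 2%N ->
    let F_CP1 := conf_space h (CP R 1) in
    inhabited F /\ inhabited F_CP1 /\
    forall (x : F) (y : F_CP1), group_isomorphic (pi1 R x) (pi1 R y)).
Proof.
have [m nE] : exists m, n = (m + k)%N by exists (n - k)%N; rewrite subnK// ltnW.
subst n; rewrite addnK.
have m_gt0 : (0 < m)%N by lia.
case: h h_ge2 => [//|[//|l]] h_ge2 F.
have [e eB] := basis_tuple (dim_dual_space R (m + k)).
pose S : set {ptws 'I_l.+2 -> Gr (dual_space R (m + k)) m} :=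
  generic_set (maxn 0 (m + k - l.+2 * k)).
have S_zopen : zopen eB S by exact: generic_set_zopen.
have S_neq0 : exists z, S z by exact: (generic_set_neq0 _ eB).
split=> [n2|n2].
  split; last by eexists; exact: (zopen_manifold S_zopen).
  have [mlk|mlk] := eqVneq m (l.+1 * k)%N.
    exact: (critical_simply_connected eB k_gt0 mlk).
  apply: (generic_simply_connected eB m_gt0 k_gt0); first exact/eqP.
  by case: m k m_gt0 k_gt0 n2 {k_lt_n e eB F S S_zopen S_neq0 mlk} => [|[|m]] [|[|k]]//; nia.
have [m1 k1] : m = 1%N /\ k = 1%N by lia.
subst m k; move=> F_CP1.
have [e' eB'] := @basis_tuple R 'cV[R[i]]_2 2 (etrans (dimvf _) (dim_matrix _ _ _)).
have SE z : S z <-> configurations z.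
  split=> [[]//|cz]; split=> //; rewrite lines_bigcap//; lia.
have [f [g [cf cg fK gK]]] := configurations_homeo eB eB' SE.
have [[z] conn] := zopen_path_connected S_zopen S_neq0.
split; first by split; exact: z.
split; first by split; exact: (f z).
move=> x y; have [p] := conn x (g y).
apply: group_isomorphic_trans (pi1_base_iso p) _.
exact: (@pi1_homeo_iso R _ _ f g cf cg fK gK (g y) y (gK y)).
Qed.
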